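(* Assume (A0)–(A3) as in the context, $r>-1$, and that (M$_p$) holds for some $p>\max\{2,1+r\}$. Then for any $\varepsilon>0$, for all $x$ sufficiently large, $$x^{-\frac{1+r}{2}}(\log x)^{-\varepsilon}\le\mathbb{P}[\eta_1\ge x]\le x^{-\frac{1+r}{2}}(\log x)^{2+r+\varepsilon}.$$ In particular $\mathbb{E}[\eta_1^{(1+r)/2}]=\infty$ but $\mathbb{E}[\eta_1^{(1+r)/2-\varepsilon}]<\infty$ for every $\varepsilon>0$.
   Context: $\mathbb{N}=\{1,2,\dots\}$. (A0): $\mathbb{S}$ is a locally finite (every bounded set meets it in finitely many points), unbounded subset of $[0,\infty)$ with $0\in\mathbb{S}$; $(X_t)_{t\in\mathbb{N}}$ is an $\mathbb{S}$-valued process adapted to a filtration $(\mathcal{F}_t)_{t\in\mathbb{N}}$ with $\mathbb{P}[X_1=0]=1$. (A1): for each $x,y\in\mathbb{S}$ there exist $m(x,y)\in\mathbb{N}$, $\varphi(x,y)>0$ with $\mathbb{P}[X_{t+m(X_t,y)}=y\mid\mathcal{F}_t]\ge\varphi(X_t,y)$ a.s. for all $t$. Write $\Delta_t:=X_{t+1}-X_t$. (A2): there are $c\in\mathbb{R}$, $s^2\in(0,\infty)$ with, as $X_t\to\infty$, $\mathbb{E}[\Delta_t\mid\mathcal{F}_t]=cX_t^{-1}+o(X_t^{-1}(\log X_t)^{-1})$ and $\mathbb{E}[\Delta_t^2\mid\mathcal{F}_t]=s^2+o((\log X_t)^{-1})$ a.s., where the implicit constants in $o(\cdot)$ are non-random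 and uniform in $t$ and in the sample point. Set $r:=-2c/s^2$. Excursions: $\tau_0:=1$, $\tau_n:=\min\{t>\tau_{n-1}:X_t=0\}$ ($\min\emptyset=\infty$), $\eta_n:=\tau_n-\tau_{n-1}$, $\mathcal{E}_n:=(X_t)_{\tau_{n-1}\le t\le\tau_n-1}$, $N:=\min\{n\in\mathbb{N}:\tau_n=\infty\}$. (A3): (a) on $\{N=\infty\}$, $(\mathcal{E}_n)_{n\in\mathbb{N}}$ is i.i.d.; (b) $\mathbb{P}[\eta_{n+1}<\infty\mid\tau_n<\infty]=\mathbb{P}[\eta_1<\infty]$ for all $n$. (M$_p$): there exist $\delta>0$, $C<\infty$ with $\mathbb{E}[|\Delta_t|^p\mid\mathcal{F}_t]\le C(1+X_t)^{p-2-\delta}$ a.s. for all $t$. *)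

(* Defs.v *)
From HB Require Import structures.
From mathcomp Require Import all_boot all_order all_algebra.
From mathcomp Require Import all_classical all_reals all_analysis.
From mathcomp Require Import measurable_realfun.
Set Implicit Arguments. Unset Strict Implicit. Unset Printing Implicit Defensive.
Import Order.TTheory GRing.Theory Num.Theory.
Import numFieldNormedType.Exports.
Local Open Scope classical_set_scope.
Local Open Scope ring_scope.

Section defs.
Context {d : measure_display} {T : measurableType d} {R : realType}.
Variable P : probability T R.

Definition sub_sigma (G : set (set T)) : Prop :=
  sigma_algebra setT G /\ G `<=` measurable.

(** (F_t)_{t in N={1,2,...}} is a filtration (only indices t >= 1 matter). *)
Definition filtration (F : nat -> set (set T)) : Prop :=
  (forall t, (0 < t)%N -> sub_sigma (F t)) /\
  (forall t, (0 < t)%N -> F t `<=` F t.+1).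

Definition G_meas (G : set (set T)) (Y : T -> R) : Prop :=
  forall B : set R, measurable B -> G (Y @^-1` B).

Definition cexp_nonneg (G : set (set T)) (Y Z : T -> \bar R) : Prop :=
  [/\ (forall w, 0 <= Z w)%E,
      (forall B : set (\bar R), measurable B -> G (Z @^-1` B)) &
      (forall A, G A -> (\int[P]_(w in A) Y w = \int[P]_(w in A) Z w)%E)].

Definition posE (y : R) : \bar R := (Num.max y 0)%:E.
Definition negE (y : R) : \bar R := (Num.max (- y) 0)%:E.

Definition incr (X : nat -> T -> R) (t : nat) (w : T) : R := X t.+1 w - X t w.

Definition A0 (S : set R) (F : nat -> set (set T)) (X : nat -> T -> R) : Prop :=
  [/\ (forall x, S x -> 0 <= x),
      (forall M : R, finite_set [set x | S x /\ x <= M]),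
      (forall M : R, exists x, S x /\ M < x) &
      S 0] /\
  [/\ filtration F,
      (forall t, (0 < t)%N -> forall w, S (X t w)),
      (forall t, (0 < t)%N -> G_meas (F t) (X t)) &
      P [set w | X 1%N w = 0] = 1%E].

Definition A1 (S : set R) (F : nat -> set (set T)) (X : nat -> T -> R) : Prop :=
  exists (m : R -> R -> nat) (phi : R -> R -> R),
    (forall x y, S x -> S y -> (0 < m x y)%N /\ 0 < phi x y) /\
    forall t, (0 < t)%N -> forall y, S y ->
      exists Z : T -> \bar R,
        cexp_nonneg (F t)
          (fun w => (\1_[set w' | X (t + m (X t w') y)%N w' = y] w)%:E) Z /\
        {ae P, forall w, ((phi (X t w) y)%:E <= Z w)%E}.

(** (A2), with r := -2c/s^2 defined in the theorem.  The o(.) terms are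
    written out: for every eps > 0 there is a (non-random) x0 such that,
    for every t and almost surely on {X_t >= x0}, the error is at most eps
    times the displayed rate.  E[Delta_t | F_t] is the generalized conditional
    expectation E[Delta_t^+ | F_t] - E[Delta_t^- | F_t] (both finite there). *)
Definition A2 (c s2 : R) (F : nat -> set (set T)) (X : nat -> T -> R) : Prop :=
  0 < s2 /\
  forall eps : R, 0 < eps -> exists x0 : R,
    forall t, (0 < t)%N ->
      (exists Zp Zm : T -> \bar R,
         cexp_nonneg (F t) (fun w => posE (incr X t w)) Zp /\
         cexp_nonneg (F t) (fun w => negE (incr X t w)) Zm /\
         {ae P, forall w, x0 <= X t w ->
            [/\ Zp w \is a fin_num, Zm w \is a fin_num &
                `| fine (Zp w) - fine (Zm w) - c / X t w |
                   <= eps / (X t w * ln (X t w))]}) /\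
      (exists Z2 : T -> \bar R,
         cexp_nonneg (F t) (fun w => ((incr X t w) ^+ 2)%:E) Z2 /\
         {ae P, forall w, x0 <= X t w ->
            Z2 w \is a fin_num /\
            `| fine (Z2 w) - s2 | <= eps / ln (X t w)}).

(** Return times to 0:  tau_0 = 1,  tau_n = min{t > tau_{n-1} : X_t = 0},
    with None standing for +infinity. *)
Definition next_zero (X : nat -> T -> R) (w : T) (s : nat) : option nat :=
  match pselect (exists t, (s < t)%N /\ X t w = 0) with
  | left h =>
      Some (@ex_minn (fun t => (s < t)%N && `[< X t w = 0 >])
              (let: ex_intro t (conj h1 h2) := h in
               ex_intro _ t (introT andP (conj h1 (asboolT h2)))))
  | right _ => None
  end.

Fixpoint tau (X : nat -> T -> R) (n : nat) (w : T) : option nat :=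
  match n with
  | 0 => Some 1%N
  | n'.+1 => obind (next_zero X w) (tau X n' w)
  end.

(** eta_n = tau_n - tau_{n-1} (None = +infinity), for n >= 1. *)
Definition ret_eta (X : nat -> T -> R) (n : nat) (w : T) : option nat :=
  match tau X n.-1 w, tau X n w with
  | Some a, Some b => Some (b - a)%N
  | _, _ => None
  end.

Definition Ninf (X : nat -> T -> R) : set T :=
  [set w | forall n, tau X n w <> None].

(** The n-th excursion E_n = (X_t)_{tau_{n-1} <= t <= tau_n - 1}
    (meaningful when tau_n < infinity; junk [::] otherwise). *)
Definition excursion (X : nat -> T -> R) (n : nat) (w : T) : seq R :=
  match tau X n.-1 w, tau X n w with
  | Some a, Some b => [seq X t w | t <- iota a (b - a)]
  | _, _ => [::]
  end.

(** (A3)(a): on {N = infinity}, (E_n)_n is i.i.d., i.e. i.i.d. under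
    P( . | N = infinity) whenever P(N = infinity) > 0.
    (A3)(b): P[eta_{n+1} < infinity | tau_n < infinity] = P[eta_1 < infinity],
    written multiplicatively (so it is vacuous when P[tau_n < oo] = 0). *)
Definition A3 (X : nat -> T -> R) : Prop :=
  (0 < fine (P (Ninf X)) ->
    forall (n : nat) (B : nat -> set (seq R)),
      fine (P (Ninf X `&` [set w | forall i, (i <= n)%N -> B i (excursion X i.+1 w)]))
        / fine (P (Ninf X))
      = \prod_(i < n.+1)
          (fine (P (Ninf X `&` [set w | B i (excursion X 1 w)])) / fine (P (Ninf X))))
  /\
  (forall n, (0 < n)%N ->
     P ([set w | tau X n w <> None] `&` [set w | ret_eta X n.+1 w <> None])
     = (P [set w | tau X n w <> None] * P [set w | ret_eta X 1 w <> None])%E).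

Definition Mp (p : R) (F : nat -> set (set T)) (X : nat -> T -> R) : Prop :=
  exists delta C : R, 0 < delta /\
    forall t, (0 < t)%N ->
      exists Z : T -> \bar R,
        cexp_nonneg (F t) (fun w => (`|incr X t w| `^ p)%:E) Z /\
        {ae P, forall w, (Z w <= (C * (1 + X t w) `^ (p - 2 - delta))%:E)%E}.

Definition eta1_pow (X : nat -> T -> R) (a : R) (w : T) : \bar R :=
  match ret_eta X 1 w with
  | Some k => ((k%:R : R) `^ a)%:E
  | None => +oo%E
  end.

End defs.

(* Main.v *)
(** Outside a bounded set the drift of [u^(1+r) (ln u)^n] along the process has the
    sign of [n]: the exponent [1+r] makes the leading terms of (A2) cancel.  Stopping
    at [0] and at a high level, the supermartingale [n < 0] and the submartingale
    [n > 0] show that an excursion reaches height [y] with probability [y^-(1+r)] up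
    to a power of [ln y].  The function [u^g], with [0 < g < min (1+r) 2], together
    with the irreducibility (A1) on the bounded part, shows that the time spent below
    [y] has geometric tails on the scale [y^2]; conversely the function
    [max (y - u) 0 ^ 2] shows that from height [y] the process stays above [y/2] for a
    fraction of [y^2] steps with probability at least [1/2].  The upper bound follows
    with [y = sqrt x / ln x], the lower bound with [y] of order [sqrt x].  (A3) only
    serves to show that the first excursion reaches large heights with positive
    probability.  The moments are compared with dyadic sums of the tail. *)
Require Import Defs.
From HB Require Import structures.
From mathcomp Require Import all_boot all_order all_algebra.
From mathcomp Require Import all_classical all_reals all_analysis.
From mathcomp Require Import measurable_realfun ring lra.
Import Order.TTheory GRing.Theory Num.Theory.
Import numFieldNormedType.Exports.
Local Open Scope classical_set_scope.
Local Open Scope ring_scope.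
Set Implicit Arguments. Unset Strict Implicit. Unset Printing Implicit Defensive.

(** * Calculus of the Lyapunov functions *)

Section calculus.
Context {R : realType}.
Implicit Types a b u x y z s M : R.

Lemma mean_value_le (g g' : R -> R) x y M :
  (forall u, `|u - x| <= `|y - x| -> is_derive u 1 g (g' u)) ->
  (forall u, `|u - x| <= `|y - x| -> `|g' u| <= M) ->
  `|g y - g x| <= M * `|y - x|.
Proof.
move=> dg bg.
have key a b : a <= b -> (forall u, a <= u <= b -> `|u - x| <= `|y - x|) ->
    `|g b - g a| <= M * `|b - a|.
  move=> ab H.
  have [| |xi xiab ->] := @MVT_segment _ g g' _ _ ab.
  - by move=> u /[!in_itv]/= /andP[/ltW ? /ltW ?]; apply/dg/H/andP.
  - apply: derivable_within_continuous => u /[!in_itv]/= uab.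
    by have [] := dg _ (H _ uab).
  - rewrite normrM ler_wpM2r//; apply/bg/H.
    by move: xiab; rewrite in_itv.
have [xy|/ltW yx] := leP x y.
  apply: key => // u /andP[? ?].
  by rewrite !ger0_norm ?subr_ge0// ?lerD2r// (le_trans xy).
rewrite distrC [`|y - x|]distrC; apply: key => // u /andP[? ?].
by rewrite distrC [`|y - x|]distrC !ger0_norm ?subr_ge0// lerD2l lerN2.
Qed.

Lemma taylor2_le (f f1 f2 f3 : R -> R) x z M :
  (forall u, `|u - x| <= `|z| -> is_derive u 1 f (f1 u)) ->
  (forall u, `|u - x| <= `|z| -> is_derive u 1 f1 (f2 u)) ->
  (forall u, `|u - x| <= `|z| -> is_derive u 1 f2 (f3 u)) ->
  (forall u, `|u - x| <= `|z| -> `|f3 u| <= M) ->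
  `|f (x + z) - f x - f1 x * z - f2 x * z ^+ 2 / 2| <= M * `|z| ^+ 3.
Proof.
move=> d0 d1 d2 b3.
have M0 : 0 <= M by rewrite (le_trans (normr_ge0 (f3 x)))// b3// subrr normr0.
have b2 u : `|u - x| <= `|z| -> `|f2 u - f2 x| <= M * `|z|.
  move=> ux; apply: (@le_trans _ _ (M * `|u - x|)); last by rewrite ler_wpM2l.
  by apply: (@mean_value_le f2 f3) => v vx; [apply: d2|apply: b3];
    rewrite (le_trans vx).
have b1 u : `|u - x| <= `|z| -> `|f1 u - f1 x - f2 x * (u - x)| <= M * `|z| * `|z|.
  move=> ux; apply: (@le_trans _ _ (M * `|z| * `|u - x|)); last first.
    by rewrite ler_wpM2l// mulr_ge0.
  have := @mean_value_le (fun v => f1 v - f2 x * (v - x)) (fun v => f2 v - f2 x)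
    x u (M * `|z|).
  rewrite subrr mulr0 subr0 [f1 u - f1 x - _]addrAC; apply => v vx.
    have H := d1 v (le_trans vx ux).
    by apply: is_derive_eq; rewrite /GRing.scale/= subr0 mulr1.
  by apply: b2; rewrite (le_trans vx).
have := @mean_value_le
  (fun v => f v - f1 x * (v - x) - f2 x * (v - x) ^+ 2 / 2)
  (fun v => f1 v - f1 x - f2 x * (v - x)) x (x + z) (M * `|z| * `|z|).
rewrite subrr mulr0 subr0 expr0n/= mulr0 mul0r subr0 (addrC x z) addrK.
rewrite (_ : f _ - _ - _ - _ = f (z + x) - f x - f1 x * z - f2 x * z ^+ 2 / 2).
  move=> H; rewrite (le_trans (H _ _))//.
  - move=> u ux; have H' := d0 u ux.
    apply: is_derive_eq; rewrite /GRing.scale/= subr0 !mulr1.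
    move: (f1 u) (f1 x) (f2 x) => p q r.
    by field.
  - by rewrite !exprS expr0 mulr1 !mulrA.
by ring.
Qed.

Definition powln a b u : R := u `^ a * ln u `^ b.

Lemma is_derive_powln a b u : 1 < u ->
  is_derive u 1 (powln a b) (a * powln (a - 1) b u + b * powln (a - 1) (b - 1) u).
Proof.
move=> u1; have u0 : 0 < u by rewrite (lt_trans _ u1).
have l0 : 0 < ln u by rewrite ln_gt0.
have d1 := @is_derive1_powR R a u u0.
have dl := @is_derive1_ln R u u0.
have d2 := @is_derive1_powR R b (ln u) l0.
have d3 : is_derive u 1 (fun v => ln v `^ b) (b * ln u `^ (b - 1) * u^-1).
  exact: (@is_derive1_comp _ (fun v => v `^ b) (@ln R) u _ _ d2 dl).
rewrite /powln.
apply: is_derive_eq; rewrite /GRing.scale/=.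
rewrite -(powR_inv1 (ltW u0)).
rewrite (_ : a - 1 = -1 + a); last by rewrite addrC.
rewrite (@powRD _ u (-1) a) ?(gt_eqF u0) ?implybT//; ring.
Qed.

Lemma powln_gt0 a b u : 1 < u -> 0 < powln a b u.
Proof.
by move=> u1; rewrite mulr_gt0// powR_gt0// ?ln_gt0// (lt_trans _ u1).
Qed.

Lemma ln_ge1 u : expR 1 <= u -> 1 <= ln u.
Proof.
move=> eu; rewrite -[leLHS](expRK (1 : R)) ler_ln// ?posrE ?expR_gt0//.
by rewrite (lt_le_trans _ eu)// expR_gt0.
Qed.

Lemma expR1_gt1 : 1 < expR 1 :> R.
Proof. by rewrite expR_gt1. Qed.

Lemma powR_ln_le b s : 0 < s ->
  exists2 C : R, 0 < C & forall u, expR 1 <= u -> ln u `^ b <= C * u `^ s.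
Proof.
move=> s0; have [b0|b0] := leP b 0.
  exists 1 => // u eu; rewrite mul1r (@le_trans _ _ 1)//.
    by rewrite -(powRr0 (ln u)) ler_powR// ln_ge1.
  by rewrite -(powRr0 u) ler_powR// ?(ltW s0)// (le_trans _ eu)// ltW// expR1_gt1.
exists ((b / s) `^ b); first exact: powR_gt0 (divr_gt0 b0 s0).
move=> u eu; have u0 : 0 < u by rewrite (lt_le_trans _ eu)// expR_gt0.
rewrite (_ : u `^ s = (u `^ (s / b)) `^ b); last by rewrite -powRrM divfK// gt_eqF.
rewrite -powRM ?powR_ge0//; last by rewrite divr_ge0// ltW.
apply: ge0_ler_powR => //; first exact: ltW.
- by rewrite nnegrE (le_trans _ (ln_ge1 eu)).
- by rewrite nnegrE mulr_ge0 ?powR_ge0// divr_ge0// ltW.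
have := ln_sublinear (powR_gt0 (s / b) u0).
rewrite ln_powR => /ltW H.
rewrite -(ler_pM2l (divr_gt0 s0 b0)) mulrA.
by rewrite (_ : s / b * (b / s) = 1) ?mul1r//; field; rewrite !gt_eqF.
Qed.

Lemma powln_le b s : 0 < s ->
  exists2 C : R, 0 < C & forall a u, expR 1 <= u -> powln a b u <= C * u `^ (a + s).
Proof.
move=> s0; have [C C0 H] := powR_ln_le b s0; exists C => // a u eu.
have u0 : 0 < u by rewrite (lt_le_trans _ eu)// expR_gt0.
rewrite powRD ?(gt_eqF u0) ?implybT// mulrCA.
by rewrite ler_wpM2l ?powR_ge0// H.
Qed.

Lemma gt0_powRD u a b : 0 < u -> u `^ (a + b) = u `^ a * u `^ b.
Proof. by move=> u0; rewrite powRD// (gt_eqF u0) implybT. Qed.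

Lemma powR_le_near a u x : 0 < x -> x / 2 <= u <= 2 * x ->
  u `^ a <= 2 `^ `|a| * x `^ a.
Proof.
move=> x0 /andP[xu ux].
have u0 : 0 < u by rewrite (lt_le_trans _ xu)// divr_gt0.
rewrite /powR !gt_eqF// -expRD ler_expR.
have l2 : ln u <= ln 2 + ln x by rewrite -lnM ?posrE// ler_ln ?posrE ?mulr_gt0.
have l1 : ln x - ln 2 <= ln u by rewrite -ln_div ?posrE// ler_ln ?posrE ?divr_gt0.
have [a0|/ltW a0] := leP 0 a.
  by rewrite ger0_norm// -mulrDr ler_wpM2l.
by rewrite ler0_norm// mulNr -mulrN -mulrDr ler_wnM2l// addrC.
Qed.

Lemma powR_le_higher q p x z : q <= p -> 0 < x -> x / 2 <= z ->
  z `^ q <= 2 `^ (p - q) * (x `^ (q - p) * z `^ p).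
Proof.
move=> qp x0 xz; have z0 : 0 < z by rewrite (lt_le_trans _ xz)// divr_gt0.
rewrite /powR !gt_eqF// -!expRD ler_expR.
have l1 : ln x - ln 2 <= ln z by rewrite -ln_div ?posrE// ler_ln ?posrE ?divr_gt0.
have : (p - q) * (ln x - ln 2) <= (p - q) * ln z by rewrite ler_wpM2l// subr_ge0.
lra.
Qed.

Section powln_derivatives.
Variables g n : R.

Definition powln1 u := g * powln (g - 1) n u + n * powln (g - 1) (n - 1) u.
Definition powln2 u := g * (g - 1) * powln (g - 2) n u
  + n * (2 * g - 1) * powln (g - 2) (n - 1) u
  + n * (n - 1) * powln (g - 2) (n - 2) u.
Definition powln3 u :=
  g * (g - 1) * ((g - 2) * powln (g - 3) n u + n * powln (g - 3) (n - 1) u)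
  + n * (2 * g - 1) * ((g - 2) * powln (g - 3) (n - 1) u
                       + (n - 1) * powln (g - 3) (n - 2) u)
  + n * (n - 1) * ((g - 2) * powln (g - 3) (n - 2) u
                   + (n - 2) * powln (g - 3) (n - 3) u).

Lemma is_derive_powln1 u : 1 < u -> is_derive u 1 powln1 (powln2 u).
Proof.
move=> u1; have d1 := @is_derive_powln (g - 1) n u u1.
have d2 := @is_derive_powln (g - 1) (n - 1) u u1.
rewrite /powln1; apply: is_derive_eq; rewrite /GRing.scale/= /powln2.
rewrite (_ : g - 1 - 1 = g - 2); last by ring.
rewrite (_ : n - 1 - 1 = n - 2); last by ring.
ring.
Qed.

Lemma is_derive_powln2 u : 1 < u -> is_derive u 1 powln2 (powln3 u).
Proof.
move=> u1; have d1 := @is_derive_powln (g - 2) n u u1.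
have d2 := @is_derive_powln (g - 2) (n - 1) u u1.
have d3 := @is_derive_powln (g - 2) (n - 2) u u1.
rewrite /powln2; apply: is_derive_eq; rewrite /GRing.scale/= /powln3.
rewrite (_ : g - 2 - 1 = g - 3); last by ring.
rewrite (_ : n - 1 - 1 = n - 2); last by ring.
rewrite (_ : n - 2 - 1 = n - 3); last by ring.
ring.
Qed.

Lemma powln_derivatives_le s : 0 < s -> exists2 C : R, 0 < C & forall u, expR 1 <= u ->
  [/\ powln g n u <= C * u `^ (g + s), `|powln1 u| <= C * u `^ (g - 1 + s),
      `|powln2 u| <= C * u `^ (g - 2 + s) & `|powln3 u| <= C * u `^ (g - 3 + s)].
Proof.
move=> s0.
have [C0 C00 H0] := powln_le n s0.
have [C1 C10 H1] := powln_le (n - 1) s0.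
have [C2 C20 H2] := powln_le (n - 2) s0.
have [C3 C30 H3] := powln_le (n - 3) s0.
pose K := C0 + C1 + C2 + C3.
have K0 : 0 < K by rewrite !addr_gt0.
pose M := 1 + (`|g| + `|n|) + (`|g * (g - 1)| + `|n * (2 * g - 1)| + `|n * (n - 1)|)
  * (1 + (`|g - 2| + `|n| + `|n - 1| + `|n - 2|)).
have H a i u : expR 1 <= u -> i \in [:: n; n - 1; n - 2; n - 3] ->
    `|powln a i u| <= K * u `^ (a + s).
  move=> eu; have u1 : 1 < u by rewrite (lt_le_trans expR1_gt1).
  rewrite gtr0_norm ?powln_gt0// => ii.
  have u0 := powR_ge0 u (a + s).
  have L C : C <= K -> C * u `^ (a + s) <= K * u `^ (a + s).
    by move=> CK; rewrite ler_wpM2r.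
  move: ii; rewrite !inE => /or4P[]/eqP ->.
  - by apply: le_trans (H0 _ _ eu) (L _ _); rewrite /K; lra.
  - by apply: le_trans (H1 _ _ eu) (L _ _); rewrite /K; lra.
  - by apply: le_trans (H2 _ _ eu) (L _ _); rewrite /K; lra.
  - by apply: le_trans (H3 _ _ eu) (L _ _); rewrite /K; lra.
have M0 : 0 < M.
  by rewrite /M -addrA ltr_pwDl// addr_ge0 ?mulr_ge0 ?addr_ge0.
have i0 : n \in [:: n; n - 1; n - 2; n - 3] by rewrite !inE eqxx.
have i1 : n - 1 \in [:: n; n - 1; n - 2; n - 3] by rewrite !inE eqxx !orbT.
have i2 : n - 2 \in [:: n; n - 1; n - 2; n - 3] by rewrite !inE eqxx !orbT.
have i3 : n - 3 \in [:: n; n - 1; n - 2; n - 3] by rewrite !inE eqxx !orbT.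
have tri c (w B : R) : `|w| <= B -> `|c * w| <= `|c| * B.
  by move=> wB; rewrite normrM ler_wpM2l.
have triD (w w' B B' : R) : `|w| <= B -> `|w'| <= B' -> `|w + w'| <= B + B'.
  by move=> h h'; rewrite (le_trans (ler_normD _ _))// lerD.
exists (M * K); first by rewrite mulr_gt0.
move=> u eu; split.
- have := H g _ _ eu i0; rewrite gtr0_norm ?powln_gt0 ?(lt_le_trans expR1_gt1)// => h.
  rewrite (le_trans h)// -mulrA ler_peMl//.
    by rewrite mulr_ge0 ?powR_ge0// ltW.
  by rewrite /M -!addrA lerDl !addr_ge0// mulr_ge0 ?addr_ge0.
- rewrite -mulrA.
  have B0 : 0 <= K * u `^ (g - 1 + s) by rewrite mulr_ge0 ?powR_ge0// ltW.
  apply: le_trans (triD _ _ _ _ (tri _ _ _ (H (g - 1) _ _ eu i0))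
    (tri _ _ _ (H (g - 1) _ _ eu i1))) _.
  rewrite -mulrDl ler_wpM2r//.
  by rewrite /M; set D := _ * (_ + _); have : 0 <= D by [
    rewrite /D mulr_ge0 ?addr_ge0]; lra.
- rewrite -mulrA.
  have B0 : 0 <= K * u `^ (g - 2 + s) by rewrite mulr_ge0 ?powR_ge0// ltW.
  apply: le_trans (triD _ _ _ _ (triD _ _ _ _ (tri _ _ _ (H (g - 2) _ _ eu i0))
    (tri _ _ _ (H (g - 2) _ _ eu i1))) (tri _ _ _ (H (g - 2) _ _ eu i2))) _.
  rewrite -!mulrDl ler_wpM2r//.
  rewrite /M; set D := `|_ * _| + _ + _.
  have D0 : 0 <= D by rewrite /D !addr_ge0.
  rewrite mulrDr mulr1.
  set D' := D * _; have : 0 <= D' by rewrite /D' mulr_ge0 ?addr_ge0.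
  have := normr_ge0 g; have := normr_ge0 n; lra.
- rewrite -mulrA.
  have B0 : 0 <= K * u `^ (g - 3 + s) by rewrite mulr_ge0 ?powR_ge0// ltW.
  apply: le_trans (triD _ _ _ _ (triD _ _ _ _
    (tri _ _ _ (triD _ _ _ _ (tri _ _ _ (H (g - 3) _ _ eu i0))
                             (tri _ _ _ (H (g - 3) _ _ eu i1))))
    (tri _ _ _ (triD _ _ _ _ (tri _ _ _ (H (g - 3) _ _ eu i1))
                             (tri _ _ _ (H (g - 3) _ _ eu i2)))))
    (tri _ _ _ (triD _ _ _ _ (tri _ _ _ (H (g - 3) _ _ eu i2))
                             (tri _ _ _ (H (g - 3) _ _ eu i3))))) _.
  have fin (E1 E2 E3 G0 G2 N0 N1 N2 B : R) : 0 <= E1 -> 0 <= E2 -> 0 <= E3 ->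
      0 <= G0 -> 0 <= G2 -> 0 <= N0 -> 0 <= N1 -> 0 <= N2 -> 0 <= B ->
      E1 * (G2 * B + N0 * B) + E2 * (G2 * B + N1 * B) + E3 * (G2 * B + N2 * B)
      <= (1 + (G0 + N0) + (E1 + E2 + E3) * (1 + (G2 + N0 + N1 + N2))) * B.
    move=> e1 e2 e3 g0 g2 n0 n1 n2 b0.
    rewrite [leLHS](_ : _ = (E1 * (G2 + N0) + E2 * (G2 + N1) + E3 * (G2 + N2)) * B);
      last by ring.
    rewrite ler_wpM2r// !mulrDl !mulrDr.
    have Q (v w : R) : 0 <= v -> 0 <= w -> 0 <= v * w by exact: mulr_ge0.
    have := Q _ _ e1 n1; have := Q _ _ e1 n2; have := Q _ _ e2 n0.
    have := Q _ _ e2 n2; have := Q _ _ e3 n0; have := Q _ _ e3 n1.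
    lra.
  exact: fin.
Qed.

Lemma powln_taylor s : 0 < s -> exists2 C : R, 0 < C & forall x z,
  2 * expR 1 <= x -> `|z| <= x / 2 ->
  `|powln g n (x + z) - powln g n x - powln1 x * z - powln2 x * z ^+ 2 / 2|
    <= C * x `^ (g - 3 + s) * `|z| ^+ 3.
Proof.
move=> s0; have [C C0 H] := powln_derivatives_le s0.
exists (C * 2 `^ `|g - 3 + s|); first by rewrite mulr_gt0// powR_gt0.
move=> x z ex zx.
have x0 : 0 < x by rewrite (lt_le_trans _ ex)// mulr_gt0// expR_gt0.
have U u : `|u - x| <= `|z| -> x / 2 <= u <= 2 * x.
  by move=> ux; have := le_trans ux zx; rewrite ler_distl => /andP[? ?]; apply/andP; split; lra.
have E u : `|u - x| <= `|z| -> expR 1 <= u.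
  by move=> /U /andP[xu _]; apply: le_trans xu; rewrite ler_pdivlMr// mulrC.
have E1 u : `|u - x| <= `|z| -> 1 < u.
  by move=> /E; apply: lt_le_trans; exact: expR1_gt1.
apply: (@taylor2_le _ powln1 powln2 powln3) => u ux.
- exact: is_derive_powln (E1 _ ux).
- exact: is_derive_powln1 (E1 _ ux).
- exact: is_derive_powln2 (E1 _ ux).
- have [_ _ _ h] := H _ (E _ ux); rewrite (le_trans h)// -mulrA ler_pM2l//.
  exact: powR_le_near (U _ ux).
Qed.

End powln_derivatives.

End calculus.

Section clamped_powln.
Context {R : realType}.
Implicit Types a b u x y z s M : R.

Lemma powln_incr (g n : R) : 0 < g -> exists2 a : R, expR 1 <= a &
  forall u v, a <= u -> u < v -> powln g n u < powln g n v.
Proof.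
move=> g0; exists (expR (1 + `|n| / g)).
  by rewrite ler_expR lerDl divr_ge0// ltW.
move=> u v au uv.
have e1 w : u <= w -> 1 < w.
  move=> uw; rewrite (lt_le_trans _ (le_trans au uw))// expR_gt1.
  by rewrite ltr_pwDl// divr_ge0// ltW.
have := @MVT R (powln g n) (powln1 g n) u v uv.
case.
- by move=> w /[!in_itv]/= /andP[/ltW uw _]; apply: is_derive_powln; exact: e1.
- apply: derivable_within_continuous => w /[!in_itv]/= /andP[uw _].
  by have [] := @is_derive_powln _ g n w (e1 _ uw).
move=> w /[!in_itv]/= /andP[/ltW uw _] Fw.
rewrite -subr_gt0 Fw mulr_gt0 ?subr_gt0//.
have w1 := e1 _ uw; have w0 : 0 < w by rewrite (lt_trans _ w1).
have l0 : 0 < ln w by rewrite ln_gt0.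
have Ln : ln w `^ n = ln w * ln w `^ (n - 1).
  by rewrite -{2}(powRr1 (ltW l0)) -gt0_powRD// addrC subrK.
rewrite /powln1 /powln Ln.
rewrite (_ : _ + _ = w `^ (g - 1) * ln w `^ (n - 1) * (g * ln w + n)); last by ring.
rewrite !mulr_gt0 ?powR_gt0//.
have : 1 + `|n| / g <= ln w.
  rewrite -[leLHS]expRK ler_ln ?posrE ?expR_gt0//.
  exact: le_trans au uw.
rewrite -(ler_pM2l g0) mulrDr mulr1 mulrCA divff ?gt_eqF// mulr1.
have := ler_norm (- n); rewrite normrN; lra.
Qed.

Definition clamp (f : R -> R) a b u := f (Num.min (Num.max u a) b).

Lemma clamp_id f a b u : a <= u <= b -> clamp f a b u = f u.
Proof. by move=> /andP[au ub]; rewrite /clamp (max_idPl au) (min_idPl ub). Qed.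

Lemma le_clamp f a b u v : a <= b -> (forall x y, a <= x -> x <= y -> f x <= f y) ->
  u <= v -> clamp f a b u <= clamp f a b v.
Proof.
move=> ab hf uv.
have H w : a <= Num.min (Num.max w a) b by rewrite le_min ab andbT le_max lexx orbT.
apply: hf => //.
by rewrite le_min !ge_min lexx orbT andbT ge_max !le_max uv lexx orbT.
Qed.

Lemma powR_le_higher_pow (b p x z : R) (k : nat) : k%:R <= p -> 0 < x -> x `^ b <= z ->
  z ^+ k <= x `^ (b * (k%:R - p)) * z `^ p.
Proof.
move=> kp x0 xz; have z0 : 0 < z by rewrite (lt_le_trans _ xz)// powR_gt0.
rewrite -(powR_mulrn k (ltW z0)) /powR (gt_eqF z0) (gt_eqF x0) -!expRD ler_expR.
have l1 : b * ln x <= ln z by rewrite -ln_powR ler_ln ?posrE// powR_gt0.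
have : (p - k%:R) * (b * ln x) <= (p - k%:R) * ln z by rewrite ler_wpM2l// subr_ge0.
lra.
Qed.

Section second_order_expansion.
Variables g n p be s a : R.
Hypotheses (p2 : 2 < p) (be01 : 0 < be < 1) (s0 : 0 < s) (gsp : g + s <= p).
Hypotheses (ea : expR 1 <= a).
Hypothesis incF : forall u v, a <= u -> u < v -> powln g n u < powln g n v.

Let homoF u v : a <= u -> u <= v -> powln g n u <= powln g n v.
Proof.
move=> au; rewrite le_eqVlt => /predU1P[->//|uv].
exact/ltW/incF.
Qed.

Let expo_le x : 1 <= x -> x `^ (g + s - p) <= x `^ (g - 2 + s) * x `^ (be * (2 - p)).
Proof.
move=> x1; rewrite -gt0_powRD ?(lt_le_trans _ x1)// ler_powR//.
have : (1 - be) * (p - 2) >= 0 by rewrite mulr_ge0 ?subr_ge0 ?(ltW p2)//; case/andP: be01 => _ /ltW.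
lra.
Qed.

Lemma clamp_powln_expansion : exists2 C : R, 0 < C & forall b x z,
  2 * a <= x -> 2 * x <= b -> - x <= z ->
  `|clamp (powln g n) a b (x + z) - clamp (powln g n) a b x
     - powln1 g n x * z - powln2 g n x * z ^+ 2 / 2|
  <= C * x `^ (g - 2 + s) * (x `^ (be - 1) * z ^+ 2 + x `^ (be * (2 - p)) * `|z| `^ p).
Proof.
have [T T0 HT] := powln_taylor g n s0.
have [D D0 HD] := powln_derivatives_le g n s0.
pose K := 3 `^ (g + s) * 2 `^ (p - (g + s)) + 2 `^ (p - 1) + 2 `^ (p - 2).
have K0 : 0 < K by rewrite !addr_gt0// ?mulr_gt0 ?powR_gt0.
exists (T + D * K); first by rewrite addr_gt0// mulr_gt0.
move=> b x z ax xb xz; have ea' := ea; have p2' := p2.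
have a1 : 1 < a := lt_le_trans expR1_gt1 ea.
have x1 : 1 <= x by lra.
have x0 : 0 < x by lra.
have ab : a <= b by lra.
set Q := x `^ (g - 2 + s); have Q0 : 0 < Q by exact: powR_gt0.
set E1 := x `^ (be - 1); have E10 : 0 < E1 by exact: powR_gt0.
set E2 := x `^ (be * (2 - p)); have E20 : 0 < E2 by exact: powR_gt0.
set Zp := `|z| `^ p; have Zp0 : 0 <= Zp by exact: powR_ge0.
have z20 : 0 <= z ^+ 2 by exact: sqr_ge0.
rewrite [leRHS](_ : _ = T * Q * (E1 * z ^+ 2 + E2 * Zp)
  + D * K * Q * (E1 * z ^+ 2 + E2 * Zp)); last by ring.
have TD0 : 0 <= E1 * z ^+ 2 + E2 * Zp by rewrite addr_ge0// mulr_ge0// ltW.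
have fx : clamp (powln g n) a b x = powln g n x by rewrite clamp_id//; apply/andP; split; lra.
have [zx|zx] := leP `|z| (x / 2).
  have fxz : clamp (powln g n) a b (x + z) = powln g n (x + z).
    by move: zx; rewrite ler_norml => /andP[? ?]; rewrite clamp_id//; apply/andP; split; lra.
  rewrite fx fxz; apply: (@le_trans _ _ (T * Q * (E1 * z ^+ 2 + E2 * Zp))); last first.
    by rewrite lerDl !mulr_ge0// ltW.
  have ex : 2 * expR 1 <= x by lra.
  apply: le_trans (HT _ _ ex zx) _.
  rewrite -!mulrA ler_pM2l//.
  have [zb|zb] := leP `|z| (x `^ be).
    apply: (@le_trans _ _ (Q * (E1 * z ^+ 2))); last first.
      by rewrite ler_pM2l// lerDl mulr_ge0// ltW.
    have -> : Q * (E1 * z ^+ 2) = x `^ (g - 3 + s) * (x `^ be * z ^+ 2).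
      rewrite /Q /E1 mulrA -gt0_powRD// [RHS]mulrA -gt0_powRD//.
      by congr (powR x _ * _); ring.
    by rewrite ler_pM2l ?powR_gt0// exprS real_normK ?num_real// ler_wpM2r.
  apply: (@le_trans _ _ (Q * (E2 * Zp))); last first.
    by rewrite ler_pM2l// lerDr mulr_ge0// ltW.
  have -> : Q = x `^ (g - 3 + s) * x.
    by rewrite /Q -{3}(powRr1 (ltW x0)) -gt0_powRD//; congr (powR x _); ring.
  rewrite -mulrA ler_pM2l ?powR_gt0// exprS ler_pM//.
  - by rewrite (le_trans zx)// ler_pdivrMr//; lra.
  - exact: powR_le_higher_pow (ltW p2) x0 (ltW zb).
apply: (@le_trans _ _ (D * K * Q * (E2 * Zp))); last first.
  rewrite -[leLHS]add0r; apply: lerD; first by rewrite !mulr_ge0// ltW.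
  by rewrite ler_pM2l ?mulr_gt0// lerDr mulr_ge0// ltW.
have xe := expo_le x1; rewrite -/Q -/E2 in xe.
have az : 0 < `|z| by rewrite (lt_trans _ zx)// divr_gt0.
have xz2 : x <= 2 * `|z| by rewrite mulrC -ler_pdivrMr// ltW.
have ex : expR 1 <= x by lra.
have [h0 h1 h2 _] := HD x ex.
have le3 : expR 1 <= 3 * `|z| by lra.
have [k0 _ _ _] := HD _ le3.
have Fb u : a <= u -> 0 < powln g n u.
  by move=> au; apply: powln_gt0; apply: lt_le_trans au.
have Fz0 : 0 <= clamp (powln g n) a b (x + z).
  by apply/ltW/Fb; rewrite le_min le_max lexx orbT ab.
have Fz : clamp (powln g n) a b (x + z) <= powln g n (3 * `|z|).
  apply: homoF; first by rewrite le_min le_max lexx orbT.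
  rewrite ge_min ge_max; have := ler_norm z; move=> zz.
  by apply/orP; left; apply/andP; split; lra.
have Fx : powln g n x <= powln g n (3 * `|z|).
  by apply: homoF; lra.
have Fx0 : 0 < powln g n x by apply: Fb; lra.
have higher q : q <= p -> `|z| `^ q <= 2 `^ (p - q) * (x `^ (q - p) * Zp).
  by move=> qp; apply: powR_le_higher => //; exact: ltW.
have H3 : powln g n (3 * `|z|) <= D * (3 `^ (g + s) * 2 `^ (p - (g + s))) * (Q * (E2 * Zp)).
  apply: le_trans k0 _; rewrite powRM// -!mulrA ler_pM2l// ler_pM2l ?powR_gt0//.
  apply: le_trans (higher _ gsp) _; rewrite ler_pM2l ?powR_gt0//.
  by rewrite mulrA ler_wpM2r.
have H1 : `|powln1 g n x * z| <= D * 2 `^ (p - 1) * (Q * (E2 * Zp)).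
  rewrite normrM; apply: (@le_trans _ _ (D * x `^ (g - 1 + s) * `|z|)); first by rewrite ler_wpM2r.
  rewrite -!mulrA ler_pM2l//.
  apply: (@le_trans _ _ (x `^ (g - 1 + s) * (2 `^ (p - 1) * (x `^ (1 - p) * Zp)))).
    rewrite ler_pM2l ?powR_gt0// -{1}(powRr1 (ltW az)); apply: higher; lra.
  rewrite mulrCA ler_pM2l ?powR_gt0// [leLHS]mulrA -(gt0_powRD _ _ x0).
  by rewrite [leRHS]mulrA ler_wpM2r// (_ : g - 1 + s + _ = g + s - p)//; ring.
have H2 : `|powln2 g n x * z ^+ 2 / 2| <= D * 2 `^ (p - 2) * (Q * (E2 * Zp)).
  rewrite normrM [`|2^-1|]ger0_norm//.
  apply: (@le_trans _ _ (`|powln2 g n x * z ^+ 2|)).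
    by rewrite ler_piMr//; lra.
  rewrite normrM; apply: (@le_trans _ _ (D * x `^ (g - 2 + s) * `|z| ^+ 2)).
    by rewrite normrX ler_wpM2r// exprn_ge0.
  rewrite -!mulrA ler_pM2l//.
  apply: (@le_trans _ _ (x `^ (g - 2 + s) * (2 `^ (p - 2) * (x `^ (2 - p) * Zp)))).
    rewrite ler_pM2l ?powR_gt0// -(powR_mulrn 2 (ltW az)); apply: higher; exact: ltW.
  rewrite mulrCA ler_pM2l ?powR_gt0// [leLHS]mulrA -(gt0_powRD _ _ x0).
  by rewrite [leRHS]mulrA ler_wpM2r// (_ : g - 2 + s + _ = g + s - p)//; ring.
rewrite fx; apply: le_trans (ler_normB _ _) _.
rewrite (_ : D * K * Q * _ = D * (3 `^ (g + s) * 2 `^ (p - (g + s))) * (Q * (E2 * Zp))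
  + D * 2 `^ (p - 1) * (Q * (E2 * Zp)) + D * 2 `^ (p - 2) * (Q * (E2 * Zp))); last first.
  by rewrite /K; ring.
apply: lerD => //; apply: le_trans (ler_normB _ _) _; apply: lerD => //.
apply: le_trans H3; rewrite ler_norml; apply/andP; split; lra.
Qed.

End second_order_expansion.

End clamped_powln.

Section drift_asymptotics.
Context {R : realType}.
Implicit Types x q : R.

Lemma near_powR_small (k e : R) : 0 < k -> 0 < e ->
  \forall x \near +oo, x `^ (- k) <= e.
Proof.
move=> k0 e0; exists ((e^-1) `^ k^-1); split; first exact: num_real.
move=> x /= ex.
have e1 : 0 < (e^-1) `^ k^-1 by apply: powR_gt0; rewrite invr_gt0.
have x0 : 0 < x by rewrite (lt_trans e1).
rewrite powRN -[leRHS]invrK lef_pV2 ?posrE ?powR_gt0 ?invr_gt0//.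
have e1n : (e^-1) `^ k^-1 \is Num.nneg by rewrite nnegrE ltW.
have xn : x \is Num.nneg by rewrite nnegrE ltW.
have := ge0_ler_powR (ltW k0) e1n xn (ltW ex).
by rewrite -powRrM mulVf ?gt_eqF// powRr1 ?invr_ge0 ?(ltW e0).
Qed.

Lemma near_ln_ge (M : R) : \forall x \near +oo, M <= ln x.
Proof.
exists (expR M); split; first exact: num_real.
move=> x /= Mx; rewrite -[leLHS]expRK ler_ln ?posrE ?expR_gt0//; first exact: ltW.
by rewrite (lt_trans _ Mx)// expR_gt0.
Qed.

Lemma near_powR_powR_ln (k b e : R) : 0 < k -> 0 < e ->
  \forall x \near +oo, x `^ (- k) * ln x `^ b <= e.
Proof.
move=> k0 e0; have k20 : 0 < k / 2 by rewrite divr_gt0.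
have [C C0 HC] := powR_ln_le b k20.
near=> x.
have ex : expR 1 <= x by near: x; exact: nbhs_pinfty_ge.
have x0 : 0 < x by rewrite (lt_le_trans _ ex)// expR_gt0.
apply: (@le_trans _ _ (x `^ (- k) * (C * x `^ (k / 2)))).
  by rewrite ler_pM2l ?powR_gt0// HC.
rewrite mulrCA -gt0_powRD// (_ : - k + k / 2 = - (k / 2)); last by field.
rewrite -ler_pdivlMl//.
by near: x; apply: near_powR_small => //; rewrite mulr_gt0// invr_gt0.
Unshelve. all: by end_near. Qed.

Variables g n c s2 p de Cp C s be ka : R.
Hypotheses (s20 : 0 < s2) (Cp0 : 0 < Cp) (C0 : 0 < C) (ka0 : 0 < ka).
Hypotheses (h1 : s + (be - 1) <= - ka) (h2 : s + be * (2 - p) + (p - 2 - de) <= - ka).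

Definition powln_drift x : R := x `^ (g - 2) * ln x `^ (n - 1) *
  (g * (c + (g - 1) * s2 / 2) * ln x + n * (c + (2 * g - 1) * s2 / 2)).

Lemma powln1E x : 1 < x ->
  powln1 g n x = x `^ (g - 2) * ln x `^ (n - 1) * (x * (g * ln x + n)).
Proof.
move=> x1; have x0 : 0 < x by rewrite (lt_trans _ x1).
have l0 : 0 < ln x by rewrite ln_gt0.
have Ln : ln x `^ n = ln x * ln x `^ (n - 1).
  by rewrite -{2}(powRr1 (ltW l0)) -gt0_powRD// addrC subrK.
have xg : x `^ (g - 1) = x * x `^ (g - 2).
  by rewrite -{2}(powRr1 (ltW x0)) -gt0_powRD//; congr (powR x _); ring.
by rewrite /powln1 /powln Ln xg; ring.
Qed.

Lemma powln2E x : 1 < x ->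
  powln2 g n x = x `^ (g - 2) * ln x `^ (n - 1) *
   (g * (g - 1) * ln x + n * (2 * g - 1) + n * (n - 1) / ln x).
Proof.
move=> x1; have x0 : 0 < x by rewrite (lt_trans _ x1).
have l0 : 0 < ln x by rewrite ln_gt0.
have Ln : ln x `^ n = ln x * ln x `^ (n - 1).
  by rewrite -{2}(powRr1 (ltW l0)) -gt0_powRD// addrC subrK.
have Ln2 : ln x `^ (n - 2) = (ln x)^-1 * ln x `^ (n - 1).
  by rewrite -(powR_inv1 (ltW l0)) -gt0_powRD//; congr (powR _ _); ring.
by rewrite /powln2 /powln Ln Ln2; ring.
Qed.

Lemma powln_drift_estimate (ep : R) : 0 < ep -> exists2 e : R, 0 < e &
  \forall x \near +oo, forall q M1 M2 Mp I : R, 0 <= q ->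
  `|M1 - c / x * q| <= e / (x * ln x) * q -> `|M2 - s2 * q| <= e / ln x * q ->
  0 <= M2 -> 0 <= Mp -> Mp <= Cp * (1 + x) `^ (p - 2 - de) * q ->
  `|I - powln1 g n x * M1 - powln2 g n x / 2 * M2|
    <= C * x `^ (g - 2 + s) * (x `^ (be - 1) * M2 + x `^ (be * (2 - p)) * Mp) ->
  `|I - powln_drift x * q| <= ep * (x `^ (g - 2) * ln x `^ (n - 1)) * q.
Proof.
move=> ep0.
pose K := 1 + `|g| + `|n| + `|g * (g - 1)| + `|n * (2 * g - 1)| + `|n * (n - 1)|.
have K0 : 0 < K by rewrite /K -!addrA ltr_pwDl// !addr_ge0.
pose e := ep / (4 * K).
have e0 : 0 < e by rewrite divr_gt0// mulr_gt0.
pose C1 := C * (s2 + e) + C * (Cp * 2 `^ `|p - 2 - de|).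
have C10 : 0 < C1 by rewrite /C1 addr_gt0 ?mulr_gt0 ?addr_gt0// powR_gt0.
exists e => //; near=> x => q M1 M2 Mp I q0 H1 H2 M20 Mp0 Hp HI.
have ex : expR 1 <= x by near: x; exact: nbhs_pinfty_ge.
have x1 : 1 < x by rewrite (lt_le_trans _ ex)// expR1_gt1.
have x0 : 0 < x by rewrite (lt_trans _ x1).
have l1 : 1 <= ln x by exact: ln_ge1.
have l0 : 0 < ln x by rewrite (lt_le_trans _ l1).
have lbig : K * s2 * 4 / ep <= ln x by near: x; exact: near_ln_ge.
have small : x `^ (- ka) * ln x `^ (1 - n) <= ep / (4 * C1).
  near: x; apply: near_powR_powR_ln => //; rewrite divr_gt0// mulr_gt0//.
set D := x `^ (g - 2) * ln x `^ (n - 1).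
have D0 : 0 < D by rewrite mulr_gt0 ?powR_gt0.
have M2q : M2 <= (s2 + e) * q.
  have : M2 - s2 * q <= e / ln x * q by exact: le_trans (ler_norm _) H2.
  have : e / ln x * q <= e * q by rewrite ler_wpM2r// ler_pdivrMr// ler_peMr// ltW.
  rewrite mulrDl; lra.
have Mpq : Mp <= Cp * 2 `^ `|p - 2 - de| * x `^ (p - 2 - de) * q.
  apply: le_trans Hp _; rewrite ler_wpM2r// -mulrA ler_pM2l// powR_le_near//.
  by apply/andP; split; lra.
have err : C * x `^ (g - 2 + s) * (x `^ (be - 1) * M2 + x `^ (be * (2 - p)) * Mp)
    <= ep / 4 * D * q.
  apply: (@le_trans _ _ (x `^ (g - 2) * (x `^ (- ka) * C1) * q)); last first.
    rewrite ler_wpM2r// [leRHS]mulrC /D -mulrA ler_pM2l ?powR_gt0//.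
    have ln1 : ln x `^ (1 - n) * ln x `^ (n - 1) = 1.
      by rewrite -gt0_powRD// (_ : 1 - n + (n - 1) = 0) ?powRr0//; ring.
    have : x `^ (- ka) * C1 * ln x `^ (1 - n) <= ep / 4.
      rewrite mulrAC -ler_pdivlMr// (le_trans small)//.
      by rewrite -mulrA ler_pM2l// invfM.
    move=> /(ler_wpM2r (powR_ge0 (ln x) (n - 1))).
    by rewrite -[leLHS]mulrA ln1 mulr1 [leRHS]mulrC.
  have p1 : x `^ s * x `^ (be - 1) <= x `^ (- ka).
    by rewrite -gt0_powRD// ler_powR// ltW.
  have p2 : x `^ s * (x `^ (be * (2 - p)) * x `^ (p - 2 - de)) <= x `^ (- ka).
    by rewrite -!gt0_powRD//; apply: ler_powR; rewrite ?(ltW x1)// addrA.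
  have P1 : x `^ s * (x `^ (be - 1) * M2) <= x `^ (- ka) * ((s2 + e) * q).
    by rewrite mulrA ler_pM// mulr_ge0// powR_ge0.
  have P2 : x `^ s * (x `^ (be * (2 - p)) * Mp)
      <= x `^ (- ka) * (Cp * 2 `^ `|p - 2 - de| * q).
    apply: (@le_trans _ _ (x `^ s * (x `^ (be * (2 - p)) *
        (Cp * 2 `^ `|p - 2 - de| * x `^ (p - 2 - de) * q)))).
      by rewrite !ler_pM2l ?powR_gt0.
    have := @ler_wpM2r _ (Cp * 2 `^ `|p - 2 - de| * q) _ _ _ p2.
    rewrite !mulr_ge0 ?powR_ge0 ?(ltW Cp0)// => /(_ isT).
    by apply: le_trans; rewrite le_eqVlt; apply/orP; left; apply/eqP; ring.
  rewrite gt0_powRD//.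
  have xg := powR_gt0 (g - 2) x0.
  have := lerD P1 P2 => P3.
  have := @ler_wpM2l _ (C * x `^ (g - 2)) _ _ _ P3.
  rewrite mulr_ge0 ?(ltW C0) ?(ltW xg)// => /(_ isT).
  rewrite /C1 => H.
  rewrite [leLHS](_ : _ = C * x `^ (g - 2) * (x `^ s * (x `^ (be - 1) * M2) +
    x `^ s * (x `^ (be * (2 - p)) * Mp))); last by ring.
  apply: le_trans H _; rewrite le_eqVlt; apply/orP; left; apply/eqP; ring.
set F1 := powln1 g n x in HI; set F2 := powln2 g n x in HI.
have F1b : `|F1| <= D * (x * (ln x * K)).
  rewrite /F1 powln1E// -/D normrM (gtr0_norm D0) ler_pM2l// normrM (gtr0_norm x0).
  rewrite ler_pM2l//; apply: le_trans (ler_normD _ _) _; rewrite normrM (gtr0_norm l0).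
  have : `|n| <= ln x * `|n| by rewrite ler_peMl.
  have : ln x * (`|g| + `|n|) <= ln x * K.
    rewrite ler_pM2l// /K.
    have : 0 <= `|g * (g - 1)| by []. have : 0 <= `|n * (2 * g - 1)| by [].
    have : 0 <= `|n * (n - 1)| by []. lra.
  rewrite mulrDr; lra.
have F2b : `|F2| <= D * (ln x * K).
  rewrite /F2 powln2E// -/D normrM (gtr0_norm D0) ler_pM2l//.
  apply: le_trans (ler_normD _ _) _; rewrite [`|_ / ln x|]normrM [`|(ln x)^-1|]gtr0_norm ?invr_gt0//.
  apply: (@le_trans _ _ (`|g * (g - 1)| * ln x + `|n * (2 * g - 1)| * ln x
      + `|n * (n - 1)| * ln x)).
    apply: lerD; last first.
      by rewrite ler_wpM2l// (@le_trans _ _ 1)// invf_le1.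
    apply: le_trans (ler_normD _ _) _; apply: lerD; last by rewrite ler_peMr.
    by rewrite normrM (gtr0_norm l0).
  rewrite -!mulrDl mulrC ler_pM2l// /K.
  have : 0 <= `|g| by []. have : 0 <= `|n| by []. lra.
have split : I - powln_drift x * q = (I - F1 * M1 - F2 / 2 * M2)
    + F1 * (M1 - c / x * q) + F2 / 2 * (M2 - s2 * q)
    + D * (n * (n - 1)) * s2 / (2 * ln x) * q.
  rewrite /F1 /F2 powln1E// powln2E// /powln_drift -/D.
  by field; rewrite !gt_eqF.
rewrite split.
have t1 : `|F1 * (M1 - c / x * q)| <= ep / 4 * D * q.
  rewrite normrM; apply: (@le_trans _ _ (D * (x * (ln x * K)) * (e / (x * ln x) * q))).
    by rewrite ler_pM.
  by rewrite le_eqVlt /e; apply/orP; left; apply/eqP; field; rewrite !gt_eqF.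
have t2 : `|F2 / 2 * (M2 - s2 * q)| <= ep / 4 * D * q.
  rewrite normrM; apply: (@le_trans _ _ (D * (ln x * K) * (e / ln x * q))).
    rewrite ler_pM// normrM [`|2^-1|]ger0_norm ?invr_ge0//.
    apply: le_trans F2b; rewrite ler_pdivrMr// ler_peMr//; lra.
  by rewrite le_eqVlt /e; apply/orP; left; apply/eqP; field; rewrite !gt_eqF.
have t3 : `|D * (n * (n - 1)) * s2 / (2 * ln x) * q| <= ep / 4 * D * q.
  rewrite normrM (ger0_norm q0) ler_wpM2r//.
  rewrite normrM [`|(_ * _)^-1|]gtr0_norm ?invr_gt0 ?mulr_gt0//.
  rewrite ler_pdivrMr ?mulr_gt0// normrM (gtr0_norm s20) normrM (gtr0_norm D0).
  have k1 : `|n * (n - 1)| <= K.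
    rewrite /K.
    have : 0 <= `|g * (g - 1)| by []. have : 0 <= `|n * (2 * g - 1)| by [].
    have : 0 <= `|g| by []. have : 0 <= `|n| by []. lra.
  have k2 : `|n * (n - 1)| * s2 <= ep / 4 * ln x.
    apply: (@le_trans _ _ (K * s2)); first by rewrite ler_pM2r.
    move: lbig; rewrite ler_pdivrMr//; lra.
  rewrite -[leLHS]mulrA [leRHS](_ : _ = D * (ep / 4 * ln x * 2)); last by ring.
  rewrite ler_pM2l//; apply: le_trans k2 _; rewrite ler_peMr//.
  - by rewrite !mulr_ge0// ltW.
  - by lra.
rewrite [leRHS](_ : _ = ep / 4 * D * q + ep / 4 * D * q + ep / 4 * D * q + ep / 4 * D * q);
  last by field.
apply: le_trans (ler_normD _ _) _; apply: lerD => //.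
apply: le_trans (ler_normD _ _) _; apply: lerD => //.
apply: le_trans (ler_normD _ _) _; apply: lerD => //.
exact: le_trans HI err.
Unshelve. all: by end_near. Qed.

End drift_asymptotics.

(** * Conditional bounds on events of the filtration *)

Section conditional_bounds.
Context {d : measure_display} {T : measurableType d} {R : realType}.
Variable P : probability T R.
Implicit Types (A B : set T) (G : set (set T)).

Lemma fin_num_prob A : measurable A -> P A \is a fin_num.
Proof. by move=> mA; rewrite fin_num_measure. Qed.

Lemma fine_prob_ge0 A : 0 <= fine (P A).
Proof. exact: fine_ge0. Qed.

Lemma le_prob A B : measurable A -> measurable B -> A `<=` B ->
  fine (P A) <= fine (P B).
Proof.
move=> mA mB AB; apply: fine_le; rewrite ?fin_num_prob//.
by apply: le_measure; rewrite ?inE.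
Qed.

Lemma prob_setU A B : measurable A -> measurable B -> A `&` B = set0 ->
  fine (P (A `|` B)) = fine (P A) + fine (P B).
Proof.
by move=> mA mB AB; rewrite measureU// fineD// fin_num_prob.
Qed.

Lemma prob_setI_setD A B : measurable A -> measurable B ->
  fine (P A) = fine (P (A `&` B)) + fine (P (A `\` B)).
Proof.
move=> mA mB; rewrite -prob_setU//; first by rewrite setUIDK.
- exact: measurableI.
- exact: measurableD.
- by apply/seteqP; split => // w [[_ ?] [_]].
Qed.

Section one_sigma_algebra.
Variables (G : set (set T)) (sG : sub_sigma G).

Lemma sub_sigma_measurable A : G A -> measurable A.
Proof. by case: sG => _; apply. Qed.

Lemma sub_sigma0 : G set0.
Proof. by case: sG => -[]. Qed.

Lemma sub_sigmaC A : G A -> G (~` A).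
Proof. by case: sG => -[_ GC _] _ GA; rewrite -setTD; exact: GC. Qed.

Lemma sub_sigma_bigcup (A : nat -> set T) : (forall n, G (A n)) -> G (\bigcup_n A n).
Proof. by case: sG => -[_ _ GU] _; exact: GU. Qed.

Lemma sub_sigmaU A B : G A -> G B -> G (A `|` B).
Proof.
move=> GA GB; rewrite -bigcup2E; apply: sub_sigma_bigcup.
by case=> [//|[//|n]]; exact: sub_sigma0.
Qed.

Lemma sub_sigmaI A B : G A -> G B -> G (A `&` B).
Proof.
by move=> GA GB; rewrite -[_ `&` _]setCK setCI; apply/sub_sigmaC/sub_sigmaU;
  exact: sub_sigmaC.
Qed.

Lemma sub_sigmaD A B : G A -> G B -> G (A `\` B).
Proof. by move=> GA GB; rewrite setDE; exact/sub_sigmaI/sub_sigmaC. Qed.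

Lemma cexp_measurable Y Z : cexp_nonneg P G Y Z -> measurable_fun setT Z.
Proof. by move=> [_ mZ _] _ B mB; rewrite setTI; exact/sub_sigma_measurable/mZ. Qed.

Let cst_int A (k : R) : measurable A ->
  (\int[P]_(w in A) k%:E = (k * fine (P A))%:E)%E.
Proof.
by move=> mA; rewrite integral_cst// EFinM fineK// fin_num_prob.
Qed.

Lemma cexp_le Y Z A (k : R) : cexp_nonneg P G Y Z -> G A -> 0 <= k ->
  {ae P, forall w, A w -> (Z w <= k%:E)%E} ->
  (\int[P]_(w in A) Y w <= (k * fine (P A))%:E)%E.
Proof.
move=> cZ GA k0 Zk; have mA := sub_sigma_measurable GA; have mZ := cexp_measurable cZ.
case: cZ => Z0 _ -> //; rewrite -cst_int//.
apply: ae_ge0_le_integral => //; exact: measurable_funS mZ.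
Qed.

Lemma cexp_ge Y Z A (k : R) : cexp_nonneg P G Y Z -> G A ->
  {ae P, forall w, A w -> (k%:E <= Z w)%E} ->
  ((k * fine (P A))%:E <= \int[P]_(w in A) Y w)%E.
Proof.
move=> cZ GA Zk; have [k0|/ltW k0] := leP 0 k; last first.
  case: cZ => Z0 _ -> //; rewrite (@le_trans _ _ 0%E)//; last exact: integral_ge0.
  by rewrite lee_fin mulr_le0_ge0// fine_prob_ge0.
have mA := sub_sigma_measurable GA; have mZ := cexp_measurable cZ.
case: cZ => Z0 _ -> //; rewrite -cst_int//.
apply: ae_ge0_le_integral => //; exact: measurable_funS mZ.
Qed.

Lemma cexp_diff_le Y1 Z1 Y2 Z2 A (k : R) :
  cexp_nonneg P G Y1 Z1 -> cexp_nonneg P G Y2 Z2 -> G A ->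
  {ae P, forall w, A w -> [/\ Z1 w \is a fin_num, Z2 w \is a fin_num &
     fine (Z1 w) - fine (Z2 w) <= k]} ->
  (\int[P]_(w in A) Y1 w \is a fin_num)%E -> (\int[P]_(w in A) Y2 w \is a fin_num)%E ->
  fine (\int[P]_(w in A) Y1 w)%E - fine (\int[P]_(w in A) Y2 w)%E <= k * fine (P A).
Proof.
move=> c1 c2 GA Zk f1 f2; have mA := sub_sigma_measurable GA.
have mZ1 : measurable_fun A Z1 by exact: measurable_funS (cexp_measurable c1).
have mZ2 : measurable_fun A Z2 by exact: measurable_funS (cexp_measurable c2).
case: c1 f1 => Z10 _ I1; rewrite I1// => f1.
case: c2 f2 => Z20 _ I2; rewrite I2// => f2.
pose kp := Num.max k 0; pose km := Num.max (- k) 0.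
have kp0 : 0 <= kp by rewrite le_max lexx orbT.
have km0 : 0 <= km by rewrite le_max lexx orbT.
have kE : k = kp - km.
  rewrite /kp /km; have [k0|/ltW k0] := leP 0 k.
    by rewrite (max_idPr _) ?subr0// oppr_le0.
  by rewrite (max_idPl _) ?oppr_ge0// sub0r opprK.
have H : (\int[P]_(w in A) (Z1 w + km%:E) <= \int[P]_(w in A) (Z2 w + kp%:E))%E.
  apply: ae_ge0_le_integral => //.
  - by move=> w _; rewrite adde_ge0// lee_fin.
  - by apply: emeasurable_funD => //; exact: measurable_cst.
  - by move=> w _; rewrite adde_ge0// lee_fin.
  - by apply: emeasurable_funD => //; exact: measurable_cst.
  - apply: filterS Zk => w + Aw => /(_ Aw)[/fineK <- /fineK <-] h.
    by rewrite -!EFinD lee_fin; lra.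
move: H; rewrite !ge0_integralD ?cst_int//.
rewrite -(fineK f1) -(fineK f2) -!EFinD lee_fin /= kE mulrBl.
lra.
Qed.

End one_sigma_algebra.
Lemma integrable_of_le A (h : T -> R) (k : R) : measurable A ->
  measurable_fun setT h -> (forall w, 0 <= h w) ->
  (\int[P]_(w in A) (h w)%:E <= k%:E)%E ->
  P.-integrable A (EFin \o h) /\ \int[P]_(w in A) h w <= k.
Proof.
move=> mA mh h0 hk; split.
  apply/integrableP; split.
    by apply/measurable_EFinP; exact: measurable_funS mh.
  rewrite (eq_integral (EFin \o h)); last by move=> w _ /=; rewrite ger0_norm.
  exact: le_lt_trans hk (ltry _).
rewrite /Rintegral -lee_fin fineK// ge0_fin_numE; first exact: le_lt_trans hk (ltry _).
by apply: integral_ge0 => w _; rewrite lee_fin.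
Qed.

Lemma bound_integrable A (h : T -> R) (M : R) : measurable A ->
  measurable_fun setT h -> (forall w, A w -> `|h w| <= M) ->
  P.-integrable A (EFin \o h).
Proof.
move=> mA mh hM; apply: (@le_integrable _ _ _ P _ mA _ (EFin \o cst M)).
- by apply/measurable_EFinP; exact: measurable_funS mh.
- by move=> w Aw /=; rewrite lee_fin (le_trans (hM _ Aw))// ler_norm.
- exact: finite_measure_integrable_cst.
Qed.

Lemma Rintegral_cstM A (k : R) : measurable A -> \int[P]_(w in A) k = k * fine (P A).
Proof. by move=> mA; rewrite Rintegral_cst. Qed.

End conditional_bounds.

Section process.
Context {d : measure_display} {T : measurableType d} {R : realType}.
Variables (P : probability T R) (S : set R) (F : nat -> set (set T)) (X : nat -> T -> R).
Hypothesis hA0 : A0 P S F X.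
Implicit Types (A B : set T) (t s : nat).

Lemma filt_sigma t : (0 < t)%N -> sub_sigma (F t).
Proof. by case: hA0 => _ [[h _] _ _ _]; exact: h. Qed.

Lemma filt_mono s t A : (0 < s)%N -> (s <= t)%N -> F s A -> F t A.
Proof.
case: hA0 => _ [[_ h] _ _ _] s0 /subnK <-; elim: (t - s)%N => // n IH FA.
by rewrite addSn; apply: h; [rewrite addn_gt0 s0 orbT|exact: IH].
Qed.

Lemma filt_measurable t A : (0 < t)%N -> F t A -> measurable A.
Proof. by move=> /filt_sigma h; exact: sub_sigma_measurable. Qed.

Lemma filt_pre s t (B : set R) : (0 < s)%N -> (s <= t)%N -> measurable B ->
  F t (X s @^-1` B).
Proof.
move=> s0 st mB; apply: (filt_mono s0 st).
by case: hA0 => _ [_ _ h _]; exact: h.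
Qed.

Lemma filt_eq s t x : (0 < s)%N -> (s <= t)%N -> F t [set w | X s w = x].
Proof. by move=> s0 st; apply: (filt_pre (B := [set x])) => //; exact: measurable_set1. Qed.

Lemma filt_le s t x : (0 < s)%N -> (s <= t)%N -> F t [set w | X s w <= x].
Proof.
move=> s0 st; rewrite (_ : mkset _ = X s @^-1` `]-oo, x]%classic); first exact: filt_pre.
by apply/seteqP; split => w /=; rewrite in_itv.
Qed.

Lemma filt_ge s t x : (0 < s)%N -> (s <= t)%N -> F t [set w | x <= X s w].
Proof.
move=> s0 st; rewrite (_ : mkset _ = X s @^-1` `[x, +oo[%classic); first exact: filt_pre.
by apply/seteqP; split => w /=; rewrite in_itv/= andbT.
Qed.

Lemma process_measurable t : (0 < t)%N -> measurable_fun setT (X t).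
Proof.
by move=> t0 _ B mB; rewrite setTI; exact/(filt_measurable t0)/filt_pre.
Qed.

Lemma process_state t w : (0 < t)%N -> S (X t w).
Proof. by case: hA0 => _ [_ h _ _]; move=> /h. Qed.

Lemma process_ge0 t w : (0 < t)%N -> 0 <= X t w.
Proof. by move=> /process_state h; case: hA0 => -[/(_ _ (h w))]. Qed.

Lemma incr_measurable t : (0 < t)%N -> measurable_fun setT (incr X t).
Proof. by move=> t0; apply: measurable_funB; exact: process_measurable. Qed.

(* On a bounded range the process takes finitely many values, so that a property
   additive in the event can be checked on events where X_t is constant. *)
Lemma finite_values_ind t (Q : set T -> Prop) (D : set R) (M : R) : (0 < t)%N ->
  Q set0 ->
  (forall A B, F t A -> F t B -> A `&` B = set0 -> Q A -> Q B -> Q (A `|` B)) ->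
  (forall x A, S x -> D x -> F t A -> A `<=` [set w | X t w = x] -> Q A) ->
  forall A, F t A -> A `<=` [set w | D (X t w) /\ X t w <= M] -> Q A.
Proof.
move=> t0 Q0 QU Q1.
have [s sE] : exists s : seq R, [set x | S x /\ x <= M] = [set` s].
  by apply/finite_seqP; case: hA0 => -[_ h _ _] _; exact: h.
have H (l : seq R) A : F t A -> A `<=` [set w | D (X t w) /\ X t w \in l] -> Q A.
  elim: l A => [|x l IH] A FA Al.
    by rewrite (_ : A = set0)//; apply/seteqP; split => // w /Al[].
  have sig := filt_sigma t0.
  have Fx : F t [set w | X t w = x] by exact: filt_eq.
  rewrite -(setUIDK A [set w | X t w = x]); apply: QU.
  - exact: sub_sigmaI.
  - exact: sub_sigmaD.
  - by apply/seteqP; split => // w [[_ ?] [_]].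
  - have [[Sx Dx]|nx] := pselect (S x /\ D x).
      by apply: (Q1 x) => //; exact: sub_sigmaI.
    rewrite (_ : _ `&` _ = set0)//; apply/seteqP; split => // w [Aw /= wx].
    apply: nx; rewrite -wx; split; first exact: process_state.
    by have [] := Al _ Aw.
  - apply: IH; first exact: sub_sigmaD.
    move=> w [/Al[Dw /=]]; rewrite inE => /predU1P[wx|wl] nwx; first by [].
    by split.
move=> A FA AM; apply: (H s) => // w /AM[Dw wM]; split => //.
have : [set x | S x /\ x <= M] (X t w) by split => //; exact: process_state.
by rewrite sE.
Qed.

Section moments.
Variables (c s2 p : R).
Hypotheses (hA2 : A2 P c s2 F X) (hMp : Mp P p F X).

Let sq_meas t : (0 < t)%N -> measurable_fun setT (fun w => incr X t w ^+ 2).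
Proof. by move=> t0; apply: measurable_funX; exact: incr_measurable. Qed.

Let pow_meas t : (0 < t)%N -> measurable_fun setT (fun w => `|incr X t w| `^ p).
Proof.
move=> t0; apply: (measurableT_comp (measurable_powR p)).
by apply: measurableT_comp => //; exact: incr_measurable.
Qed.

Lemma moment_p : exists de C : R, [/\ 0 < de, 0 < C &
  forall t A k, (0 < t)%N -> F t A -> 0 <= k ->
  (forall w, A w -> C * (1 + X t w) `^ (p - 2 - de) <= k) ->
  P.-integrable A (EFin \o (fun w => `|incr X t w| `^ p)) /\
  \int[P]_(w in A) `|incr X t w| `^ p <= k * fine (P A)].
Proof.
have [de [C [de0 H]]] := hMp; exists de, (Num.max C 1); split => //.
  by rewrite lt_max ltr01 orbT.
move=> t A k t0 FA k0 Ck; have [Z [cZ Zle]] := H t t0.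
apply: integrable_of_le.
- exact: filt_measurable FA.
- exact: pow_meas.
- by move=> w; exact: powR_ge0.
apply: (cexp_le (filt_sigma t0) cZ FA k0).
apply: filterS Zle => w Zw Aw; apply: le_trans Zw _; rewrite lee_fin.
apply: le_trans (Ck _ Aw); rewrite ler_wpM2r ?powR_ge0//.
by rewrite le_max lexx.
Qed.

Let x_large (x : R) : expR 1 <= x -> 0 < x /\ 0 < ln x.
Proof.
move=> ex; have x0 : 0 < x by rewrite (lt_le_trans _ ex)// expR_gt0.
by split => //; rewrite (lt_le_trans _ (ln_ge1 ex)).
Qed.

Lemma moment_2_far : exists x0 : R, forall t A, (0 < t)%N -> F t A ->
  A `<=` [set w | x0 <= X t w] ->
  P.-integrable A (EFin \o (fun w => incr X t w ^+ 2)) /\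
  \int[P]_(w in A) incr X t w ^+ 2 <= 2 * s2 * fine (P A).
Proof.
have [s20 H] := hA2; have [x0 Hx0] := H _ s20.
exists (Num.max x0 (expR 1)) => t A t0 FA Ax.
have [_ [Z [cZ Zle]]] := Hx0 t t0.
apply: integrable_of_le.
- exact: filt_measurable FA.
- exact: sq_meas.
- by move=> w; exact: sqr_ge0.
apply: (cexp_le (filt_sigma t0) cZ FA); first by rewrite mulr_ge0// ltW.
apply: filterS Zle => w Zw /Ax /=; rewrite ge_max => /andP[xw ew].
have [fZ] := Zw xw; rewrite -(fineK fZ) lee_fin /= => h.
have [x00 l0] := x_large ew.
have : s2 / ln (X t w) <= s2.
  by rewrite ler_pdivrMr// ler_peMr ?(ltW s20)// ln_ge1.
by have := le_trans (ler_norm _) h; lra.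
Qed.

Lemma moment_12 (e : R) : 0 < e -> exists x0 : R, forall t A x, (0 < t)%N -> F t A ->
  x0 <= x -> A `<=` [set w | X t w = x] ->
  [/\ P.-integrable A (EFin \o incr X t),
      P.-integrable A (EFin \o (fun w => incr X t w ^+ 2)),
      `|\int[P]_(w in A) incr X t w - c / x * fine (P A)| <= e / (x * ln x) * fine (P A) &
      `|\int[P]_(w in A) incr X t w ^+ 2 - s2 * fine (P A)| <= e / ln x * fine (P A)].
Proof.
move=> e0; have [s20 H] := hA2; have [x0 Hx0] := H _ e0.
exists (Num.max x0 (expR 1)) => t A x t0 FA; rewrite ge_max => /andP[x0x ex] Ax.
have mA := filt_measurable t0 FA.
have [x00 l0] := x_large ex.
have el0 : 0 <= e / ln x by rewrite divr_ge0// ltW.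
have [[Zp [Zm [cZp [cZm Z1]]]] [Z2 [cZ2 HZ2]]] := Hx0 t t0.
have sig := filt_sigma t0.
have up2 : (\int[P]_(w in A) (incr X t w ^+ 2)%:E <= ((s2 + e / ln x) * fine (P A))%:E)%E.
  apply: (cexp_le sig cZ2 FA); first by rewrite addr_ge0// ltW.
  apply: filterS HZ2 => w Zw /Ax /= wx; rewrite wx in Zw.
  have [fZ h] := Zw x0x; rewrite -(fineK fZ) lee_fin.
  by have := le_trans (ler_norm _) h; lra.
have low2 : (((s2 - e / ln x) * fine (P A))%:E <= \int[P]_(w in A) (incr X t w ^+ 2)%:E)%E.
  apply: (cexp_ge sig cZ2 FA).
  apply: filterS HZ2 => w Zw /Ax /= wx; rewrite wx in Zw.
  have [fZ h] := Zw x0x; rewrite -(fineK fZ) lee_fin.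
  by move: h; rewrite ler_norml => /andP[? _]; lra.
have [i2 le2] := integrable_of_le mA (sq_meas t0) (fun w => sqr_ge0 (incr X t w)) up2.
have i1 : P.-integrable A (EFin \o incr X t).
  apply: (@le_integrable _ _ _ P _ mA _ (fun w => (1 + incr X t w ^+ 2)%:E)).
  - by apply/measurable_EFinP; apply: measurable_funS (incr_measurable t0).
  - move=> w _ /=; rewrite lee_fin [leRHS]ger0_norm ?addr_ge0 ?sqr_ge0//.
    by rewrite ler_norml; apply/andP; split; nra.
  - apply: (@integrableD _ _ _ P _ mA (EFin \o cst 1) (EFin \o fun w => incr X t w ^+ 2)) => //.
    exact: finite_measure_integrable_cst.
split => //; last first.
  rewrite ler_norml; apply/andP; split; last by move: le2; rewrite mulrDl; lra.
  have := fine_le _ _ low2; rewrite /= integrable_fin_num// => /(_ isT isT).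
  by rewrite /Rintegral mulrBl; lra.
have posn (h : T -> \bar R) : h = ((EFin \o incr X t)^\+)%E \/ h = ((EFin \o incr X t)^\-)%E ->
    (\int[P]_(w in A) h w \is a fin_num)%E.
  by case=> ->; apply: integrable_fin_num => //;
    [exact: integrable_funepos|exact: integrable_funeneg].
have pE : (fun w => Defs.posE (incr X t w)) = ((EFin \o incr X t)^\+)%E.
  by apply/funext => w; rewrite funeposE /Defs.posE /= EFin_max.
have nE : (fun w => Defs.negE (incr X t w)) = ((EFin \o incr X t)^\-)%E.
  by apply/funext => w; rewrite funenegE /Defs.negE /= EFin_max.
have fp : (\int[P]_(w in A) Defs.posE (incr X t w) \is a fin_num)%E.
  by rewrite pE; apply: posn; left.
have fm : (\int[P]_(w in A) Defs.negE (incr X t w) \is a fin_num)%E.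
  by rewrite nE; apply: posn; right.
have IE : \int[P]_(w in A) incr X t w =
    fine (\int[P]_(w in A) Defs.posE (incr X t w))%E - fine (\int[P]_(w in A) Defs.negE (incr X t w))%E.
  by rewrite /Rintegral integralE -pE -nE fineB.
have Z1x : {ae P, forall w, A w -> [/\ Zp w \is a fin_num, Zm w \is a fin_num &
    `|fine (Zp w) - fine (Zm w) - c / x| <= e / (x * ln x)]}.
  by apply: filterS Z1 => w Zw /Ax /= wx; rewrite wx in Zw; exact: Zw.
have aeu : {ae P, forall w, A w -> [/\ Zp w \is a fin_num, Zm w \is a fin_num &
    fine (Zp w) - fine (Zm w) <= c / x + e / (x * ln x)]}.
  apply: filterS Z1x => w + Aw => /(_ Aw)[f1 f2 h]; split => //.
  by have := le_trans (ler_norm _) h; lra.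
have ael : {ae P, forall w, A w -> [/\ Zm w \is a fin_num, Zp w \is a fin_num &
    fine (Zm w) - fine (Zp w) <= - (c / x) + e / (x * ln x)]}.
  apply: filterS Z1x => w + Aw => /(_ Aw)[f1 f2 h]; split => //.
  by move: h; rewrite ler_norml => /andP[? _]; lra.
have := cexp_diff_le sig cZp cZm FA aeu fp fm.
have := cexp_diff_le sig cZm cZp FA ael fm fp.
rewrite !mulrDl mulNr IE ler_norml => ? ?; apply/andP; split; lra.
Qed.

End moments.
End process.

Section drift.
Context {d : measure_display} {T : measurableType d} {R : realType}.
Variables (P : probability T R) (S : set R) (F : nat -> set (set T)) (X : nat -> T -> R).
Hypothesis hA0 : A0 P S F X.
Implicit Types (A B : set T) (t s : nat).

Lemma le_Rintegral_values t (u v : T -> R) (D : set R) (M : R) : (0 < t)%N ->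
  P.-integrable setT (EFin \o u) -> P.-integrable setT (EFin \o v) ->
  (forall x A, S x -> D x -> F t A -> A `<=` [set w | X t w = x] ->
    \int[P]_(w in A) u w <= \int[P]_(w in A) v w) ->
  forall A, F t A -> A `<=` [set w | D (X t w) /\ X t w <= M] ->
    \int[P]_(w in A) u w <= \int[P]_(w in A) v w.
Proof.
move=> t0 iu iv H; apply: (finite_values_ind hA0 t0) => //.
  by rewrite !Rintegral_set0.
move=> A B FA FB AB hA hB.
have mA := filt_measurable hA0 t0 FA; have mB := filt_measurable hA0 t0 FB.
have mAB : measurable (A `|` B) by exact: measurableU.
have dAB : [disjoint A & B] by apply/disj_setPS; rewrite AB.
rewrite !Rintegral_setU//; first exact: lerD.
- exact: integrableS iv.
- exact: integrableS iu.
Qed.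

Section clamped.
Variables (g n a : R).
Hypotheses (ea : expR 1 <= a).
Hypothesis incF : forall u v, a <= u -> u < v -> powln g n u < powln g n v.
Local Notation f b := (clamp (powln g n) a b).

Lemma powln_homo u v : a <= u -> u <= v -> powln g n u <= powln g n v.
Proof. by move=> au; rewrite le_eqVlt => /predU1P[->//|uv]; exact/ltW/incF. Qed.

Lemma clamp_powln_homo b u v : a <= b -> u <= v -> f b u <= f b v.
Proof. by move=> ab; apply: le_clamp => //; exact: powln_homo. Qed.

Lemma clamp_powln_gt0 b u : a <= b -> 0 < f b u.
Proof.
move=> ab; apply: powln_gt0; rewrite (lt_le_trans expR1_gt1)//.
by rewrite (le_trans ea)// le_min ab andbT le_max lexx orbT.
Qed.

Lemma clamp_powln_le b u : a <= b -> f b u <= powln g n b.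
Proof.
move=> ab; apply: powln_homo; first by rewrite le_min ab andbT le_max lexx orbT.
by rewrite ge_min lexx orbT.
Qed.

Lemma clamp_powln_measurable b : measurable_fun setT (f b).
Proof.
have mp : measurable_fun [set: R] (powln g n).
  apply: measurable_funM; first exact: measurable_powR.
  by apply: (measurableT_comp (measurable_powR n)); exact: measurable_ln.
apply: (measurableT_comp mp); apply: measurable_minr => //; exact: measurable_maxr.
Qed.

Lemma clamp_powln_integrable b t A : a <= b -> (0 < t)%N -> measurable A ->
  P.-integrable A (EFin \o (fun w => f b (X t w))).
Proof.
move=> ab t0 mA; apply: (@bound_integrable _ _ _ P _ _ (powln g n b)) => //.
  by apply: (measurableT_comp (clamp_powln_measurable b)); exact: process_measurable hA0 _ t0.
by move=> w _; rewrite gtr0_norm ?clamp_powln_gt0// clamp_powln_le.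
Qed.

End clamped.

Lemma double_le (u v : R) : 0 <= u -> 2 * u <= v -> u <= v.
Proof. lra. Qed.

Section estimate.
Variables (c s2 p : R).
Hypotheses (hA2 : A2 P c s2 F X) (hMp : Mp P p F X) (p2 : 2 < p).

Lemma drift_estimate (g n : R) : 0 < g -> g < p -> exists a : R, [/\ expR 1 <= a,
  forall u v, a <= u -> u < v -> powln g n u < powln g n v &
  forall ep, 0 < ep -> exists2 x0 : R, 2 * a <= x0 &
    forall t A x b, (0 < t)%N -> F t A -> A `<=` [set w | X t w = x] ->
    x0 <= x -> 2 * x <= b ->
    `|\int[P]_(w in A) clamp (powln g n) a b (X t.+1 w)
      - (powln g n x + powln_drift g n c s2 x) * fine (P A)|
    <= ep * (x `^ (g - 2) * ln x `^ (n - 1)) * fine (P A)].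
Proof.
move=> g0 gp; have [s20 _] := hA2.
have [a ea incF] := powln_incr n g0; exists a; split => // ep ep0.
have [de [Cp [de0 Cp0 Hp]]] := moment_p hA0 hMp.
have p20 : 0 < p - 2 by rewrite subr_gt0.
pose th : R := Num.min (1 / 2) (de / (3 * (p - 2))).
have th0 : 0 < th by rewrite lt_min !divr_gt0// mulr_gt0.
have th1 : th <= 1 / 2 by rewrite ge_min lexx.
have th2 : (p - 2) * th <= de / 3.
  apply: (@le_trans _ _ ((p - 2) * (de / (3 * (p - 2))))).
    by rewrite ler_pM2l// ge_min lexx orbT.
  by rewrite le_eqVlt; apply/orP; left; apply/eqP; field; rewrite gt_eqF.
pose ka : R := Num.min (th / 2) (de / 3).
have ka0 : 0 < ka by rewrite lt_min !divr_gt0.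
have ka1 : ka <= th / 2 by rewrite ge_min lexx.
have ka2 : ka <= de / 3 by rewrite ge_min lexx orbT.
pose s : R := Num.min ka (p - g).
have s0 : 0 < s by rewrite lt_min ka0 subr_gt0.
have s1 : s <= ka by rewrite ge_min lexx.
have s3 : g + s <= p by rewrite -lerBrDl ge_min lexx orbT.
pose be : R := 1 - th.
have be01 : 0 < be < 1 by apply/andP; split; rewrite /be; lra.
have h1 : s + (be - 1) <= - ka by rewrite /be; lra.
have h2 : s + be * (2 - p) + (p - 2 - de) <= - ka.
  rewrite [leLHS](_ : _ = s + (p - 2) * th - de); last by rewrite /be; ring.
  lra.
have [C C0 HC] := clamp_powln_expansion p2 be01 s0 s3 ea incF.
have [e e0 [x1 [_ Hx1]]] := @powln_drift_estimate R g n c s2 p de Cp C s be ka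
  s20 Cp0 C0 ka0 h1 h2 ep ep0.
have [x2 Hx2] := moment_12 hA0 hA2 e0.
exists (Num.max (2 * a) (Num.max (x1 + 1) x2)); first by rewrite le_max lexx.
move=> t A x b t0 FA Ax; rewrite !ge_max => /and3P[ax x1x x2x] xb.
have mA := filt_measurable hA0 t0 FA.
have [i1 i2 m1 m2] := Hx2 t A x t0 FA x2x Ax.
have a0 : 0 < a by exact: lt_le_trans (expR_gt0 1) ea.
have ax' := double_le (ltW a0) ax.
have x0 : 0 < x by exact: lt_le_trans a0 ax'.
have xb' := double_le (ltW x0) xb.
have ab : a <= b by exact: le_trans ax' xb'.
have [||ip mp] := Hp t A (Cp * (1 + x) `^ (p - 2 - de)) t0 FA _ _.
- by rewrite mulr_ge0 ?powR_ge0// ltW.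
- by move=> w /Ax /= ->.
have if1 := @clamp_powln_integrable g n a ea incF b t.+1 A ab isT mA.
set f := clamp (powln g n) a b.
set q := fine (P A) in m1 m2 mp *.
set M1 := \int[P]_(w in A) incr X t w in m1.
set M2 := \int[P]_(w in A) incr X t w ^+ 2 in m2.
set M := \int[P]_(w in A) `|incr X t w| `^ p in mp.
have fx : f x = powln g n x by rewrite /f clamp_id// ax' xb'.
pose F1 := powln1 g n x; pose F2 := powln2 g n x.
pose h w := f (X t.+1 w) - f x - F1 * incr X t w - F2 / 2 * incr X t w ^+ 2.
have ic k : P.-integrable A (EFin \o (fun=> k)) by exact: finite_measure_integrable_cst.
have iZ k (u : T -> R) : P.-integrable A (EFin \o u) ->
    P.-integrable A (EFin \o (fun w => k * u w)).
  by move=> iu; apply: (integrableZl mA k iu).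
have iB (u v : T -> R) : P.-integrable A (EFin \o u) -> P.-integrable A (EFin \o v) ->
    P.-integrable A (EFin \o (fun w => u w - v w)).
  by move=> iu iv; apply: (integrableB mA iu iv).
have iD (u v : T -> R) : P.-integrable A (EFin \o u) -> P.-integrable A (EFin \o v) ->
    P.-integrable A (EFin \o (fun w => u w + v w)).
  by move=> iu iv; apply: (integrableD mA iu iv).
have if2 := iB _ _ if1 (ic (f x)).
have if3 := iB _ _ if2 (iZ F1 _ i1).
have ih : P.-integrable A (EFin \o h) := iB _ _ if3 (iZ (F2 / 2) _ i2).
have hE : \int[P]_(w in A) h w
    = \int[P]_(w in A) f (X t.+1 w) - f x * q - F1 * M1 - F2 / 2 * M2.
  rewrite /h (RintegralB mA if3 (iZ (F2 / 2) _ i2)) (RintegralB mA if2 (iZ F1 _ i1)).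
  rewrite (RintegralB mA if1 (ic (f x))) Rintegral_cstM//.
  by rewrite (RintegralZl _ mA i1) (RintegralZl _ mA i2).
rewrite -fx [(f x + _) * q]mulrDl opprD addrA.
apply: (Hx1 x _ q M1 M2 M (\int[P]_(w in A) f (X t.+1 w) - f x * q)).
- by rewrite (lt_le_trans _ x1x)// ltrDl.
- exact: fine_prob_ge0.
- exact: m1.
- exact: m2.
- by apply: Rintegral_ge0 => w _; exact: sqr_ge0.
- by apply: Rintegral_ge0 => w _; exact: powR_ge0.
- exact: mp.
rewrite -hE; apply: le_trans (le_normr_Rintegral mA ih) _.
set E1 := x `^ (be - 1); set E2 := x `^ (be * (2 - p)); set Q := C * _.
have -> : Q * (E1 * M2 + E2 * M) =
    \int[P]_(w in A) (Q * E1 * incr X t w ^+ 2 + Q * E2 * `|incr X t w| `^ p).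
  rewrite (RintegralD mA (iZ (Q * E1) _ i2) (iZ (Q * E2) _ ip)).
  by rewrite (RintegralZl _ mA i2) (RintegralZl _ mA ip) mulrDr !mulrA.
apply: le_Rintegral => //.
- exact: (integrable_norm ih).
- exact: (iD _ _ (iZ (Q * E1) _ i2) (iZ (Q * E2) _ ip)).
move=> w Aw; have wx := Ax _ Aw.
have Xx : X t.+1 w = x + incr X t w by rewrite /incr wx addrC subrK.
have xz : - x <= incr X t w.
  by rewrite /incr wx lerBrDl addrN; exact: (process_ge0 hA0).
have H := HC b x (incr X t w) ax xb xz.
rewrite -Xx -/f -/F1 -/F2 -/E1 -/E2 -/Q in H; rewrite /h.
move: (incr X t w) H => z H.
rewrite [leRHS](_ : _ = Q * (E1 * z ^+ 2 + E2 * `|z| `^ p)); last by ring.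
by rewrite [F2 / 2 * _]mulrAC.
Qed.

End estimate.
End drift.

(** * Confinement and the upper tail *)

Section set_integrals.
Context {d : measure_display} {T : measurableType d} {R : realType}.
Variable P : probability T R.
Implicit Types (A B : set T) (h : T -> R).

Lemma Rintegral_setI_setD A B h : measurable A -> measurable B ->
  P.-integrable A (EFin \o h) ->
  \int[P]_(w in A) h w = \int[P]_(w in A `&` B) h w + \int[P]_(w in A `\` B) h w.
Proof.
move=> mA mB ih; rewrite -[in LHS](setUIDK A B) Rintegral_setU//.
- exact: measurableI.
- exact: measurableD.
- by rewrite setUIDK.
- by apply/disj_setPS => w [[_ ?] [_]].
Qed.

Lemma le_Rintegral_set A B h : measurable A -> measurable B -> A `<=` B ->
  P.-integrable B (EFin \o h) -> (forall w, 0 <= h w) ->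
  \int[P]_(w in A) h w <= \int[P]_(w in B) h w.
Proof.
move=> mA mB AB ih h0; rewrite (Rintegral_setI_setD mB mA ih) setIC.
by rewrite (setIidl AB) lerDl; apply: Rintegral_ge0.
Qed.

Lemma Rintegral_bounds A h (l u : R) : measurable A -> P.-integrable A (EFin \o h) ->
  (forall w, A w -> l <= h w <= u) ->
  l * fine (P A) <= \int[P]_(w in A) h w <= u * fine (P A).
Proof.
move=> mA ih H; rewrite -!(Rintegral_cstM P _ mA); apply/andP; split;
  apply: le_Rintegral => //; try exact: finite_measure_integrable_cst;
  by move=> w /H /andP[].
Qed.

End set_integrals.

Lemma sum_shift_le (R : realType) (u : nat -> R) (m n : nat) :
  (forall i, 0 <= u i) -> (forall i, u i.+1 <= u i) ->
  \sum_(i < n) (u i - u (i + m)%N) <= m%:R * u 0%N.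
Proof.
move=> u0 ud.
have um i : u i <= u 0%N by elim: i => // i; apply: le_trans (ud i).
elim: m => [|m IH].
  by rewrite mul0r big1// => i _; rewrite addn0 subrr.
have -> : \sum_(i < n) (u i - u (i + m.+1)%N) =
    \sum_(i < n) (u i - u (i + m)%N) + \sum_(i < n) (u (i + m)%N - u (i.+1 + m)%N).
  by rewrite -big_split; apply: eq_bigr => i _ /=; rewrite addrA subrK addnS.
rewrite -natr1 mulrDl mul1r lerD//.
rewrite -(big_mkord xpredT (fun i => u (i + m)%N - u (i.+1 + m)%N)) /=.
rewrite (@telescope_sumr_eq _ 0 n (fun i => - u (i + m)%N))//; last first.
  by move=> k _; rewrite opprK addrC.
by rewrite opprK add0n addrC lerBlDr (le_trans (um m))// lerDl.
Qed.

Section survival.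
Context {d : measure_display} {T : measurableType d} {R : realType}.
Variables (P : probability T R) (S : set R) (F : nat -> set (set T)) (X : nat -> T -> R).
Hypothesis hA0 : A0 P S F X.
Implicit Types (A B : set T) (t s : nat).

Local Notation sig t0 := (filt_sigma hA0 t0).

Definition alive t : set T := [set w | forall s, (2 <= s <= t)%N -> X s w <> 0].
Definition below (y : R) t : set T := [set w | forall s, (1 <= s <= t)%N -> X s w < y].
Definition confined y t : set T := alive t `&` below y t.

Lemma filt_forall (Q : set R) a t : measurable Q -> (0 < a)%N -> (0 < t)%N ->
  F t [set w | forall s, (a <= s <= t)%N -> Q (X s w)].
Proof.
move=> mQ a0 t0.
rewrite (_ : mkset _ = ~` \bigcup_s (if (a <= s <= t)%N then X s @^-1` (~` Q) else set0)).
  apply: sub_sigmaC (sig t0) _ _; apply: sub_sigma_bigcup (sig t0) _ _ => s.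
  case: ifPn => [/andP[sa st]|_]; last exact: sub_sigma0 (sig t0).
  by apply: (filt_pre hA0) => //; [exact: leq_trans sa|exact: measurableC].
apply/seteqP; split => w /= H.
  by move=> [s _]; case: ifPn => // /H.
move=> s sat; apply: contrapT => nQ; apply: H; exists s => //.
by rewrite sat.
Qed.

Lemma filt_alive t : (0 < t)%N -> F t (alive t).
Proof.
move=> t0; apply: (@filt_forall (~` [set 0])) => //.
by apply: measurableC; exact: measurable_set1.
Qed.

Lemma filt_below y t : (0 < t)%N -> F t (below y t).
Proof.
move=> t0; rewrite (_ : below y t =
  [set w | forall s, (1 <= s <= t)%N -> `]-oo, y[%classic (X s w)]); last first.
  by apply/seteqP; split => w /= H s st; have := H s st; rewrite /= in_itv.
exact: filt_forall.
Qed.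

Lemma filt_confined y t : (0 < t)%N -> F t (confined y t).
Proof. by move=> t0; apply: sub_sigmaI (sig t0) _ _ _ _; [exact: filt_alive|exact: filt_below]. Qed.

Lemma alive_mono s t : (s <= t)%N -> alive t `<=` alive s.
Proof.
by move=> st w H k /andP[k1 k2]; apply: H; rewrite k1 (leq_trans k2).
Qed.

Lemma below_mono y s t : (s <= t)%N -> below y t `<=` below y s.
Proof.
by move=> st w H k /andP[k1 k2]; apply: H; rewrite k1 (leq_trans k2).
Qed.

Lemma confined_mono y s t : (s <= t)%N -> confined y t `<=` confined y s.
Proof. by move=> st w [? ?]; split; [exact: alive_mono st _ _|exact: below_mono st _ _]. Qed.

Section visits.
Hypothesis hA1 : A1 P S F X.

Definition hits t m : set T := [set w | exists2 s, (t < s <= t + m)%N & X s w = 0].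

Lemma filt_hits t m : (0 < t)%N -> F (t + m)%N (hits t m).
Proof.
move=> t0; have tm0 : (0 < t + m)%N by rewrite addn_gt0 t0.
rewrite (_ : hits t m = ~` [set w | forall s, (t.+1 <= s <= t + m)%N -> (~` [set 0]) (X s w)]).
  apply: sub_sigmaC (sig tm0) _ _; apply: filt_forall => //.
  by apply: measurableC; exact: measurable_set1.
apply/seteqP; split => w /=.
  by move=> [s st X0] H; exact: (H s st).
move=> H; apply: contrapT => H'; apply: H => s st X0.
by apply: H'; exists s.
Qed.

Lemma A1_reach : exists (m : R -> R -> nat) (phi : R -> R -> R),
  (forall x y, S x -> S y -> (0 < m x y)%N /\ 0 < phi x y) /\
  forall t A x y, (0 < t)%N -> S x -> S y -> F t A -> A `<=` [set w | X t w = x] ->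
  phi x y * fine (P A) <= fine (P (A `&` [set w | X (t + m x y)%N w = y])).
Proof.
have [m [phi [H1 H2]]] := hA1; exists m, phi; split => // t A x y t0 Sx Sy FA Ax.
have [Z [cZ Zge]] := H2 t t0 y Sy.
have mA := filt_measurable hA0 t0 FA.
have mE : measurable [set w | X (t + m x y)%N w = y].
  have tm : (0 < t + m x y)%N by rewrite addn_gt0 t0.
  exact: (filt_measurable hA0 tm (filt_eq hA0 _ tm (leqnn _))).
have := @cexp_ge _ _ _ P _ (sig t0) _ _ A (phi x y) cZ FA _.
rewrite (eq_integral (fun w => (\1_[set w | X (t + m x y)%N w = y] w)%:E)); last first.
  move=> w; rewrite inE => Aw; have wx := Ax _ Aw.
  congr (_%:E); rewrite !indicE; congr (_%:R); congr nat_of_bool.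
  by apply/idP/idP; rewrite !inE /= wx.
rewrite integral_indic// setIC => H.
rewrite -lee_fin fineK; last by apply: fin_num_prob; exact: measurableI.
apply: H; apply: filterS Zge => w + Aw.
by have /= -> := Ax _ Aw.
Qed.

Lemma hit_zero_bound (x0 : R) : exists (m : nat) (phi : R), 0 < phi /\
  forall t A, (0 < t)%N -> F t A -> A `<=` [set w | X t w <= x0] ->
  phi * fine (P A) <= fine (P (A `&` hits t m)).
Proof.
have [m [phi [Hpos Hr]]] := A1_reach.
have S0 : S 0 by case: hA0 => -[].
have [l lE] : exists l : seq R, [set x | S x /\ x <= x0] = [set` l].
  by apply/finite_seqP; case: hA0 => -[_ h _ _] _; exact: h.
have [m0 [f0 [f00 H0]]] : exists (m0 : nat) (f0 : R), 0 < f0 /\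
    forall x, x \in l -> S x -> (m x 0%R <= m0)%N /\ f0 <= phi x 0.
  elim: {lE} l => [|x l [m0 [f0 [f00 H0]]]]; first by exists 0%N, 1.
  have [Sx|nSx] := pselect (S x); last first.
    exists m0, f0; split => // z; rewrite inE => /predU1P[->//|]; exact: H0.
  exists (maxn m0 (m x 0%R)), (Num.min f0 (phi x 0)); split.
    by rewrite lt_min f00; have [] := Hpos _ _ Sx S0.
  move=> z; rewrite inE => /predU1P[-> _|zl Sz].
    by rewrite leq_maxr ge_min lexx orbT.
  by have [? ?] := H0 z zl Sz; split; [rewrite leq_max; apply/orP; left|rewrite ge_min; apply/orP; left].
exists m0, f0; split => // t A t0 FA Ax.
have tm0 : (0 < t + m0)%N by rewrite addn_gt0 t0.
have mH : measurable (hits t m0) by exact: (filt_measurable hA0 tm0 (filt_hits m0 t0)).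
have := @finite_values_ind _ _ _ P S F X hA0 t
  (fun A => f0 * fine (P A) <= fine (P (A `&` hits t m0))) [set x | x <= x0] x0 t0.
apply => //; last by move=> w /Ax.
- by rewrite set0I measure0 mulr0.
- move=> B C FB FC BC hB hC.
  have mB := filt_measurable hA0 t0 FB; have mC := filt_measurable hA0 t0 FC.
  rewrite setIUl !prob_setU//; try exact: measurableI; first by rewrite mulrDr lerD.
  by rewrite setIACA BC set0I.
move=> x B Sx xx0 FB Bx.
have xl : x \in l by have : [set` l] x by rewrite -lE.
have [mx px] := H0 x xl Sx.
apply: le_trans (le_trans (Hr t B x 0 t0 Sx S0 FB Bx) _).
  by rewrite ler_wpM2r// fine_prob_ge0.
have mB := filt_measurable hA0 t0 FB.
have tm : (0 < t + m x 0%R)%N by rewrite addn_gt0 t0.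
have mE := filt_measurable hA0 tm (filt_eq hA0 0 tm (leqnn _)).
apply: le_prob; [exact: measurableI|exact: measurableI|].
move=> w [Bw /= w0]; split => //; exists (t + m x 0%R)%N => //.
rewrite leq_add2l mx andbT -[X in (X < _)%N]addn0 ltn_add2l.
by have [] := Hpos _ _ Sx S0.
Qed.

Lemma visits_bound (x0 : R) : exists2 V : R, 0 <= V &
  forall t A n, (0 < t)%N -> F t A ->
  \sum_(i < n) fine (P (A `&` alive (t + i) `&` [set w | X (t + i)%N w <= x0]))
    <= V * fine (P A).
Proof.
have [m [phi [phi0 H]]] := hit_zero_bound x0.
exists (m%:R / phi); first by rewrite divr_ge0// ltW.
move=> t A n t0 FA.
have ti0 i : (0 < t + i)%N by rewrite addn_gt0 t0.
have FAi i : F (t + i)%N (A `&` alive (t + i)).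
  by apply: sub_sigmaI (sig (ti0 i)) _ _ _ _; [exact: filt_mono hA0 _ _ _ t0 (leq_addr _ _) FA|exact: filt_alive].
have mAi i := filt_measurable hA0 (ti0 i) (FAi i).
pose u i := fine (P (A `&` alive (t + i))).
have ud i : u i.+1 <= u i.
  by apply: le_prob => //; apply: setIS; apply: alive_mono; rewrite leq_add2l.
have u0 i : 0 <= u i by exact: fine_prob_ge0.
have key i : phi * fine (P (A `&` alive (t + i) `&` [set w | X (t + i)%N w <= x0]))
    <= u i - u (i + m)%N.
  have Fi : F (t + i)%N (A `&` alive (t + i) `&` [set w | X (t + i)%N w <= x0]).
    exact: (sub_sigmaI (sig (ti0 i)) (FAi i) (filt_le hA0 x0 (ti0 i) (leqnn _))).
  apply: le_trans (H _ _ (ti0 i) Fi _) _; first by move=> w [].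
  have mH : measurable (hits (t + i) m).
    have tim : (0 < t + i + m)%N by rewrite addn_gt0 ti0.
    exact: (filt_measurable hA0 tim (filt_hits m (ti0 i))).
  have mi := filt_measurable hA0 (ti0 i) Fi.
  rewrite lerBrDr /u -prob_setU//; last 2 first.
  - exact: measurableI.
  - apply/seteqP; split => // w [[_ [s /andP[s1 s2] X0]] [_ al]].
    apply: (al s) => //; rewrite addnA s2 andbT.
    by apply: leq_ltn_trans s1; rewrite ti0.
  apply: le_prob => //; first by apply: measurableU => //; exact: measurableI.
  move=> w [[[? _] _]//|[Aw al]]; split => //.
  by apply: alive_mono al; rewrite addnA leq_addr.
rewrite mulrAC ler_pdivlMr// mulrC mulr_sumr.
apply: (@le_trans _ _ (\sum_(i < n) (u i - u (i + m)%N))); first by apply: ler_sum.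
apply: le_trans (sum_shift_le m n u0 ud) _; rewrite ler_wpM2l// /u addn0.
have := mAi 0%N; rewrite addn0 => mA0.
by apply: le_prob => //; exact: (filt_measurable hA0 t0 FA).
Qed.

End visits.

Lemma confined_telescope (V x0 y fM B k fy : R) (f : R -> R) :
  (forall t A n, (0 < t)%N -> F t A ->
    \sum_(i < n) fine (P (A `&` alive (t + i) `&` [set w | X (t + i)%N w <= x0]))
    <= V * fine (P A)) ->
  measurable_fun setT f -> (forall u, 0 <= f u <= fM) -> (forall u, y <= u -> fy <= f u) ->
  0 <= k -> 0 <= B ->
  (forall t A, (0 < t)%N -> F t A -> A `<=` [set w | x0 <= X t w < y] ->
    \int[P]_(w in A) f (X t.+1 w) <= \int[P]_(w in A) f (X t w) - k * fine (P A)) ->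
  (forall t A, (0 < t)%N -> F t A -> A `<=` [set w | X t w <= x0] ->
    \int[P]_(w in A) f (X t.+1 w) <= B * fine (P A)) ->
  forall t A n, (0 < t)%N -> F t A ->
  k * (\sum_(i < n) fine (P (A `&` confined y (t + i))))
  + fy * (\sum_(i < n) fine (P (A `&` confined y (t + i) `&` [set w | y <= X (t + i).+1 w])))
  <= \int[P]_(w in A `&` confined y t) f (X t w) + (B + k) * (V * fine (P A)).
Proof.
move=> visits mf fb fyP k0 B0 far near t A n t0 FA.
have ti0 i : (0 < t + i)%N by rewrite addn_gt0 t0.
pose G i := A `&` confined y (t + i).
have FAi i : F (t + i)%N A by exact: (filt_mono hA0 t0 (leq_addr _ _) FA).
have FG i : F (t + i)%N (G i).
  exact: (sub_sigmaI (sig (ti0 i)) (FAi i) (filt_confined y (ti0 i))).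
have mG i := filt_measurable hA0 (ti0 i) (FG i).
have intf B' s : (0 < s)%N -> measurable B' -> P.-integrable B' (EFin \o (fun w => f (X s w))).
  move=> s0 mB; apply: (@bound_integrable _ _ _ P _ _ fM) => //.
    by apply: (measurableT_comp mf); exact: process_measurable hA0 _ s0.
  by move=> w _; have /andP[? ?] := fb (X s w); rewrite ger0_norm.
pose I i := \int[P]_(w in G i) f (X (t + i)%N w).
pose vis i := fine (P (A `&` alive (t + i) `&` [set w | X (t + i)%N w <= x0])).
have step i : k * fine (P (G i)) + fy * fine (P (G i `&` [set w | y <= X (t + i).+1 w]))
    + I i.+1 <= I i + (B + k) * vis i.
  have Fl : F (t + i)%N [set w | X (t + i)%N w <= x0] := filt_le hA0 x0 (ti0 i) (leqnn _).
  set L := mkset _ in Fl.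
  have mL := filt_measurable hA0 (ti0 i) Fl.
  have Fh : F (t + i).+1 [set w | y <= X (t + i).+1 w] by exact: (filt_ge hA0).
  set H := mkset _ in Fh *.
  have mH := filt_measurable hA0 (ltn0Sn (t + i)) Fh.
  have FGL := sub_sigmaI (sig (ti0 i)) (FG i) Fl.
  have FGD := sub_sigmaD (sig (ti0 i)) (FG i) Fl.
  have mGL := filt_measurable hA0 (ti0 i) FGL.
  have mGD := filt_measurable hA0 (ti0 i) FGD.
  have mGH : measurable (G i `&` H) by exact: measurableI.
  have mGH' : measurable (G i `\` H) by exact: measurableD.
  have i1 := intf (G i) (t + i).+1 isT (mG i).
  have i0 := intf (G i) (t + i)%N (ti0 i) (mG i).
  have e1 := Rintegral_setI_setD (mG i) mL i1.
  have e2 := Rintegral_setI_setD (mG i) mH i1.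
  have b1 : \int[P]_(w in G i `&` L) f (X (t + i).+1 w) <= B * fine (P (G i `&` L)).
    by apply: near => // w [].
  have b2 : \int[P]_(w in G i `\` L) f (X (t + i).+1 w) <=
      \int[P]_(w in G i `\` L) f (X (t + i)%N w) - k * fine (P (G i `\` L)).
    apply: far => // w [[_ [_ bl]] nL] /=; apply/andP; split.
      by rewrite leNgt; apply/negP => /ltW.
    by apply: bl; rewrite ti0 leqnn.
  have b3 : \int[P]_(w in G i `\` L) f (X (t + i)%N w) <= I i.
    apply: le_Rintegral_set => //.
    by move=> w; have /andP[] := fb (X (t + i)%N w).
  have b4 : fy * fine (P (G i `&` H)) <= \int[P]_(w in G i `&` H) f (X (t + i).+1 w).
    rewrite -(Rintegral_cstM P _ mGH); apply: le_Rintegral => //.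
    - exact: finite_measure_integrable_cst.
    - exact: intf.
    - by move=> w [_ /fyP].
  have b5 : I i.+1 <= \int[P]_(w in G i `\` H) f (X (t + i).+1 w).
    rewrite /I addnS; apply: le_Rintegral_set => //.
    - move=> w [Aw cw]; split.
        by split=> //; apply: confined_mono cw; rewrite addnS.
      move=> /=; case: cw => _ /(_ (t + i).+1); rewrite addnS leqnn => /(_ isT) h1 h2.
      by have := lt_le_trans h1 h2; rewrite ltxx.
    - exact: intf.
    - by move=> w; have /andP[] := fb (X (t + i).+1 w).
  have pE := prob_setI_setD P (mG i) mL.
  have vE : (B + k) * fine (P (G i `&` L)) <= (B + k) * vis i.
    rewrite ler_wpM2l ?addr_ge0//; apply: le_prob => //.
      apply: measurableI => //.
      exact: (filt_measurable hA0 (ti0 i) (sub_sigmaI (sig (ti0 i)) (FAi i) (filt_alive (ti0 i)))).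
    by move=> w [[? [? _]] ?].
  rewrite mulrDl in vE; rewrite pE mulrDr; lra.
have tot m : k * (\sum_(i < m) fine (P (G i)))
    + fy * (\sum_(i < m) fine (P (G i `&` [set w | y <= X (t + i).+1 w]))) + I m
    <= I 0%N + (B + k) * \sum_(i < m) vis i.
  elim: m => [|m IH]; first by rewrite !big_ord0 !mulr0 !addr0 add0r.
  by rewrite !big_ord_recr /= !mulrDr; have := step m; lra.
have In0 : 0 <= I n by apply: Rintegral_ge0 => w _; have /andP[] := fb (X (t + n)%N w).
have I0 : I 0%N = \int[P]_(w in A `&` confined y t) f (X t w) by rewrite /I /G addn0.
have : (B + k) * \sum_(i < n) vis i <= (B + k) * (V * fine (P A)).
  by rewrite ler_wpM2l ?addr_ge0// visits.
by have := tot n; rewrite I0; lra.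
Qed.

End survival.

Section upper_tail.
Context {d : measure_display} {T : measurableType d} {R : realType}.
Variables (P : probability T R) (S : set R) (F : nat -> set (set T)) (X : nat -> T -> R).
Variables (c s2 p : R).
Hypotheses (hA0 : A0 P S F X) (hA1 : A1 P S F X) (hA2 : A2 P c s2 F X) (hMp : Mp P p F X).
Hypothesis p2 : 2 < p.
Implicit Types (A B : set T) (t s : nat).
Local Notation r := (- 2 * c / s2).
Local Notation confined := (confined X).
Local Notation alive := (alive X).

Let s20 : 0 < s2. Proof. by case: hA2. Qed.

Lemma powln_drift_critical (n x : R) : powln_drift (1 + r) n c s2 x =
  x `^ (1 + r - 2) * ln x `^ (n - 1) * (n * (s2 / 2 * (1 + r))).
Proof.
rewrite /powln_drift; congr (_ * _).
by field; rewrite gt_eqF.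
Qed.

Lemma powln_drift_power (g x : R) : 0 < ln x ->
  powln_drift g 0 c s2 x = - (g * (s2 / 2) * (1 + r - g)) * x `^ (g - 2).
Proof.
move=> l0; rewrite /powln_drift sub0r powR_inv1 ?(ltW l0)//.
by field; rewrite !gt_eqF.
Qed.

Lemma far_of_pointwise (f : R -> R) (fM x0 y k : R) : measurable_fun setT f ->
  (forall u, 0 <= f u <= fM) ->
  (forall t A x, (0 < t)%N -> F t A -> A `<=` [set w | X t w = x] -> x0 <= x < y ->
    \int[P]_(w in A) f (X t.+1 w) <= (f x - k) * fine (P A)) ->
  forall t A, (0 < t)%N -> F t A -> A `<=` [set w | x0 <= X t w < y] ->
    \int[P]_(w in A) f (X t.+1 w) <= \int[P]_(w in A) f (X t w) - k * fine (P A).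
Proof.
move=> mf fb H t A t0 FA Axy.
have intf s B : (0 < s)%N -> measurable B -> P.-integrable B (EFin \o (fun w => f (X s w))).
  move=> s0 mB; apply: (@bound_integrable _ _ _ P _ _ fM) => //.
    by apply: (measurableT_comp mf); exact: process_measurable hA0 _ s0.
  by move=> w _; have /andP[? ?] := fb (X s w); rewrite ger0_norm.
have ic B : measurable B -> P.-integrable B (EFin \o (fun=> k)).
  by move=> mB; exact: finite_measure_integrable_cst.
have mA := filt_measurable hA0 t0 FA.
rewrite lerBrDr -(Rintegral_cstM P k mA) -(RintegralD mA (intf _ _ (ltn0Sn t) mA) (ic _ mA)).
apply: (@le_Rintegral_values _ _ _ P S F X hA0 t _ _ [set x | x0 <= x < y] y) => //.
- exact: (integrableD measurableT (intf _ _ (ltn0Sn t) measurableT) (ic _ measurableT)).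
- exact: intf.
- move=> x B Sx xy FB Bx; have mB := filt_measurable hA0 t0 FB.
  rewrite (RintegralD mB (intf _ _ (ltn0Sn t) mB) (ic _ mB)) Rintegral_cstM//.
  rewrite (_ : \int[P]_(w in B) f (X t w) = \int[P]_(w in B) f x); last first.
    by apply: eq_Rintegral => w; rewrite inE => /Bx /= ->.
  by rewrite Rintegral_cstM// -lerBrDr -mulrBl; exact: H.
- by move=> w /Axy /= xy; split => //; case/andP: xy => _ /ltW.
Qed.

Lemma occupation_bound : -1 < r -> exists2 K : R, 0 < K & exists y0 : R,
  forall y, y0 <= y -> forall t A n, (0 < t)%N -> F t A ->
  \sum_(i < n) fine (P (A `&` confined y (t + i))) <= K * y ^+ 2 * fine (P A).
Proof.
move=> r1.
pose g : R := Num.min (1 + r) 2 / 2.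
have gm0 : 0 < Num.min (1 + r) 2 by rewrite lt_min; apply/andP; split; lra.
have g0 : 0 < g by rewrite divr_gt0.
have gr : g < 1 + r.
  have : Num.min (1 + r) 2 <= 1 + r by rewrite ge_min lexx.
  rewrite /g; lra.
have g2 : g < 2.
  have : Num.min (1 + r) 2 <= 2 by rewrite ge_min lexx orbT.
  rewrite /g; lra.
have gp : g < p by exact: lt_trans g2 p2.
have [a [ea incF Hd]] := drift_estimate hA0 hA2 hMp p2 0 g0 gp.
pose kap : R := g * (s2 / 2) * (1 + r - g).
have kap0 : 0 < kap by rewrite !mulr_gt0 ?divr_gt0 ?subr_gt0.
have kap20 : 0 < kap / 2 by rewrite divr_gt0.
have [x0 ax0 Hx0] := Hd _ kap20.
have [V V0 HV] := visits_bound hA0 hA1 x0.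
pose K : R := 2 `^ g * 2 / kap * (1 + V) + V.
have K0 : 0 < K by rewrite ltr_pwDl// !mulr_gt0 ?invr_gt0 ?powR_gt0// ltr_pwDl.
exists K => //; exists (Num.max x0 1) => y; rewrite ge_max => /andP[x0y y1] t A n t0 FA.
have a0 : 0 < a := lt_le_trans (expR_gt0 1) ea.
have y0 : 0 < y by rewrite (lt_le_trans _ y1).
have ay : a <= 2 * y by have := double_le (ltW a0) ax0; lra.
pose f := clamp (powln g 0) a (2 * y).
pose fM := powln g 0 (2 * y).
have fME : fM = 2 `^ g * y `^ g by rewrite /fM /powln powRr0 mulr1 powRM// ltW.
have fM0 : 0 <= fM by rewrite fME mulr_ge0 ?powR_ge0.
have fb u : 0 <= f u <= fM.
  by rewrite (ltW (clamp_powln_gt0 _ _ ea _ ay)) /=; exact: clamp_powln_le.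
have mf : measurable_fun setT f by exact: clamp_powln_measurable.
pose k := kap / 2 * y `^ (g - 2).
have k0 : 0 < k by rewrite mulr_gt0// powR_gt0.
have far := @far_of_pointwise f fM x0 y k mf fb.
have := @confined_telescope _ _ _ P S F X hA0 V x0 y fM fM k 0 f HV mf fb.
move=> /(_ _ (ltW k0) fM0 _ _ t A n t0 FA).
rewrite mul0r addr0 => H.
have {}H : k * (\sum_(i < n) fine (P (A `&` confined y (t + i)))) <=
    \int[P]_(w in A `&` confined y t) f (X t w) + (fM + k) * (V * fine (P A)).
  apply: H.
  - by move=> u _; case/andP: (fb u).
  - apply: far => s B x s0 FB Bx /andP[x0x xy].
    have xb : 2 * x <= 2 * y by rewrite ler_pM2l// ltW.
    have := Hx0 s B x (2 * y) s0 FB Bx x0x xb.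
    have ax := le_trans ax0 x0x.
    have ax' := double_le (ltW a0) ax.
    have x0' : 0 < x := lt_le_trans a0 ax'.
    have l1 : 1 <= ln x by apply: ln_ge1; exact: le_trans ea ax'.
    have l0 : 0 < ln x by rewrite (lt_le_trans _ l1).
    have fx : f x = powln g 0 x.
      by rewrite /f clamp_id// ax' (double_le (ltW x0') (le_trans xb _))// ler_peMl ?mulr_ge0// ltW.
    rewrite powln_drift_power// -/kap -fx => /(le_trans (ler_norm _)).
    have : kap / 2 * (x `^ (g - 2) * ln x `^ (0 - 1)) <= kap / 2 * x `^ (g - 2).
      rewrite ler_pM2l// ler_piMr ?powR_ge0// sub0r powR_inv1 ?(ltW l0)//.
      by rewrite invf_le1.
    have : k <= kap / 2 * x `^ (g - 2).
      rewrite /k ler_pM2l//.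
      have := @ge0_ler_powR _ (2 - g) _ x y.
      rewrite !nnegrE subr_ge0 (ltW g2) (ltW x0') (ltW y0) (ltW xy) => /(_ isT isT isT isT).
      by rewrite -[g - 2]opprB !powRN lef_pV2 ?posrE ?powR_gt0.
    have := fine_prob_ge0 P B; move: (fine (P B)) (x `^ (g - 2)) => q z q0 h1 h2.
    rewrite lerBlDr -mulrDl => h3; apply: (le_trans h3); rewrite ler_wpM2r//.
    lra.
  - move=> s B s0 FB _; have mB := filt_measurable hA0 s0 FB.
    rewrite -(Rintegral_cstM P _ mB); apply: le_Rintegral => //.
    + by apply: (clamp_powln_integrable hA0 ea incF).
    + exact: finite_measure_integrable_cst.
    + by move=> w _; case/andP: (fb (X s.+1 w)).
have IfM : \int[P]_(w in A `&` confined y t) f (X t w) <= fM * fine (P A).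
  have FAc : F t (A `&` confined y t).
    exact: (sub_sigmaI (filt_sigma hA0 t0) FA (filt_confined hA0 y t0)).
  have mAc := filt_measurable hA0 t0 FAc.
  have ib := clamp_powln_integrable hA0 ea incF ay t0 mAc.
  have /andP[_] := Rintegral_bounds mAc ib (fun w _ => fb (X t w)).
  move=> /le_trans; apply; rewrite ler_wpM2l//; apply: le_prob => //.
  exact: (filt_measurable hA0 t0 FA).
rewrite -(ler_pM2l k0); apply: (le_trans H).
have ky : k * (K * y ^+ 2 * fine (P A)) =
    (fM * (1 + V) + k * y ^+ 2 * V) * fine (P A).
  rewrite fME /k /K (_ : y `^ g = y `^ (g - 2) * y ^+ 2); last first.
    by rewrite -powR_mulrn ?(ltW y0)// -gt0_powRD//; congr (powR y _); ring.
  by field; rewrite gt_eqF.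
rewrite ky; apply: le_trans (lerD IfM (lexx _)) _.
rewrite mulrA -mulrDl ler_wpM2r ?fine_prob_ge0//.
rewrite mulrDl mulrDr mulr1 addrA lerD2l ler_wpM2r// ler_peMr ?(ltW k0)//.
by rewrite exprn_ege1.
Qed.

Lemma overshoot_bound (g n a x0 : R) : 0 < g -> g < p -> expR 1 <= a ->
  (forall u v, a <= u -> u < v -> powln g n u < powln g n v) -> 0 <= x0 ->
  exists2 B : R, 0 <= B & forall b t A, a <= b -> (0 < t)%N -> F t A ->
  A `<=` [set w | X t w <= x0] ->
  \int[P]_(w in A) clamp (powln g n) a b (X t.+1 w) <= B * fine (P A).
Proof.
move=> g0 gp ea incF x00.
have pg0 : 0 < p - g by rewrite subr_gt0.
have [C C0 HC] := powln_le n pg0.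
have [de [Cp [de0 Cp0 Hp]]] := moment_p hA0 hMp.
pose Bp := Cp * (1 + x0) `^ `|p - 2 - de|.
have Bp0 : 0 <= Bp by rewrite mulr_ge0 ?powR_ge0// ltW.
pose D := C * (2 `^ p * (x0 + a) `^ p).
pose E := C * 2 `^ p.
have D0 : 0 <= D by rewrite !mulr_ge0 ?powR_ge0// ltW.
have E0 : 0 <= E by rewrite !mulr_ge0 ?powR_ge0// ltW.
have a0 : 0 < a := lt_le_trans (expR_gt0 1) ea.
have p0 : 0 <= p by lra.
exists (D + E * Bp); first by rewrite addr_ge0// mulr_ge0.
move=> b t A ab t0 FA Ax; have mA := filt_measurable hA0 t0 FA.
have [|ip mp] := Hp t A Bp t0 FA Bp0 _.
- move=> w Aw; rewrite ler_pM2l//; have Xw := Ax _ Aw; have X0 := process_ge0 hA0 w t0.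
  apply: (@le_trans _ _ ((1 + X t w) `^ `|p - 2 - de|)).
    by rewrite ler_powR ?ler_norm// lerDl.
  by apply: ge0_ler_powR; rewrite ?nnegrE ?addr_ge0// lerD2l.
have ic : P.-integrable A (EFin \o (fun=> D)) by exact: finite_measure_integrable_cst.
have iE : P.-integrable A (EFin \o (fun w => E * `|incr X t w| `^ p)).
  exact: (integrableZl mA E ip).
apply: (@le_trans _ _ (\int[P]_(w in A) (D + E * `|incr X t w| `^ p))).
  apply: le_Rintegral => //.
  - exact: (clamp_powln_integrable hA0 ea incF).
  - exact: (integrableD mA ic iE).
  move=> w Aw; have Xw := Ax _ Aw.
  set z := `|incr X t w|; have z0 : 0 <= z by exact: normr_ge0.
  have Xz : X t.+1 w <= x0 + z.
    by have := ler_norm (incr X t w); rewrite -/z /incr; move: Xw => /=; lra.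
  pose v := x0 + a + z.
  have av : a <= v by rewrite /v; lra.
  apply: (@le_trans _ _ (powln g n v)).
    apply: (powln_homo incF); first by rewrite le_min ab andbT le_max lexx orbT.
    by rewrite ge_min ge_max; apply/orP; left; apply/andP; split; rewrite /v; lra.
  apply: (le_trans (HC _ _ (le_trans ea av))).
  rewrite (_ : g + (p - g) = p); last by ring.
  rewrite /D /E -!mulrA -mulrDr ler_pM2l// -mulrDr.
  have [xz|zx] := leP z (x0 + a).
    apply: (@le_trans _ _ ((2 * (x0 + a)) `^ p)).
      by apply: ge0_ler_powR; rewrite ?nnegrE /v; lra.
    by rewrite powRM; [rewrite ler_pM2l ?powR_gt0// lerDl powR_ge0|by []|lra].
  apply: (@le_trans _ _ ((2 * z) `^ p)).
    by apply: ge0_ler_powR; rewrite ?nnegrE /v; lra.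
  by rewrite powRM// ler_pM2l ?powR_gt0// lerDr powR_ge0.
rewrite (RintegralD mA ic iE) Rintegral_cstM// (RintegralZl _ mA ip) mulrDl -mulrA.
by rewrite lerD2l ler_wpM2l.
Qed.

Lemma exceedance_bound (n : R) : -1 < r -> 1 + r < p -> n < 0 ->
  exists2 K : R, 0 < K & exists y0 : R, forall y, y0 <= y -> forall N,
  powln (1 + r) n y * (\sum_(i < N) fine (P ([set w | X 1 w = 0] `&` confined y (1 + i) `&`
     [set w | y <= X (1 + i).+1 w]))) <= K.
Proof.
move=> r1 rp n0.
have g0 : 0 < 1 + r by lra.
have [a [ea incF Hd]] := drift_estimate hA0 hA2 hMp p2 n g0 rp.
pose ep : R := - n * (s2 / 2 * (1 + r)).
have ep0 : 0 < ep by rewrite !mulr_gt0 ?divr_gt0// oppr_gt0.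
have [x0 ax0 Hx0] := Hd _ ep0.
have a0 : 0 < a := lt_le_trans (expR_gt0 1) ea.
have ax0' := double_le (ltW a0) ax0.
have x00 : 0 <= x0 by rewrite (le_trans _ ax0')// ltW.
have [V V0 HV] := visits_bound hA0 hA1 x0.
have [B B0 HB] := overshoot_bound g0 rp ea incF x00.
exists (powln (1 + r) n a + B * V).
  rewrite ltr_pwDl ?mulr_ge0// powln_gt0//; exact: lt_le_trans expR1_gt1 ea.
exists x0 => y x0y N.
have y0 : 0 < y by rewrite (lt_le_trans _ x0y)// (lt_le_trans a0).
have ay' : a <= y by exact: le_trans ax0' x0y.
have y2y : y <= 2 * y by rewrite ler_peMl ?(ltW y0)//; lra.
have ay : a <= 2 * y by exact: le_trans ay' y2y.
pose f := clamp (powln (1 + r) n) a (2 * y).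
pose fM := powln (1 + r) n (2 * y).
have fb u : 0 <= f u <= fM.
  by rewrite (ltW (clamp_powln_gt0 _ _ ea _ ay)) /=; exact: clamp_powln_le.
have mf : measurable_fun setT f by exact: clamp_powln_measurable.
have FA : F 1%N [set w | X 1 w = 0] by exact: (filt_eq hA0).
have mA := filt_measurable hA0 (ltn0Sn 0) FA.
have PA : fine (P [set w | X 1 w = 0]) <= 1.
  by have := probability_le1 P mA; rewrite -lee_fin fineK// fin_num_prob.
have := @confined_telescope _ _ _ P S F X hA0 V x0 y fM B 0 (powln (1 + r) n y) f HV mf fb.
move=> /(_ _ (lexx 0) B0 _ _ 1%N _ N (ltn0Sn 0) FA).
rewrite mul0r add0r addr0 => H.
have FAc : F 1%N ([set w | X 1 w = 0] `&` confined y 1).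
  exact: (sub_sigmaI (filt_sigma hA0 (ltn0Sn 0)) FA (filt_confined hA0 y (ltn0Sn 0))).
have mAc := filt_measurable hA0 (ltn0Sn 0) FAc.
apply: (le_trans (H _ _ _)).
- move=> u yu; rewrite -(@clamp_id _ (powln (1 + r) n) a (2 * y) y) ?ay'//.
  exact: (clamp_powln_homo incF).
- apply: (@far_of_pointwise f fM) => // s D x s0 FD Dx /andP[x0x xy].
  have xb : 2 * x <= 2 * y by rewrite ler_pM2l// ltW.
  have := Hx0 s D x (2 * y) s0 FD Dx x0x xb.
  have ax' := le_trans ax0' x0x.
  have fx : f x = powln (1 + r) n x by rewrite /f clamp_id// ax' (le_trans (ltW xy)).
  rewrite powln_drift_critical -fx => /(le_trans (ler_norm _)).
  have : 0 <= x `^ (1 + r - 2) * ln x `^ (n - 1) by rewrite mulr_ge0 ?powR_ge0.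
  rewrite lerBlDr -mulrDl subr0 => _ h; apply: (le_trans h).
  by rewrite [X in X * _ <= _](_ : _ = f x)// /ep; ring.
- by move=> s D s0 FD Dx; apply: HB.
rewrite lerD//; last by rewrite -[leRHS]mulr1 -mulrA ler_wpM2l// ler_wpM2l.
have ib := clamp_powln_integrable hA0 ea incF ay (ltn0Sn 0) mAc.
have fa : powln (1 + r) n a = f 0.
  by rewrite /f /clamp (max_idPr (ltW a0)) (min_idPl ay).
have H1 w : ([set w | X 1 w = 0] `&` confined y 1) w -> 0 <= f (X 1 w) <= powln (1 + r) n a.
  by move=> [/= -> _]; rewrite fa lexx andbT; case/andP: (fb 0).
have /andP[_ /le_trans->//] := Rintegral_bounds mAc ib H1.
rewrite ler_piMr// ?(le_trans _ PA)//.
  by rewrite fa; case/andP: (fb 0).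
by apply: le_prob => // w [].
Qed.

End upper_tail.

Lemma near_powR_ln_ge (R : realType) (C e : R) : 0 < e ->
  \forall x \near +oo, C <= ln x `^ e.
Proof.
move=> e0; near=> x.
have l1 : 1 <= ln x by near: x; exact: near_ln_ge.
have lC : (`|C| + 1) `^ e^-1 <= ln x by near: x; exact: near_ln_ge.
have C1 : 0 < `|C| + 1 by rewrite ltr_wpDl.
apply: (@le_trans _ _ (`|C| + 1)); first by have := ler_norm C; lra.
have := @ge0_ler_powR _ e (ltW e0) ((`|C| + 1) `^ e^-1) (ln x).
rewrite !nnegrE powR_ge0 (le_trans _ l1)// => /(_ isT isT lC).
by rewrite -powRrM mulVf ?gt_eqF// powRr1// ltW.
Unshelve. all: by end_near. Qed.

Section upper_tail_estimate.
Context {d : measure_display} {T : measurableType d} {R : realType}.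
Variables (P : probability T R) (S : set R) (F : nat -> set (set T)) (X : nat -> T -> R).
Variables (c s2 p : R).
Hypotheses (hA0 : A0 P S F X) (hA1 : A1 P S F X) (hA2 : A2 P c s2 F X) (hMp : Mp P p F X).
Hypothesis p2 : 2 < p.
Implicit Types (A B : set T) (t s : nat).
Local Notation r := (- 2 * c / s2).
Local Notation confined := (confined X).
Local Notation alive := (alive X).

Let s20 : 0 < s2. Proof. by case: hA2. Qed.

Let mconf y t : (0 < t)%N -> measurable (confined y t).
Proof. by move=> t0; exact: (filt_measurable hA0 t0 (filt_confined hA0 y t0)). Qed.

Lemma confined_halving (K y : R) (n : nat) :
  (forall t A n, (0 < t)%N -> F t A ->
    \sum_(i < n) fine (P (A `&` confined y (t + i))) <= K * y ^+ 2 * fine (P A)) ->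
  (0 < n)%N -> 2 * (K * y ^+ 2) <= n%:R ->
  forall k, fine (P (confined y (1 + k * n))) <= (2^-1) ^+ k.
Proof.
move=> H n0 Kn; elim=> [|k IH].
  rewrite mul0n addn0 expr0 -lee_fin fineK; last by apply: fin_num_prob; exact: mconf.
  by apply: probability_le1; exact: mconf.
set t := (1 + k * n)%N in IH *.
have t0 : (0 < t)%N by [].
have -> : (1 + k.+1 * n)%N = (t + n)%N by rewrite /t mulSn addnCA addnC.
have := H t _ n t0 (filt_confined hA0 y t0).
have : n%:R * fine (P (confined y (t + n))) <=
    \sum_(i < n) fine (P (confined y t `&` confined y (t + i))).
  rewrite -[n in n%:R]card_ord mulr_natl -sumr_const; apply: ler_sum => i _.
  apply: le_prob.
  - by apply: mconf; rewrite addn_gt0 t0.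
  - by apply: measurableI; apply: mconf; rewrite ?addn_gt0 ?t0.
  - by move=> w cw; split; apply: confined_mono cw; rewrite ?leq_addr// leq_add2l ltnW.
move=> /le_trans h /h {h}.
have q0 := fine_prob_ge0 P (confined y t).
have q1 := fine_prob_ge0 P (confined y (t + n)).
have n0' : 0 < n%:R :> R by rewrite ltr0n.
rewrite [2^-1 ^+ k.+1]exprS; move: (fine (P (confined y t))) (fine (P (confined y (t + n)))) IH q0 q1.
move=> a b ah a0 b0 h.
have : n%:R * b <= n%:R / 2 * a.
  by apply: (le_trans h); rewrite ler_wpM2r//; lra.
rewrite -mulrA ler_pM2l// => /le_trans; apply.
by rewrite ler_pM2l// invr_gt0.
Qed.

Lemma prob_start A : measurable A ->
  fine (P A) = fine (P ([set w | X 1 w = 0] `&` A)).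
Proof.
move=> mA; have m1 : measurable [set w | X 1 w = 0].
  exact: (filt_measurable hA0 (ltn0Sn 0) (filt_eq hA0 0 (ltn0Sn 0) (leqnn _))).
have P1 : P [set w | X 1 w = 0] = 1%E by case: hA0 => _ [].
have PC := probability_setC P m1; rewrite P1 subee// in PC.
have e0 : fine (P (A `\` [set w | X 1 w = 0])) = 0.
  apply/eqP; rewrite eq_le fine_prob_ge0 andbT.
  have : fine (P (A `\` [set w | X 1 w = 0])) <= fine (P (~` [set w | X 1 w = 0])).
    by apply: le_prob; [exact: measurableD|exact: measurableC|move=> w []].
  by rewrite PC.
by rewrite (prob_setI_setD P mA m1) e0 addr0 setIC.
Qed.

Lemma alive_le_exceed (y : R) (N : nat) : 0 < y ->
  fine (P (alive (1 + N))) <= fine (P (confined y (1 + N))) +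
  \sum_(i < N) fine (P ([set w | X 1 w = 0] `&` confined y (1 + i) `&`
     [set w | y <= X (1 + i).+1 w])).
Proof.
move=> y0; set A := [set w | X 1 w = 0].
have mA : measurable A.
  exact: (filt_measurable hA0 (ltn0Sn 0) (filt_eq hA0 0 (ltn0Sn 0) (leqnn _))).
have mal t : (0 < t)%N -> measurable (alive t).
  by move=> t0; exact: (filt_measurable hA0 t0 (filt_alive hA0 t0)).
have mbe t : (0 < t)%N -> measurable (below X y t).
  by move=> t0; exact: (filt_measurable hA0 t0 (filt_below hA0 y t0)).
rewrite (prob_start (mal _ _))//.
have mAal t : (0 < t)%N -> measurable (A `&` alive t) by move=> t0; apply: measurableI => //; exact: mal.
rewrite (prob_setI_setD P (mAal (1 + N)%N isT) (mbe (1 + N)%N isT)); apply: lerD.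
  by apply: le_prob; [apply: measurableI; [exact: mAal|exact: mbe]|exact: mconf|move=> w [[]]].
elim: N => [|N IH].
  rewrite big_ord0 (_ : _ `\` _ = set0) ?measure0//.
  apply/seteqP; split => // w [[Aw _] nb]; apply: nb => s; rewrite addn0 => /andP[s1 s2'].
  by rewrite (_ : s = 1%N) ?Aw//; apply/eqP; rewrite eqn_leq s2'.
rewrite big_ord_recr /=; set E := _ `&` _ in IH *.
set H := _ `&` confined y (1 + N) `&` _.
have mH : measurable H.
  apply: measurableI; first by apply: measurableI => //; exact: mconf.
  exact: (filt_measurable hA0 (ltn0Sn _) (filt_ge hA0 y (ltn0Sn _) (leqnn _))).
have mD t : (0 < t)%N -> measurable ((A `&` alive t) `\` below X y t).
  by move=> t0; apply: measurableD; [exact: mAal|exact: mbe].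
apply: le_trans (lerD IH (lexx _)).
rewrite (prob_setI_setD P (mD (1 + N.+1)%N isT) mH) addrC; apply: lerD; last first.
  by apply: le_prob => //; apply: measurableI => //; exact: mD.
apply: le_prob.
- by apply: measurableD => //; exact: mD.
- exact: mD.
move=> w [[[Aw al] nb] nH]; have al' : alive (1 + N) w by apply: alive_mono al; rewrite addnS.
split=> // bl; apply: nb => s /andP[s1]; rewrite addnS leq_eqVlt => /predU1P[->|sN].
  by rewrite ltNge; apply/negP => yX; apply: nH.
by apply: bl; rewrite s1.
Qed.

Lemma upper_tail (ep : R) : -1 < r -> 1 + r < p -> 0 < ep ->
  \forall x \near +oo, forall N : nat, x <= N%:R ->
  fine (P (alive N)) <= x `^ (- ((1 + r) / 2)) * ln x `^ (2 + r + ep).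
Proof.
move=> r1 rp ep0.
have [K K0 [y0 HK]] := occupation_bound hA0 hA1 hA2 hMp p2 r1.
have [K' K'0 [y1 HK']] := exceedance_bound hA0 hA1 hA2 hMp p2 r1 rp (ltrN10 R).
pose al : R := (1 + r) / 2.
have al0 : 0 < al by rewrite divr_gt0//; lra.
pose ym := 1 + `|y0| + `|y1| + K^-1 + expR 1.
have ki0 : 0 < K^-1 by rewrite invr_gt0.
have e10 : 0 < expR 1 :> R by exact: expR_gt0.
have ym0 : 0 < ym.
  by have := normr_ge0 y0; have := normr_ge0 y1; rewrite /ym; lra.
have ln20 : 0 < ln 2 :> R by rewrite ln_gt0//; lra.
near=> x => N xN.
have x2 : 2 <= x by near: x; exact: nbhs_pinfty_ge.
have x0 : 0 < x by lra.
have ex : expR 1 <= x by near: x; exact: nbhs_pinfty_ge.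
have l1 : 1 <= ln x by exact: ln_ge1.
have l0 : 0 < ln x by lra.
have lbig : 6 * K * (al / ln 2 + 1) <= ln x by near: x; exact: near_ln_ge.
have lep : K' + 1 <= ln x `^ ep by near: x; exact: near_powR_ln_ge.
have yb0 : x `^ (- (1 / 2)) * ln x `^ 1 <= ym^-1.
  by near: x; apply: near_powR_powR_ln; rewrite ?invr_gt0//; lra.
pose y : R := x `^ (1 / 2) / ln x.
have yp0 : 0 < y by rewrite divr_gt0// powR_gt0.
have yym : ym <= y.
  rewrite -[leLHS]invrK -[leRHS]invrK lef_pV2 ?posrE ?invr_gt0//.
  apply: le_trans yb0; rewrite powRr1 ?(ltW l0)// powRN /y invfM invrK.
  by rewrite mulrC.
have y2E : y ^+ 2 = x / ln x ^+ 2.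
  rewrite /y expr_div_n; congr (_ / _).
  by rewrite -powR_mulrn ?powR_ge0// -powRrM div1r mulVf ?powRr1 ?(ltW x0)// pnatr_eq0.
have [n01 n11] : 0 <= `|y0| /\ 0 <= `|y1| by [].
have yy0 : y0 <= y.
  by apply: le_trans yym; rewrite /ym; have := ler_norm y0; lra.
have yy1 : y1 <= y.
  by apply: le_trans yym; rewrite /ym; have := ler_norm y1; lra.
have yge1 : 1 <= y by apply: le_trans yym; rewrite /ym; lra.
have ye : expR 1 <= y by apply: le_trans yym; rewrite /ym; lra.
have Ky1 : 1 <= K * y ^+ 2.
  have : K^-1 <= y by apply: le_trans yym; rewrite /ym; lra.
  move=> /(ler_wpM2l (ltW K0)); rewrite mulfV ?gt_eqF// => /le_trans; apply.
  by rewrite ler_pM2l// expr2 ler_peMl// ltW.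
pose n := (Num.truncn (2 * (K * y ^+ 2))).+1.
have Ky0 : 0 <= 2 * (K * y ^+ 2) by lra.
have /andP[tn1 tn2] := Num.Theory.truncn_itv Ky0.
have nge : 2 * (K * y ^+ 2) <= n%:R by exact: ltW.
have nle : n%:R <= 3 * (K * y ^+ 2) by rewrite /n -natr1; lra.
have N0 : (0 < N)%N by rewrite -(ltr0n R) (lt_le_trans x0).
pose M := N.-1.
have NE : N = (1 + M)%N by rewrite /M add1n prednK.
have Mx : x / 2 <= M%:R.
  by move: xN; rewrite NE natrD; lra.
pose k := (M %/ n)%N.
have kM : (k * n <= M)%N by exact: leq_trunc_div.
have Mk : (M < k.+1 * n)%N by rewrite -ltn_divLR.
have kbig : al / ln 2 * ln x <= k%:R.
  have : M%:R <= k.+1%:R * n%:R :> R by rewrite -natrM ler_nat ltnW.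
  have kn0 : 0 <= k.+1%:R :> R by [].
  have : k.+1%:R * n%:R <= k.+1%:R * (3 * (K * y ^+ 2)) :> R by rewrite ler_wpM2l.
  move=> h1 h2; have := le_trans Mx (le_trans h2 h1).
  rewrite y2E => h3.
  have : ln x ^+ 2 <= 6 * K * k.+1%:R.
    have l20 : 0 < ln x ^+ 2 by rewrite exprn_gt0.
    rewrite -(ler_pM2l x0) -(ler_pM2r (_ : 0 < (ln x ^+ 2)^-1)) ?invr_gt0//.
    rewrite mulfK ?gt_eqF//; move: h3.
    rewrite [k.+1%:R * _](_ : _ = (x * (6 * K * k.+1%:R) / ln x ^+ 2) / 2); last by field; rewrite gt_eqF.
    by rewrite ler_pM2r// invr_gt0.
  have : 6 * K * (al / ln 2 + 1) * ln x <= ln x ^+ 2 by rewrite expr2 ler_pM2r.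
  move=> h4 h5; have := le_trans h4 h5; rewrite -mulrA ler_pM2l ?mulr_gt0//.
  rewrite mulrDl mul1r -natr1; lra.
have conf : fine (P (confined y (1 + M))) <= x `^ (- al).
  apply: (@le_trans _ _ (fine (P (confined y (1 + k * n))))).
    by apply: le_prob; [exact: mconf|exact: mconf|apply: confined_mono; rewrite leq_add2l].
  apply: (le_trans (confined_halving (HK y yy0) (ltn0Sn _) nge k)).
  rewrite /powR gt_eqF// -[2^-1]lnK ?posrE ?invr_gt0// -expRM_natl ler_expR.
  rewrite lnV ?posrE// mulrN mulNr lerN2.
  move: kbig; rewrite mulrAC ler_pdivrMr//.
have exc : \sum_(i < M) fine (P ([set w | X 1 w = 0] `&` confined y (1 + i) `&`
     [set w | y <= X (1 + i).+1 w])) <= K' * (x `^ (- al) * ln x `^ (2 + r)).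
  have := HK' y yy1 M; set s := \sum_(i < M) _.
  have s0 : 0 <= s by apply: sumr_ge0 => i _; exact: fine_prob_ge0.
  set q := x `^ (- al) * ln x `^ (2 + r).
  have q0 : 0 < q by rewrite mulr_gt0 ?powR_gt0.
  have qp : q^-1 <= powln (1 + r) (-1) y.
    have ly1 : 1 <= ln y by exact: ln_ge1.
    have yx : y <= x.
      rewrite /y ler_pdivrMr// (@le_trans _ _ x)//; last by rewrite ler_peMr// ltW.
      by apply: ler1_powR; lra.
    have lyx : ln y <= ln x by rewrite ler_ln ?posrE.
    rewrite /powln; apply: (@le_trans _ _ (y `^ (1 + r) * (ln x)^-1)); last first.
      rewrite ler_pM2l ?powR_gt0// powR_inv1 ?(le_trans _ ly1)//.
      by rewrite lef_pV2 ?posrE// (lt_le_trans _ ly1).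
    rewrite /y -(powR_inv1 (ltW l0)) powRM ?powR_ge0// -!powRrM -mulrA -gt0_powRD//.
    rewrite /q invfM -!powRN le_eqVlt; apply/orP; left; apply/eqP.
    rewrite opprK; congr (_ * _); [congr (powR x _)|congr (powR (ln x) _)];
      by rewrite ?/al; ring.
  move=> h; rewrite -ler_pdivrMr//.
  by apply: le_trans h; rewrite mulrC ler_wpM2r.
rewrite NE; apply: (le_trans (alive_le_exceed M yp0)).
apply: (le_trans (lerD conf exc)).
have -> : - ((1 + r) / 2) = - al by [].
rewrite [ln x `^ (2 + r + ep)]gt0_powRD//.
have A0 : 0 < x `^ (- al) by exact: powR_gt0.
have L1 : 1 <= ln x `^ (2 + r) by rewrite -[leLHS](powRr0 (ln x)) ler_powR//; lra.
apply: (@le_trans _ _ (x `^ (- al) * (ln x `^ (2 + r) * (K' + 1)))); last first.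
  by rewrite ler_pM2l// ler_pM2l ?powR_gt0.
rewrite mulrCA -{1}[x `^ (- al)]mulr1 -mulrDr ler_pM2l// mulrDr mulr1 addrC [K' * _]mulrC.
by rewrite lerD2l.
Unshelve. all: by end_near. Qed.

End upper_tail_estimate.

(** * Excursions and the lower tail *)

Section excursions.
Context {d : measure_display} {T : measurableType d} {R : realType}.
Variables (P : probability T R) (S : set R) (F : nat -> set (set T)) (X : nat -> T -> R).
Hypotheses (hA0 : A0 P S F X) (hA1 : A1 P S F X) (hA3 : A3 P X).
Implicit Types (A B W : set T) (t s i j k n : nat).
Local Notation confined := (confined X).
Local Notation alive := (alive X).

Lemma next_zeroP w s : match next_zero X w s with
  | Some b => [/\ (s < b)%N, X b w = 0 & forall t, (s < t < b)%N -> X t w <> 0]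
  | None => forall t, (s < t)%N -> X t w <> 0 end.
Proof.
rewrite /next_zero; case: pselect => [h|nh].
  case: ex_minnP => b /andP[sb /asboolP Xb] bmin; split => // t /andP[st tb] Xt.
  have : (b <= t)%N by apply: bmin; rewrite st; apply/asboolP.
  by rewrite leqNgt tb.
by move=> t st Xt; apply: nh; exists t.
Qed.

Lemma next_zeroE w s b : (s < b)%N -> X b w = 0 ->
  (forall t, (s < t < b)%N -> X t w <> 0) -> next_zero X w s = Some b.
Proof.
move=> sb Xb H; have := next_zeroP w s; case: next_zero => [b' [sb' Xb' H']|]; last first.
  by move=> /(_ b sb).
congr Some; apply/eqP; rewrite eqn_leq; apply/andP; split; rewrite leqNgt; apply/negP => h.
  by apply: (H' b) => //; rewrite sb.
by apply: (H b') => //; rewrite sb'.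
Qed.

Local Arguments tau : simpl never.

Lemma tau0 w : tau X 0 w = Some 1%N. Proof. by []. Qed.

Lemma tauS n w : tau X n.+1 w = obind (next_zero X w) (tau X n w). Proof. by []. Qed.

Lemma tau1 w : tau X 1 w = next_zero X w 1. Proof. by []. Qed.

Lemma ret_eta_fin n w :
  ret_eta X n.+1 w <> None <-> tau X n w <> None /\ tau X n.+1 w <> None.
Proof.
by rewrite /ret_eta -[n.+1.-1]/n; case: (tau X n w) => [a|]; case: (tau X n.+1 w) => [b|];
  split => // -[].
Qed.

Definition eta_tail (x : R) : set T := [set w | match ret_eta X 1 w with
  | Some k => x <= k%:R | None => True end].

Lemma eta_tailE (x : R) N : (0 < N)%N -> (forall k, (x <= k%:R) = (N <= k)%N) ->
  eta_tail x = alive N.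
Proof.
move=> N0 xN; apply/seteqP; split => w; rewrite /eta_tail /mkset /ret_eta -[1.-1]/0%N tau0 tau1;
  have := next_zeroP w 1; case: next_zero => [b [b1 Xb Hb]|Hb].
- rewrite xN => h s /andP[s1 s2]; apply: Hb; rewrite s1 /=.
  by rewrite (leq_ltn_trans s2)// (leq_ltn_trans h)// subn1 prednK// ltnW.
- by move=> _ s /andP[s1 _]; exact: Hb.
- move=> al; rewrite xN leqNgt; apply/negP => h; apply: (al b) => //.
  by rewrite b1 /=; move: h; rewrite subn1 -ltnS prednK// ltnW.
- by [].
Qed.

Lemma tau1_alive w : tau X 1 w = None -> forall N, alive N w.
Proof.
by rewrite tau1; have := next_zeroP w 1; case: next_zero => // H _ N s /andP[s1 _]; exact: H.
Qed.

Lemma tau_ge n w a : tau X n w = Some a -> (n < a)%N.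
Proof.
elim: n a => [a [<-]//|n IH a]; rewrite tauS; case E : (tau X n w) => [b|]//= nz.
have := next_zeroP w b; rewrite nz => -[ba _ _].
exact: leq_ltn_trans (IH _ E) ba.
Qed.

Lemma measurable_tau n k : measurable [set w | tau X n w = Some k].
Proof.
elim: n k => [|n IH] k.
  have [->|nk] := eqVneq k 1%N.
    by rewrite (_ : mkset _ = setT)//; apply/seteqP; split.
  rewrite (_ : mkset _ = set0)//; apply/seteqP; split => // w /=; rewrite tau0 => -[k1].
  by rewrite k1 eqxx in nk.
have [->|k0] := posnP k.
  rewrite (_ : mkset _ = set0)//; apply/seteqP; split => // w /= /(@tau_ge n.+1 w).
  by rewrite ltn0.
rewrite (_ : mkset _ = \bigcup_j (if (j < k)%N then [set w | tau X n w = Some j] `&`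
  ([set w | X k w = 0] `&` [set w | forall s, (j.+1 <= s <= k)%N -> s = k \/ X s w <> 0])
  else set0)).
  apply: bigcupT_measurable => j; case: ifPn => // jk.
  apply: measurableI => //; apply: measurableI.
    exact: (filt_measurable hA0 k0 (filt_eq hA0 0 k0 (leqnn _))).
  have [j1|kj] := ltnP j.+1 k; last first.
    rewrite (_ : mkset _ = setT)//; apply/seteqP; split => // w _ s /andP[s1 s2]; left.
    by apply/eqP; rewrite eqn_leq s2 (leq_trans kj).
  have k1 : (0 < k.-1)%N by rewrite -ltnS prednK// (leq_ltn_trans _ j1).
  rewrite (_ : mkset _ = [set w | forall s, (j.+1 <= s <= k.-1)%N -> (~` [set 0]) (X s w)]).
    apply: (filt_measurable hA0 k1); apply: (filt_forall hA0) => //.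
    by apply: measurableC; exact: measurable_set1.
  apply/seteqP; split => w /= H s /andP[s1 s2].
    have sjk : (j < s <= k)%N by rewrite s1 (leq_trans s2)// leq_pred.
    have [sk|//] := H s sjk.
    by move: s2; rewrite sk -ltnS prednK// ltnn.
  move: s2; rewrite leq_eqVlt => /predU1P[->|sk]; first by left.
  by right; apply: H; rewrite s1 /= -ltnS prednK.
apply/seteqP; split => w /=; rewrite tauS.
  case E : (tau X n w) => [j|]//= nz; exists j => //.
  have := next_zeroP w j; rewrite nz => -[jk Xk H]; rewrite jk; split => //; split => // s.
  move=> /andP[s1]; rewrite leq_eqVlt => /predU1P[->|sk]; first by left.
  by right; apply: H; rewrite s1.
move=> [j _]; case: ifPn => // jk [/= -> [Xk H]] /=.
apply: next_zeroE => // s /andP[s1 s2].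
have sjk : (j < s <= k)%N by rewrite s1 ltnW.
by have [sk|] := H s sjk; first by rewrite sk ltnn in s2.
Qed.

Lemma measurable_tau_fin n : measurable [set w | tau X n w <> None].
Proof.
rewrite (_ : mkset _ = \bigcup_k [set w | tau X n w = Some k]).
  by apply: bigcupT_measurable => k; exact: measurable_tau.
apply/seteqP; split => w /=; last by move=> [k _ /= ->].
by case E : (tau X n w) => [k|]// _; exists k.
Qed.

Lemma measurable_Ninf : measurable (Ninf X).
Proof.
rewrite (_ : Ninf X = \bigcap_n [set w | tau X n w <> None]).
  by apply: bigcapT_measurable => n; exact: measurable_tau_fin.
by apply/seteqP; split => w /= H n; [move=> _; exact: H|exact: H].
Qed.

Lemma prob1_bigcap (A : nat -> set T) : (forall n, measurable (A n)) ->
  (forall n, P (A n) = 1%E) -> P (\bigcap_n A n) = 1%E.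
Proof.
move=> mA PA.
have mC : measurable (\bigcap_n A n) by exact: bigcapT_measurable.
have : P (~` \bigcap_n A n) = 0%E.
  rewrite setC_bigcap; apply/negligibleP.
    by apply: bigcupT_measurable => n; exact: measurableC.
  apply: negligible_bigcup => n; apply/negligibleP; first exact: measurableC.
  by apply: etrans (probability_setC P (mA n)) _; rewrite PA subee.
rewrite probability_setC// => h.
move: h; rewrite -(fineK (fin_num_prob P mC)) -EFinB => -[/eqP].
by rewrite subr_eq0 => /eqP <-.
Qed.

Lemma tau_fin_prob : P [set w | tau X 1 w <> None] = 1%E ->
  forall n, P [set w | tau X n w <> None] = 1%E.
Proof.
move=> P1; case=> [|n]; first by rewrite (_ : mkset _ = setT) ?probability_setT//; apply/seteqP; split.
elim: n => // n IH; apply/eqP; rewrite eq_le; apply/andP; split.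
  by apply: probability_le1; exact: measurable_tau_fin.
have [_ /(_ n.+1 (ltn0Sn _))] := hA3; rewrite IH mul1e.
have -> : [set w | ret_eta X 1 w <> None] = [set w | tau X 1 w <> None].
  by apply/seteqP; split => w /= h; [have [] := (ret_eta_fin 0 w).1 h|apply/ret_eta_fin].
have -> : [set w | tau X n.+1 w <> None] `&` [set w | ret_eta X n.+2 w <> None] =
    [set w | tau X n.+1 w <> None] `&` [set w | tau X n.+2 w <> None].
  apply/seteqP; split => w [/= h1 h2]; split => //=; first by have [] := (ret_eta_fin n.+1 w).1 h2.
  exact/ret_eta_fin.
rewrite P1 => <-; apply: le_measure; rewrite ?inE.
- by apply: measurableI; exact: measurable_tau_fin.
- exact: measurable_tau_fin.
- by move=> w [].
Qed.

Lemma measurable_avoid (x1 : R) n :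
  measurable (Ninf X `&` [set w | x1 \notin excursion X n.+1 w]).
Proof.
rewrite (_ : _ `&` _ = Ninf X `&` \bigcup_a \bigcup_b
  ([set w | tau X n w = Some a.+1] `&` ([set w | tau X n.+1 w = Some b] `&`
   [set w | forall s, (a.+1 <= s <= b)%N -> s = b \/ X s w <> x1]))).
  apply: measurableI; first exact: measurable_Ninf.
  apply: bigcupT_measurable => a; apply: bigcupT_measurable => b.
  apply: measurableI; first exact: measurable_tau.
  have [ab|ba] := ltnP a.+1 b; last first.
    have -> : [set w | forall s, (a.+1 <= s <= b)%N -> s = b \/ X s w <> x1] = setT.
      apply/seteqP; split => // w _ s /andP[s1 s2]; left.
      by apply/eqP; rewrite eqn_leq s2 (leq_trans ba).
    by rewrite setIT; exact: measurable_tau.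
  apply: measurableI; first exact: measurable_tau.
  have b1 : (0 < b.-1)%N by rewrite -ltnS prednK ?(leq_ltn_trans _ ab).
  have b0 : (0 < b)%N by exact: leq_ltn_trans ab.
  rewrite (_ : mkset _ = [set w | forall s, (a.+1 <= s <= b.-1)%N -> (~` [set x1]) (X s w)]).
    apply: (filt_measurable hA0 b1); apply: (filt_forall hA0) => //.
    by apply: measurableC; exact: measurable_set1.
  apply/seteqP; split => w /= H s /andP[s1 s2].
    have sab : (a < s <= b)%N by rewrite s1 (leq_trans s2)// leq_pred.
    have [sk|//] := H s sab.
    by move: s2; rewrite sk -ltnS prednK// ltnn.
  move: s2; rewrite leq_eqVlt => /predU1P[->|sk]; first by left.
  by right; apply: H; rewrite s1 /= -ltnS prednK.
apply/seteqP; split => w [Nw /=].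
  move=> nx; split => //.
  case Ea : (tau X n w) => [[|a]|]; [by have := tau_ge Ea; rewrite ltn0| |by have := Nw n].
  case Eb : (tau X n.+1 w) => [b|]; last by have := Nw n.+1.
  exists a => //; exists b => //; split => //; split => // s /andP[s1].
  rewrite leq_eqVlt => /predU1P[->|sb]; first by left.
  right=> Xs; move/negP: nx; apply.
  rewrite /excursion -[n.+1.-1]/n Ea Eb; apply/mapP; exists s => //.
  by rewrite mem_iota s1 /= subnKC// (leq_trans s1)// ltnW.
move=> [a _ [b _ [Ea [Eb H]]]]; split => //=.
rewrite /excursion -[n.+1.-1]/n Ea Eb; apply/negP => /mapP[s].
have [ab|ba] := leqP a.+1 b; last by rewrite (eqP (_ : b - a.+1 == 0)%N) ?subn_eq0 ?(ltnW ba)// in_nil.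
rewrite mem_iota subnKC// => /andP[s1 s2] x1E.
have sab : (a < s <= b)%N by rewrite s1 ltnW.
by have [sb|] := H s sab; [rewrite sb ltnn in s2|apply].
Qed.

Lemma excursion_mem w x1 u n : Ninf X w -> (0 < u)%N -> (u <= n.+1)%N -> X u w = x1 ->
  exists2 i, (i <= n)%N & x1 \in excursion X i.+1 w.
Proof.
move=> Nw u0 un Xu.
have [a aE] : exists a : nat -> nat, forall i, tau X i w = Some (a i).
  exists (fun i => odflt 0%N (tau X i w)) => i; case E : (tau X i w) => [b|]//.
  by have := Nw i.
have ai i : (i < a i)%N by apply: (@tau_ge i w); rewrite aE.
have exi : exists i, (u < a i)%N by exists n.+1; exact: leq_ltn_trans (ai _).
case: (ex_minnP exi) => -[|i] ui imin.
  by have := aE 0%N => -[a0]; rewrite -a0 ltnS leqNgt u0 in ui.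
have au : (a i <= u)%N by rewrite leqNgt; apply/negP => /imin; rewrite ltnn.
exists i.
  by rewrite -ltnS (leq_trans _ un)// (leq_trans (ai i)).
rewrite /excursion -[i.+1.-1]/i (aE i) (aE i.+1); apply/mapP; exists u => //.
by rewrite mem_iota au /= subnKC// (leq_trans au)// ltnW.
Qed.

Lemma reach_before_return (x0 : R) : P [set w | tau X 1 w <> None] = 1%E ->
  exists x1 y1 t1, [/\ S x1, x0 < x1, (0 < t1)%N &
    0 < fine (P (confined y1 t1 `&` [set w | X t1 w = x1]))].
Proof.
move=> P1.
have [x1 [Sx1 x01]] : exists x1, S x1 /\ x0 < x1 by case: hA0 => -[_ _ h _] _; exact: h.
have S0 : S 0 by case: hA0 => -[].
apply: contrapT => H.
have Z (y1 : R) t : (0 < t)%N -> P (confined y1 t `&` [set w | X t w = x1]) = 0%E.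
  move=> t0.
  have mC : measurable (confined y1 t `&` [set w | X t w = x1]).
    apply: measurableI; first exact: (filt_measurable hA0 t0 (filt_confined hA0 y1 t0)).
    exact: (filt_measurable hA0 t0 (filt_eq hA0 x1 t0 (leqnn _))).
  apply/eqP; rewrite -(fineK (fin_num_prob P mC)) eqe eq_le fine_prob_ge0 andbT.
  rewrite leNgt; apply/negP => h; apply: H; exists x1, y1, t; split => //.
have PN : P (Ninf X) = 1%E.
  rewrite (_ : Ninf X = \bigcap_n [set w | tau X n w <> None]).
    by apply: prob1_bigcap; [exact: measurable_tau_fin|exact: tau_fin_prob].
  by apply/seteqP; split => w /= h n; [move=> _; exact: h|exact: h].
pose E n := Ninf X `&` [set w | x1 \notin excursion X n.+1 w].
have E0 : P (E 0%N) = 1%E.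
  have mE : measurable (E 0%N) := measurable_avoid x1 0.
  have neg : P (Ninf X `\` E 0%N) = 0%E.
    apply/negligibleP; first by apply: measurableD => //; exact: measurable_Ninf.
    apply: (@negligibleS _ _ _ P (\bigcup_t \bigcup_k
      (confined k%:R t.+1 `&` [set w | X t.+1 w = x1]))); last first.
      apply: negligible_bigcup => t; apply: negligible_bigcup => k.
      apply/negligibleP; last exact: Z.
      apply: measurableI; first exact: (filt_measurable hA0 (ltn0Sn t) (filt_confined hA0 _ (ltn0Sn t))).
      exact: (filt_measurable hA0 (ltn0Sn t) (filt_eq hA0 x1 (ltn0Sn t) (leqnn _))).
    move=> w [Nw nE].
    have : x1 \in excursion X 1 w by apply: contrapT => /negP h; apply: nE.
    rewrite /excursion -[1.-1]/0%N tau0 tau1; have := next_zeroP w 1; case: next_zero => [b [b1 Xb Hb]|//].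
    move=> /mapP[t]; rewrite mem_iota subnKC ?(ltnW b1)// => /andP[t1 t2] x1E.
    case: t t1 t2 x1E => // t _ t2 x1E; exists t => //.
    have [k Hk] : exists k : nat, forall s, (1 <= s <= t.+1)%N -> X s w < k%:R.
      elim: t.+1 => [|m [k Hk]]; first by exists 0%N; case.
      exists (maxn k (Num.truncn (X m.+1 w)).+1) => s /andP[s1].
      rewrite leq_eqVlt => /predU1P[->|sm].
        have /andP[_ h] := Num.Theory.truncn_itv (process_ge0 hA0 w (ltn0Sn m)).
        by apply: (lt_le_trans h); rewrite ler_nat leq_maxr.
      by apply: (lt_le_trans (Hk s _)); [rewrite s1|rewrite ler_nat leq_maxl].
    exists k => //; split => //; split => // s /andP[s1 s2]; apply: Hb.
    by rewrite s1 (leq_ltn_trans s2).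
  have := prob_setI_setD P measurable_Ninf mE; rewrite neg addr0 PN.
  have -> : Ninf X `&` E 0%N = E 0%N by rewrite /E setIA setIid.
  move=> h; rewrite -(fineK (fin_num_prob P mE)) -h.
  by rewrite -[1%E]/(1%:E).
have [m [phi [Hpos Hr]]] := A1_reach hA0 hA1.
pose u := (1 + m 0%R x1)%N.
have u0 : (0 < u)%N by [].
have Pu : 0 < fine (P ([set w | X 1 w = 0] `&` [set w | X u w = x1])).
  have F1 : F 1%N [set w | X 1 w = 0] by exact: (filt_eq hA0).
  apply: lt_le_trans (Hr 1%N _ 0 x1 isT S0 Sx1 F1 _) => //.
  have -> : P [set w | X 1 w = 0] = 1%E by case: hA0 => _ [].
  by rewrite mulr1; have [] := Hpos _ _ S0 Sx1.
have [hA3a _] := hA3; rewrite PN in hA3a.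
have := hA3a ltr01 u (fun=> [set s : seq R | x1 \notin s]); rewrite divr1 => hprod.
set G := Ninf X `&` _ in hprod.
have PG : fine (P G) = 1.
  rewrite hprod big1// => i _; rewrite divr1.
  by rewrite [P _](_ : _ = P (E 0%N)) ?E0.
have GE : G = \bigcap_i (if (i <= u)%N then E i else Ninf X).
  apply/seteqP; split => w.
    by move=> [Nw h] i _; case: ifPn => // iu; split => //; exact: h.
  move=> h; split; first by have := h u.+1 I; rewrite ltnn.
  by move=> i iu; have := h i I; rewrite iu => -[].
have mG : measurable G.
  rewrite GE; apply: bigcapT_measurable => i; case: ifPn => _; last exact: measurable_Ninf.
  exact: measurable_avoid.
set D := _ `&` _ in Pu.
have mD : measurable D.
  apply: measurableI.
    exact: (filt_measurable hA0 (ltn0Sn 0) (filt_eq hA0 0 (ltn0Sn 0) (leqnn _))).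
  exact: (filt_measurable hA0 u0 (filt_eq hA0 x1 u0 (leqnn _))).
have GD : G `&` D = set0.
  apply/seteqP; split => // w [[Nw Gw] [_ Xu]].
  have [i iu mem] := excursion_mem Nw u0 (leqnSn u) Xu.
  by have /negP := Gw i iu.
have := prob_setU P mG mD GD; rewrite PG => h.
have mU : measurable (G `|` D) by exact: measurableU.
have := probability_le1 P mU; rewrite -(fineK (fin_num_prob P mU)) h lee_fin; lra.
Qed.

End excursions.

Section lower_tail.
Context {d : measure_display} {T : measurableType d} {R : realType}.
Variables (P : probability T R) (S : set R) (F : nat -> set (set T)) (X : nat -> T -> R).
Variables (c s2 p : R).
Hypotheses (hA0 : A0 P S F X) (hA1 : A1 P S F X) (hA2 : A2 P c s2 F X) (hMp : Mp P p F X).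
Hypothesis p2 : 2 < p.
Implicit Types (A B W : set T) (t s : nat).
Local Notation r := (- 2 * c / s2).
Local Notation confined := (confined X).
Local Notation alive := (alive X).
Local Notation sig t0 := (filt_sigma hA0 t0).

Let s20 : 0 < s2. Proof. by case: hA2. Qed.

(* [gap y] has second derivative at most 2, so its second order Taylor
   inequality holds for jumps of every size. *)
Definition gap (y u : R) : R := Num.max (y - u) 0 ^+ 2.

Lemma gap_measurable y : measurable_fun setT (gap y).
Proof.
apply: measurable_funX; apply: measurable_maxr => //; exact: measurable_funB.
Qed.

Lemma gap_le y u : 0 <= u -> 0 <= y -> 0 <= gap y u <= y ^+ 2.
Proof.
move=> u0 y0; rewrite sqr_ge0 /= /gap ler_sqr ?nnegrE ?le_max ?lexx ?orbT//.
by rewrite ge_max y0 andbT; lra.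
Qed.

Lemma gap_near y x z : x <= y -> gap y (x + z) <= gap y x - 2 * (y - x) * z + z ^+ 2.
Proof.
move=> xy; rewrite {2}/gap (max_idPl _) ?subr_ge0//.
rewrite [leRHS](_ : _ = (y - (x + z)) ^+ 2); last by ring.
rewrite /gap; have [h|h] := leP 0 (y - (x + z)); first by [].
by rewrite expr0n sqr_ge0.
Qed.

Lemma gap_far y x z : y <= x -> gap y (x + z) <= z ^+ 2.
Proof.
move=> yx; rewrite /gap; have [h|h] := leP 0 (y - (x + z)); last by rewrite expr0n sqr_ge0.
have : 0 <= y - (x + z) <= - z by apply/andP; split; lra.
by move=> /andP[h1 h2]; rewrite -[leRHS]sqrrN ler_sqr ?nnegrE//; lra.
Qed.

Lemma gap_drift : exists2 C : R, 0 < C & exists y0 : R, forall y t A, y0 <= y ->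
  (0 < t)%N -> F t A -> A `<=` [set w | y / 2 <= X t w] ->
  \int[P]_(w in A) gap y (X t.+1 w) <= \int[P]_(w in A) gap y (X t w) + C * fine (P A).
Proof.
have s2p : 0 < s2 := s20.
have [xa Hfar] := moment_2_far hA0 hA2.
have [xb Hnear] := moment_12 hA0 hA2 (@ltr01 R).
pose C1 := 2 * (`|c| + 1) + (s2 + 1).
have C10 : 0 < C1 by have := normr_ge0 c; rewrite /C1; lra.
pose C := C1 + 2 * s2.
have C0 : 0 < C by rewrite /C; lra.
exists C => //; exists (2 * (`|xa| + `|xb| + expR 1)) => y t A yy t0 FA Ay.
have [na nb] := (normr_ge0 xa, normr_ge0 xb).
have e0 : 0 < expR 1 :> R by exact: expR_gt0.
have xay : xa <= y / 2 by have := ler_norm xa; lra.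
have xby : xb <= y / 2 by have := ler_norm xb; lra.
have ey : expR 1 <= y / 2 by lra.
have y0 : 0 < y by lra.
have mA := filt_measurable hA0 t0 FA.
have intg s B : (0 < s)%N -> measurable B -> P.-integrable B (EFin \o (fun w => gap y (X s w))).
  move=> s0 mB; apply: (@bound_integrable _ _ _ P _ _ (y ^+ 2)) => //.
    by apply: (measurableT_comp (gap_measurable y)); exact: process_measurable hA0 _ s0.
  move=> w _; have /andP[? ?] := gap_le (process_ge0 hA0 w s0) (ltW y0).
  by rewrite ger0_norm.
have ic B k : measurable B -> P.-integrable B (EFin \o (fun=> k)).
  by move=> mB; exact: finite_measure_integrable_cst.
have FL : F t [set w | X t w <= y] by exact: (filt_le hA0 y t0 (leqnn _)).
set L := mkset _ in FL.
have mL := filt_measurable hA0 t0 FL.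
have FAL := sub_sigmaI (sig t0) FA FL.
have FAD := sub_sigmaD (sig t0) FA FL.
have mAL := filt_measurable hA0 t0 FAL.
have mAD := filt_measurable hA0 t0 FAD.
have hfar : \int[P]_(w in A `\` L) gap y (X t.+1 w) <= 2 * s2 * fine (P (A `\` L)).
  have [|i2 h2] := Hfar t _ t0 FAD.
    by move=> w [/Ay /= h _]; exact: le_trans xay h.
  apply: le_trans h2; apply: le_Rintegral => //; first exact: intg.
  move=> w [_ /= /negP]; rewrite -ltNge => /ltW yX.
  have -> : X t.+1 w = X t w + incr X t w by rewrite /incr addrC subrK.
  exact: gap_far.
have hnear : \int[P]_(w in A `&` L) gap y (X t.+1 w) <=
    \int[P]_(w in A `&` L) (gap y (X t w) + C1).
  apply: (@le_Rintegral_values _ _ _ P S F X hA0 t _ _ [set x | y / 2 <= x <= y] y) => //.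
  - exact: intg.
  - exact: (integrableD measurableT (intg _ _ t0 measurableT) (ic _ C1 measurableT)).
  - move=> x B Sx /andP[yx xy] FB Bx; have mB := filt_measurable hA0 t0 FB.
    have [i1 i2 m1 m2] := Hnear t B x t0 FB (le_trans xby yx) Bx.
    have ex : expR 1 <= x by exact: le_trans ey yx.
    have x0 : 0 < x by exact: lt_le_trans e0 ex.
    have l1 : 1 <= ln x by exact: ln_ge1.
    have l0 : 0 < ln x by exact: lt_le_trans ltr01 l1.
    have iZ := integrableZl mB (2 * (y - x)) i1.
    rewrite (RintegralD mB (intg _ _ t0 mB) (ic _ C1 mB)) Rintegral_cstM//.
    rewrite (_ : \int[P]_(w in B) gap y (X t w) = \int[P]_(w in B) gap y x); last first.
      by apply: eq_Rintegral => w; rewrite inE => /Bx /= ->.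
    have iG : P.-integrable B (EFin \o (fun w => gap y x - 2 * (y - x) * incr X t w)).
      exact: (integrableB mB (ic _ (gap y x) mB) iZ).
    have := @le_Rintegral _ _ _ P B (fun w => gap y (X t.+1 w))
      (fun w => gap y x - 2 * (y - x) * incr X t w + incr X t w ^+ 2) mB
      (intg _ _ (ltn0Sn t) mB) (integrableD mB iG i2).
    rewrite (RintegralD mB iG i2) (RintegralB mB (ic _ (gap y x) mB) iZ) (RintegralZl _ mB i1).
    rewrite Rintegral_cstM// => h.
    set q := fine (P B) in m1 m2 h *; have q0 : 0 <= q by exact: fine_prob_ge0.
    have hh : \int[P]_(w in B) gap y (X t.+1 w) <= gap y x * q -
        2 * (y - x) * \int[P]_(w in B) incr X t w + \int[P]_(w in B) incr X t w ^+ 2.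
      apply: h => w Bw.
      have -> : X t.+1 w = x + incr X t w by rewrite /incr (Bx _ Bw) addrC subrK.
      exact: gap_near.
    apply: (le_trans hh).
    set M1 := \int[P]_(w in B) incr X t w in m1 *.
    set M2 := \int[P]_(w in B) incr X t w ^+ 2 in m2 *.
    have M2q : M2 <= (s2 + 1) * q.
      have : 1 / ln x * q <= q by rewrite ler_piMl// ler_pdivrMr// mul1r.
      by have := le_trans (ler_norm _) m2; rewrite mulrDl mul1r; lra.
    have M1q : - M1 * x <= (`|c| + 1) * q.
      have : `|M1 * x - c * q| <= q.
        have -> : M1 * x - c * q = (M1 - c / x * q) * x by field; rewrite gt_eqF.
        rewrite normrM (gtr0_norm x0) -ler_pdivlMr// (le_trans m1)//.
        rewrite mulrC ler_wpM2l// ler_pdivrMr ?mulr_gt0// mulrA mulVf ?gt_eqF//.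
        by rewrite mul1r.
      have : - c * q <= `|c| * q by rewrite ler_wpM2r// -normrN ler_norm.
      by rewrite ler_norml mulrDl mul1r => ? /andP[? ?]; lra.
    have key : - (2 * (y - x) * M1) <= 2 * (`|c| + 1) * q.
      have [M10|M10] := leP 0 M1.
        have : 0 <= 2 * (`|c| + 1) * q by rewrite !mulr_ge0 ?addr_ge0.
        have : 0 <= 2 * (y - x) * M1 by rewrite !mulr_ge0// subr_ge0.
        lra.
      have : (y - x) * - M1 <= x * - M1 by rewrite ler_wpM2r ?oppr_ge0 ?(ltW M10)//; lra.
      lra.
    rewrite /C1 mulrDl; lra.
  - by move=> w [/Ay /= h1 /= h2]; split; first by apply/andP.
rewrite (RintegralD mAL (intg _ _ t0 mAL) (ic _ C1 mAL)) Rintegral_cstM// in hnear.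
rewrite (Rintegral_setI_setD mA mL (intg _ _ (ltn0Sn t) mA)).
rewrite (Rintegral_setI_setD mA mL (intg _ _ t0 mA)).
rewrite (prob_setI_setD P mA mL).
have g0 : 0 <= \int[P]_(w in A `\` L) gap y (X t w).
  by apply: Rintegral_ge0 => w _; exact: sqr_ge0.
have q1 := fine_prob_ge0 P (A `&` L); have q2 := fine_prob_ge0 P (A `\` L).
have : 0 <= s2 * fine (P (A `&` L)) by rewrite mulr_ge0// ltW.
have : 0 <= C1 * fine (P (A `\` L)) by rewrite mulr_ge0// ltW.
rewrite /C; move: hnear hfar g0; move: (fine (P (A `&` L))) (fine (P (A `\` L))) => u v.
move: (\int[P]_(w in _) _) (\int[P]_(w in _) _) (\int[P]_(w in _) _) (\int[P]_(w in _) _).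
move=> i1 i2 i3 i4; rewrite mulrDr !mulrDl; lra.
Qed.

Lemma survival_bound : exists2 ka : R, 0 < ka & exists y0 : R,
  forall y t W (K : nat), y0 <= y -> (0 < t)%N -> F t W -> W `<=` [set w | y <= X t w] ->
  K%:R <= ka * y ^+ 2 ->
  fine (P W) <= 2 * fine (P (W `&` [set w | forall s, (t <= s <= t + K)%N -> y / 2 < X s w])).
Proof.
have [C C0 [y0 HC]] := gap_drift.
exists (1 / (8 * C)); first by rewrite divr_gt0// mulr_gt0.
exists (Num.max y0 1) => y t W K; rewrite ge_max => /andP[yy y1] t0 FW Wy Ky.
have y00 : 0 < y by exact: lt_le_trans ltr01 y1.
have ti0 i : (0 < t + i)%N by rewrite addn_gt0 t0.
pose Q : set R := `]y / 2, +oo[%classic.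
pose V i := W `&` [set w | forall s, (t <= s <= t + i)%N -> y / 2 < X s w].
have FV i : F (t + i)%N (V i).
  apply: (sub_sigmaI (sig (ti0 i)) (filt_mono hA0 t0 (leq_addr _ _) FW)).
  rewrite (_ : mkset _ = [set w | forall s, (t <= s <= t + i)%N -> Q (X s w)]).
    by apply: (filt_forall hA0 _ t0 (ti0 i)); exact: measurable_itv.
  by apply/seteqP; split => w /= H s st; have := H s st; rewrite /Q /= in_itv/= andbT.
have mV i := filt_measurable hA0 (ti0 i) (FV i).
have VS i : V i.+1 `<=` V i.
  move=> w [Ww H]; split => // s /andP[s1 s2']; apply: H.
  by rewrite s1 addnS (leq_trans s2').
have mW := filt_measurable hA0 t0 FW.
have V0 : V 0%N = W.
  apply/seteqP; split => [w []//|w Ww]; split => // s.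
  rewrite addn0 -eqn_leq => /eqP <-.
  by apply: lt_le_trans (Wy _ Ww); lra.
have intg s B : (0 < s)%N -> measurable B -> P.-integrable B (EFin \o (fun w => gap y (X s w))).
  move=> s0 mB; apply: (@bound_integrable _ _ _ P _ _ (y ^+ 2)) => //.
    by apply: (measurableT_comp (gap_measurable y)); exact: process_measurable hA0 _ s0.
  move=> w _; have /andP[? ?] := gap_le (process_ge0 hA0 w s0) (ltW y00).
  by rewrite ger0_norm.
pose J i := \int[P]_(w in V i) gap y (X (t + i)%N w).
have step i : y ^+ 2 / 4 * (fine (P (V i)) - fine (P (V i.+1))) + J i.+1
    <= J i + C * fine (P W).
  have h1 : \int[P]_(w in V i) gap y (X (t + i).+1 w) <= J i + C * fine (P (V i)).
    apply: HC => // w [_ H] /=; apply: ltW; apply: H.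
    by rewrite leq_addr leqnn.
  have h2 : C * fine (P (V i)) <= C * fine (P W).
    by rewrite ler_pM2l//; apply: le_prob => // w [].
  have ig := intg (t + i).+1 (V i) (ltn0Sn _) (mV i).
  rewrite (Rintegral_setI_setD (mV i) (mV i.+1) ig) in h1.
  have VE : V i `&` V i.+1 = V i.+1 by rewrite setIC; apply: setIidl; exact: VS.
  rewrite VE in h1.
  have mD : measurable (V i `\` V i.+1) by exact: measurableD.
  have h3 : y ^+ 2 / 4 * fine (P (V i `\` V i.+1)) <=
      \int[P]_(w in V i `\` V i.+1) gap y (X (t + i).+1 w).
    rewrite -(Rintegral_cstM P _ mD); apply: le_Rintegral => //.
    - exact: finite_measure_integrable_cst.
    - exact: intg.
    - move=> w [[Ww H] nV].
      have Xy : X (t + i).+1 w <= y / 2.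
        rewrite leNgt; apply/negP => yX; apply: nV; split => // s /andP[s1].
        rewrite addnS leq_eqVlt => /predU1P[->//|s2'].
        by apply: H; rewrite s1.
      have -> : y ^+ 2 / 4 = (y / 2) ^+ 2 by field.
      rewrite /gap ler_sqr ?nnegrE; last 2 first.
      + by lra.
      + by rewrite le_max lexx orbT.
      by rewrite le_max; apply/orP; left; lra.
  have pE := prob_setI_setD P (mV i) (mV i.+1); rewrite VE in pE.
  rewrite pE [_ + fine (P (_ `\` _)) - _]addrAC subrr add0r.
  have JE : J i.+1 = \int[P]_(w in V i.+1) gap y (X (t + i).+1 w) by rewrite /J addnS.
  rewrite JE; lra.
have tot m : y ^+ 2 / 4 * (fine (P W) - fine (P (V m))) + J m <= J 0%N + m%:R * (C * fine (P W)).
  elim: m => [|m IH]; first by rewrite V0 subrr mulr0 mul0r add0r addr0.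
  have := step m; rewrite [m.+1%:R]mulrS mulrDl mul1r.
  move: (fine (P (V m))) (fine (P (V m.+1))) IH => u v; rewrite !mulrBr; lra.
have J0 : J 0%N = 0.
  have ig := intg t W t0 mW.
  have H0 w : W w -> 0 <= gap y (X t w) <= 0.
    by move=> /Wy /= yX; rewrite /gap (max_idPr _) ?subr_le0// expr0n lexx.
  have /andP[] := Rintegral_bounds mW ig H0.
  by rewrite !mul0r /J V0 addn0 => h1 h2; apply/eqP; rewrite eq_le h1 h2.
have JK : 0 <= J K by apply: Rintegral_ge0 => w _; exact: sqr_ge0.
have q0 := fine_prob_ge0 P W.
have y20 : 0 < y ^+ 2 by rewrite exprn_gt0.
have KC : K%:R * (C * fine (P W)) <= y ^+ 2 / 4 * (fine (P W) / 2).
  apply: (@le_trans _ _ (1 / (8 * C) * y ^+ 2 * (C * fine (P W)))).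
    by rewrite ler_wpM2r// mulr_ge0// ltW.
  by rewrite le_eqVlt; apply/orP; left; apply/eqP; field; rewrite gt_eqF.
have := tot K; rewrite J0 add0r => h.
have : y ^+ 2 / 4 * (fine (P W) - fine (P (V K))) <= y ^+ 2 / 4 * (fine (P W) / 2) by lra.
rewrite ler_pM2l ?divr_gt0// /V; lra.
Qed.

End lower_tail.

Lemma exit_step_le (R : realType) (Ji Jn i1 i2 u v : R) :
  Ji <= Jn + (i1 + i2) -> i1 <= v -> i2 <= u -> Ji <= Jn + u + v.
Proof. lra. Qed.

Lemma exit_sum_le (R : realType) (J0 Jm Jn fx fM q um un s v : R) :
  J0 <= Jm + fx * (q - um) + fM * s -> Jm <= Jn + fx * (um - un) + fM * v ->
  J0 <= Jn + fx * (q - un) + fM * (s + v).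
Proof. by rewrite !mulrBr mulrDr; lra. Qed.

Lemma exit_total_le (R : realType) (c0 p0 p1 q JN un fM s : R) :
  p1 * q <= JN + p0 * (q - un) + fM * s -> JN <= fM * un -> fM * un <= c0 ->
  0 <= p0 * un -> 2 * c0 = p1 * q - p0 * q -> c0 <= fM * s.
Proof. by rewrite mulrBr; lra. Qed.

Section lower_tail_estimate.
Context {d : measure_display} {T : measurableType d} {R : realType}.
Variables (P : probability T R) (S : set R) (F : nat -> set (set T)) (X : nat -> T -> R).
Variables (c s2 p : R).
Hypotheses (hA0 : A0 P S F X) (hA1 : A1 P S F X) (hA2 : A2 P c s2 F X) (hA3 : A3 P X).
Hypotheses (hMp : Mp P p F X) (p2 : 2 < p).
Implicit Types (A B W : set T) (t s i j : nat).
Local Notation r := (- 2 * c / s2).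
Hypotheses (r1 : -1 < r) (rp : 1 + r < p) (recurrent : P [set w | tau X 1 w <> None] = 1%E).
Local Notation confined := (confined X).
Local Notation alive := (alive X).
Local Notation sig t0 := (filt_sigma hA0 t0).

Let s20 : 0 < s2. Proof. by case: hA2. Qed.

Lemma sum_disjoint_le (B : nat -> set T) A n : (forall i, measurable (B i)) -> measurable A ->
  (forall i j, (i < j)%N -> B i `&` B j = set0) ->
  (forall i, (i < n)%N -> B i `<=` A) -> \sum_(i < n) fine (P (B i)) <= fine (P A).
Proof.
move=> mB + dB; elim: n A => [|n IH] A mA BA; first by rewrite big_ord0 fine_prob_ge0.
rewrite big_ord_recr /= (prob_setI_setD P mA (mB n)) addrC; apply: lerD.
  apply: le_prob => //; first exact: measurableI.
  by move=> w Bw; split => //; exact: BA Bw.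
apply: IH; first exact: measurableD.
move=> i iN w Bw; split; first by apply: BA Bw; rewrite ltnS ltnW.
by move=> Bn; have := dB i n iN; apply/eqP/set0P; exists w.
Qed.

Lemma exceedance_lower (n : R) : 0 < n -> exists2 c0 : R, 0 < c0 & exists y0 : R,
  forall y, y0 <= y -> exists (t1 N : nat) (W : nat -> set T), [/\ 
    forall i, F (t1 + i).+1 (W i),
    forall i, W i `<=` [set w | y <= X (t1 + i).+1 w] `&` alive (t1 + i).+1,
    forall i j, (i < j)%N -> W i `&` W j = set0 &
    c0 <= powln (1 + r) n (2 * y) * \sum_(i < N) fine (P (W i))].
Proof.
move=> n0; have g0 : 0 < 1 + r by have := r1; lra.
have [a [ea incF Hd]] := drift_estimate hA0 hA2 hMp p2 n g0 rp.
pose ep : R := n * (s2 / 2 * (1 + r)).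
have ep0 : 0 < ep by rewrite !mulr_gt0 ?divr_gt0.
have [x0 ax0 Hx0] := Hd _ ep0.
have a0 : 0 < a := lt_le_trans (expR_gt0 1) ea.
have ax0' := double_le (ltW a0) ax0.
have x00 : 0 < x0 := lt_le_trans a0 ax0'.
have [x1 [y1 [t1 [Sx1 x01 t10 PA0]]]] := reach_before_return hA0 hA1 hA3 x0 recurrent.
have [K K0 [yK HK]] := occupation_bound hA0 hA1 hA2 hMp p2 r1.
set A := confined y1 t1 `&` [set w | X t1 w = x1] in PA0.
have FA : F t1 A.
  exact: (sub_sigmaI (sig t10) (filt_confined hA0 y1 t10) (filt_eq hA0 x1 t10 (leqnn _))).
have mA := filt_measurable hA0 t10 FA.
set pa := fine (P A) in PA0.
pose c0 := (powln (1 + r) n x1 - powln (1 + r) n x0) * pa / 2.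
have c00 : 0 < c0 by rewrite divr_gt0// mulr_gt0// subr_gt0 incF.
exists c0 => //; exists (Num.max (Num.max y1 yK) (x1 + 1)) => y.
rewrite !ge_max => /andP[/andP[yy1 yyK] yx1].
have x1y : x1 < y by rewrite (lt_le_trans _ yx1)// ltrDl.
have x0y : x0 < y by exact: lt_trans x01 x1y.
have y0 : 0 < y by exact: lt_trans x00 x0y.
have ay : a <= 2 * y.
  by apply: le_trans (le_trans ax0' (ltW x0y)) _; rewrite ler_peMl ?(ltW y0)//; lra.
have y2y : y <= 2 * y by rewrite ler_peMl ?(ltW y0)//; lra.
pose f := clamp (powln (1 + r) n) a (2 * y).
pose fM := powln (1 + r) n (2 * y).
have fM0 : 0 < fM by apply: powln_gt0; apply: lt_le_trans ay; exact: lt_le_trans expR1_gt1 ea.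
have fb u : 0 <= f u <= fM.
  by rewrite (ltW (clamp_powln_gt0 _ _ ea _ ay)) /=; exact: clamp_powln_le.
have fE u : a <= u -> u <= y -> f u = powln (1 + r) n u.
  by move=> au uy; rewrite /f clamp_id// au (le_trans uy).
have intf s B : (0 < s)%N -> measurable B -> P.-integrable B (EFin \o (fun w => f (X s w))).
  by move=> s0 mB; exact: (clamp_powln_integrable hA0 ea incF ay s0 mB).
have sub t B : (0 < t)%N -> F t B -> B `<=` [set w | x0 <= X t w < y] ->
    \int[P]_(w in B) f (X t w) <= \int[P]_(w in B) f (X t.+1 w).
  move=> t0 FB Bxy.
  apply: (@le_Rintegral_values _ _ _ P S F X hA0 t (fun w => f (X t w))
    (fun w => f (X t.+1 w)) [set x | x0 <= x < y] y t0 (intf t setT t0 measurableT)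
    (intf t.+1 setT (ltn0Sn t) measurableT) _ B FB).
  - move=> x D Sx /andP[x0x xy] FD Dx; have mD := filt_measurable hA0 t0 FD.
    rewrite (_ : \int[P]_(w in D) f (X t w) = \int[P]_(w in D) f x); last first.
      by apply: eq_Rintegral => w; rewrite inE => /Dx /= ->.
    rewrite Rintegral_cstM//.
    have xb : 2 * x <= 2 * y by rewrite ler_pM2l// ltW.
    have := Hx0 t D x (2 * y) t0 FD Dx x0x xb.
    rewrite (powln_drift_critical hA2) -(fE x (le_trans ax0' x0x) (ltW xy)).
    rewrite ler_norml => /andP[+ _]; rewrite lerBrDr -mulNr -mulrDl.
    rewrite [X in X * _ <= _](_ : _ = f x)// /ep; ring.
  - by move=> w /Bxy /= xy; split => //; case/andP: xy => _ /ltW.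
have ti0 i : (0 < t1 + i)%N by rewrite addn_gt0 t10.
pose Q : set R := `]x0, y[%classic.
pose U i := A `&` [set w | forall s, (t1 <= s <= t1 + i)%N -> Q (X s w)].
have FU i : F (t1 + i)%N (U i).
  apply: (sub_sigmaI (sig (ti0 i)) (filt_mono hA0 t10 (leq_addr _ _) FA)).
  by apply: (filt_forall hA0 _ t10 (ti0 i)); exact: measurable_itv.
have mU i := filt_measurable hA0 (ti0 i) (FU i).
have Qe u : Q u -> x0 < u /\ u < y by rewrite /Q /= in_itv/= => /andP.
have eQ u : x0 < u -> u < y -> Q u by move=> h1 h2; rewrite /Q /= in_itv/= h1 h2.
have US i : U i.+1 `<=` U i.
  move=> w [Aw H]; split => // s /andP[s1 s2']; apply: H.
  by rewrite s1 addnS (leq_trans s2').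
have U0 : U 0%N = A.
  apply/seteqP; split => [w []//|w Aw]; split => // s.
  rewrite addn0 -eqn_leq => /eqP <-; apply: eQ; case: Aw => _ /= -> //.
pose W i := U i `&` [set w | y <= X (t1 + i).+1 w].
have FH i : F (t1 + i).+1 [set w | y <= X (t1 + i).+1 w].
  exact: (filt_ge hA0 y (ltn0Sn _) (leqnn _)).
have FW i : F (t1 + i).+1 (W i).
  exact: (sub_sigmaI (sig (ltn0Sn _)) (filt_mono hA0 (ti0 i) (leqnSn _) (FU i)) (FH i)).
have mW i := filt_measurable hA0 (ltn0Sn _) (FW i).
pose J i := \int[P]_(w in U i) f (X (t1 + i)%N w).
have step i : J i <= J i.+1 + f x0 * (fine (P (U i)) - fine (P (U i.+1))) + fM * fine (P (W i)).
  have h1 : J i <= \int[P]_(w in U i) f (X (t1 + i).+1 w).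
    apply: sub => // w [_ H]; have /Qe[h1 h2] : Q (X (t1 + i)%N w) by apply: H; rewrite leq_addr leqnn.
    by rewrite /= (ltW h1) h2.
  have ig := intf (t1 + i).+1 (U i) (ltn0Sn _) (mU i).
  rewrite (Rintegral_setI_setD (mU i) (mU i.+1) ig) in h1.
  have UE : U i `&` U i.+1 = U i.+1 by rewrite setIC; apply: setIidl; exact: US.
  rewrite UE in h1.
  set D := U i `\` U i.+1 in h1.
  have mD : measurable D by exact: measurableD.
  have mH := filt_measurable hA0 (ltn0Sn _) (FH i).
  set H := mkset _ in mH.
  have igD := intf (t1 + i).+1 D (ltn0Sn _) mD.
  rewrite (Rintegral_setI_setD mD mH igD) in h1.
  have mDH : measurable (D `&` H) by exact: measurableI.
  have mDH' : measurable (D `\` H) by exact: measurableD.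
  have b1 : \int[P]_(w in D `&` H) f (X (t1 + i).+1 w) <= fM * fine (P (W i)).
    apply: (@le_trans _ _ (fM * fine (P (D `&` H)))).
      rewrite -(Rintegral_cstM P _ mDH); apply: (le_Rintegral mDH (intf _ _ (ltn0Sn _) mDH)).
        exact: finite_measure_integrable_cst.
      by move=> w _; case/andP: (fb (X (t1 + i).+1 w)).
    by rewrite ler_pM2l//; apply: le_prob => // w [[]].
  have b2 : \int[P]_(w in D `\` H) f (X (t1 + i).+1 w) <= f x0 * fine (P D).
    apply: (@le_trans _ _ (f x0 * fine (P (D `\` H)))).
      rewrite -(Rintegral_cstM P _ mDH'); apply: (le_Rintegral mDH' (intf _ _ (ltn0Sn _) mDH')).
        exact: finite_measure_integrable_cst.
      move=> w [[[Aw Uw] nU] /= /negP]; rewrite -ltNge => Xy.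
      apply: (clamp_powln_homo incF) => //.
      rewrite leNgt; apply/negP => x0X; apply: nU; split => // s /andP[s1].
      rewrite addnS leq_eqVlt => /predU1P[->|s2']; first exact: eQ.
      by apply: Uw; rewrite s1.
    rewrite ler_wpM2l//; first by case/andP: (fb x0).
    by apply: le_prob => // w [].
  have pE := prob_setI_setD P (mU i) (mU i.+1); rewrite UE -/D in pE.
  rewrite pE [_ + fine (P D) - _]addrAC subrr add0r.
  have JE : J i.+1 = \int[P]_(w in U i.+1) f (X (t1 + i).+1 w) by rewrite /J addnS.
  rewrite JE; exact: exit_step_le h1 b1 b2.
have tot m : J 0%N <= J m + f x0 * (pa - fine (P (U m))) + fM * \sum_(i < m) fine (P (W i)).
  elim: m => [|m IH]; first by rewrite U0 subrr big_ord0 !mulr0 !addr0.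
  by rewrite big_ord_recr /=; exact: exit_sum_le IH (step m).
pose B := fM * (K * y ^+ 2 * pa) / c0.
have B0 : 0 <= B.
  by rewrite divr_ge0 ?(ltW c00)// mulr_ge0 ?(ltW fM0)// mulr_ge0 ?(ltW PA0)// mulr_ge0 ?(ltW K0) ?sqr_ge0.
pose N := (Num.truncn B).+1.
have /andP[_ BN] := Num.Theory.truncn_itv B0.
exists t1, N, W; split => //.
- move=> i w [[[[al _] _] Uw] Hw]; split => // s /andP[s1].
  rewrite leq_eqVlt => /predU1P[->|s2']; first by move=> X0; move: Hw; rewrite /= X0 leNgt y0.
  have [st|ts] := leqP s t1; first by apply: al; rewrite s1.
  have /Qe[h _] : Q (X s w) by apply: Uw; rewrite (ltnW ts).
  by move=> X0; rewrite X0 in h; have := lt_trans x00 h; rewrite ltxx.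
- move=> i j ij; apply/seteqP; split => // w [[_ /= Hw] [[_ Uw] _]].
  have /Qe[_ h] : Q (X (t1 + i).+1 w).
    by apply: Uw; rewrite -addnS leq_addr leq_add2l.
  by have := lt_le_trans h Hw; rewrite ltxx.
have N0' : 0 < N%:R :> R by rewrite ltr0n.
have UN : fM * fine (P (U N)) <= c0.
  have : N%:R * fine (P (U N)) <= K * y ^+ 2 * pa.
    apply: le_trans (HK y yyK t1 A N t10 FA).
    rewrite -[N in N%:R]card_ord mulr_natl -sumr_const; apply: ler_sum => i _.
    have mc : measurable (confined y (t1 + i)) := filt_measurable hA0 (ti0 i) (filt_confined hA0 y (ti0 i)).
    apply: le_prob => //; first exact: measurableI.
    move=> w [Aw Uw]; split => //; case: (Aw) => -[al bl] Xx1.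
    have iN : (t1 + i <= t1 + N)%N by rewrite leq_add2l ltnW.
    split=> s /andP[s1 s2']; have [st|/ltnW ts] := leqP s t1.
    - by apply: al; rewrite s1.
    - have /Qe[h _] : Q (X s w) by apply: Uw; rewrite ts (leq_trans s2').
      by move=> X0; rewrite X0 in h; have := lt_trans x00 h; rewrite ltxx.
    - by apply: lt_le_trans yy1; apply: bl; rewrite s1.
    - by have /Qe[_ h] : Q (X s w) by apply: Uw; rewrite ts (leq_trans s2').
  move=> h; rewrite -(ler_pM2l N0') mulrCA.
  apply: (@le_trans _ _ (fM * (K * y ^+ 2 * pa))); first by rewrite ler_pM2l.
  by rewrite -ler_pdivrMr// ltW.
have J0 : J 0%N = powln (1 + r) n x1 * pa.
  rewrite /J U0 addn0 (_ : \int[P]_(w in A) f (X t1 w) = \int[P]_(w in A) f x1); last first.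
    by apply: eq_Rintegral => w; rewrite inE => -[_ /= ->].
  by rewrite Rintegral_cstM// fE// ?(le_trans ax0')// ltW.
have JN : J N <= fM * fine (P (U N)).
  have ig := intf (t1 + N)%N (U N) (ti0 N) (mU N).
  by have /andP[] := Rintegral_bounds (mU N) ig (fun w _ => fb (X (t1 + N)%N w)).
have := tot N; rewrite J0 (fE x0 ax0' (ltW x0y)).
have fU : 0 <= powln (1 + r) n x0 * fine (P (U N)).
  by rewrite mulr_ge0 ?fine_prob_ge0// -(fE x0 ax0' (ltW x0y)); case/andP: (fb x0).
have c0E : 2 * c0 = powln (1 + r) n x1 * pa - powln (1 + r) n x0 * pa by rewrite /c0; field.
by move=> h; exact: exit_total_le h JN UN fU c0E.
Qed.

Lemma lower_tail (ep : R) : 0 < ep ->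
  \forall x \near +oo, forall M : nat, M%:R <= x + 1 ->
  x `^ (- ((1 + r) / 2)) * ln x `^ (- ep) <= fine (P (alive M)).
Proof.
move=> ep0; have ep20 : 0 < ep / 2 by rewrite divr_gt0.
have [c0 c00 [y0 Hy0]] := exceedance_lower ep20.
have [ka ka0 [yS HS]] := survival_bound hA0 hA2.
pose b : R := (2 / ka) `^ (1 / 2).
have b0 : 0 < b by rewrite powR_gt0// divr_gt0.
have b2 : ka * b ^+ 2 = 2.
  rewrite /b -powR_mulrn ?powR_ge0// -powRrM div1r mulVf ?pnatr_eq0// powRr1 ?divr_ge0 ?(ltW ka0)//.
  by field; rewrite gt_eqF.
pose al : R := (1 + r) / 2.
pose C := 2 * (2 * b) `^ (1 + r) / c0.
pose D := (`|y0| + `|yS| + 1) / b + 2 * b.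
have D0 : 0 < D.
  by rewrite addr_gt0// ?mulr_gt0// ?invr_gt0// ltr_wpDl// addr_ge0.
near=> x => M Mx.
have x1 : 1 <= x by near: x; exact: nbhs_pinfty_ge.
have x0 : 0 < x by exact: lt_le_trans ltr01 x1.
have ex : expR 1 <= x by near: x; exact: nbhs_pinfty_ge.
have l1 : 1 <= ln x by exact: ln_ge1.
have l0 : 0 < ln x by exact: lt_le_trans ltr01 l1.
have lC : C <= ln x `^ (ep / 2) by near: x; exact: near_powR_ln_ge.
have xD' : x `^ (- (1 / 2)) <= D^-1.
  by near: x; apply: near_powR_small; rewrite ?invr_gt0.
set h := x `^ (1 / 2).
have h0 : 0 < h by exact: powR_gt0.
have xD : D <= h by move: xD'; rewrite powRN lef_pV2 ?posrE.
have hh : h ^+ 2 = x.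
  by rewrite /h -powR_mulrn ?powR_ge0// -powRrM div1r mulVf ?pnatr_eq0// powRr1 ?(ltW x0).
pose y := h * b.
have yy : `|y0| + `|yS| + 1 <= y.
  rewrite /y -ler_pdivrMr//; apply: le_trans xD; rewrite /D lerDl.
  by rewrite mulr_ge0// ltW.
have yb : 2 * b <= h.
  apply: le_trans xD; rewrite /D lerDr.
  by rewrite divr_ge0 ?(ltW b0)// !addr_ge0.
have yy0 : y0 <= y by have := ler_norm y0; have := normr_ge0 yS; move: yy; lra.
have yyS : yS <= y by have := ler_norm yS; have := normr_ge0 y0; move: yy; lra.
have yp : 0 < y by rewrite mulr_gt0.
have [t1 [N [W [FW WH dW cW]]]] := Hy0 y yy0.
have MK : M%:R <= ka * y ^+ 2.
  apply: (le_trans Mx); rewrite /y exprMn hh mulrCA b2; move: x1; lra.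
pose V i := W i `&` [set w | forall s, ((t1 + i).+1 <= s <= (t1 + i).+1 + M)%N -> y / 2 < X s w].
have mW i := filt_measurable hA0 (ltn0Sn (t1 + i)) (FW i).
have mV i : measurable (V i).
  apply: measurableI => //.
  pose Q : set R := `]y / 2, +oo[%classic.
  rewrite (_ : mkset _ = [set w | forall s, ((t1 + i).+1 <= s <= (t1 + i).+1 + M)%N -> Q (X s w)]).
    apply: (filt_measurable hA0 (ltn0Sn (t1 + i + M))).
    by apply: (filt_forall hA0 _ (ltn0Sn _) (ltn0Sn _)); exact: measurable_itv.
  by apply/seteqP; split => w /= H s st; have := H s st; rewrite /Q /= in_itv/= andbT.
have WV : \sum_(i < N) fine (P (W i)) <= 2 * fine (P (alive M)).
  apply: (@le_trans _ _ (2 * \sum_(i < N) fine (P (V i)))).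
    rewrite mulr_sumr; apply: ler_sum => i _.
    apply: (HS y (t1 + i).+1 (W i) M yyS (ltn0Sn _) (FW i) _ MK).
    by move=> w /WH[].
  rewrite ler_pM2l//.
  have [M0|M0] := posnP M.
    have -> : alive M = setT by apply/seteqP; split => // w _ s; rewrite M0; case: s => [|s]//; rewrite andbF.
    apply: sum_disjoint_le => //.
    move=> i j ij; apply/seteqP; split => // w [[Wi _] [Wj _]].
    by have := dW i j ij; apply/eqP/set0P; exists w.
  apply: sum_disjoint_le => //.
  - exact: (filt_measurable hA0 M0 (filt_alive hA0 M0)).
  - move=> i j ij; apply/seteqP; split => // w [[Wi _] [Wj _]].
    by have := dW i j ij; apply/eqP/set0P; exists w.
  - move=> i _ w [Wi Hi] s /andP[s1 s2'].
    have [_ alw] := WH i w Wi.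
    have [st|/ltnW ts] := leqP s (t1 + i).+1; first by apply: alw; rewrite s1.
    have := Hi s; rewrite ts (leq_trans s2') ?leq_addl// => /(_ isT) h1 X0.
    by move: h1; rewrite X0; move: yp; lra.
have pw : powln (1 + r) (ep / 2) (2 * y) <= (2 * b) `^ (1 + r) * x `^ al * ln x `^ (ep / 2).
  have E : 2 * y = 2 * b * h by rewrite /y; ring.
  have e2 : x `^ al = h `^ (1 + r) by rewrite /h -powRrM; congr (powR x _); rewrite /al; ring.
  rewrite e2 -powRM ?(ltW h0)//; last by rewrite mulr_ge0// ltW.
  rewrite /powln E ler_wpM2l ?powR_ge0//.
  have [lb|lb] := leP 0 (ln (2 * b * h)).
    apply: ge0_ler_powR; rewrite ?nnegrE ?(ltW l0) ?(ltW ep20)//.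
    rewrite ler_ln ?posrE ?mulr_gt0// -hh expr2 ler_pM2r//.
  rewrite lt0_powR1//.
  by rewrite -[leLHS](powRr0 (ln x)) ler_powR// ltW.
have al0 : 0 < x `^ al by exact: powR_gt0.
have L0 : 0 < ln x `^ (ep / 2) by exact: powR_gt0.
set q := fine (P (alive M)) in WV *.
have q0 : 0 <= q by exact: fine_prob_ge0.
have main : c0 <= (2 * b) `^ (1 + r) * x `^ al * ln x `^ (ep / 2) * (2 * q).
  apply: (le_trans cW); apply: ler_pM => //.
  - by rewrite mulr_ge0 ?powR_ge0.
  - by apply: sumr_ge0 => i _; exact: fine_prob_ge0.
have -> : - ((1 + r) / 2) = - al by [].
rewrite (_ : - ep = - (ep / 2) + - (ep / 2)); last by field.
rewrite gt0_powRD// !powRN -!invfM.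
rewrite -[leLHS]mul1r ler_pdivrMr; last by rewrite !mulr_gt0.
have bb : 0 < (2 * b) `^ (1 + r) by apply: powR_gt0; rewrite mulr_gt0.
have lC' : 2 * (2 * b) `^ (1 + r) <= c0 * ln x `^ (ep / 2).
  by move: lC; rewrite /C ler_pdivrMr// [leRHS]mulrC.
have := le_trans lC' (ler_wpM2r (ltW L0) main).
rewrite [leRHS](_ : _ = 2 * (2 * b) `^ (1 + r) * (q * (x `^ al * (ln x `^ (ep / 2) * ln x `^ (ep / 2)))));
  last by ring.
by rewrite -[leLHS]mulr1 ler_pM2l// mulr_gt0.
Unshelve. all: by end_near. Qed.

End lower_tail_estimate.

(** * Moments *)

Section dyadic.
Context {R : realType}.

Lemma dyadic_powR (al : R) k : (2 `^ al) ^+ k = ((2 ^ k)%:R : R) `^ al.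
Proof. by rewrite natrX -powR_mulrn ?powR_ge0// -!powRrM mulrC powRrM powR_mulrn. Qed.

Lemma dyadic_layers_le (al : R) m n : 0 < al -> (0 < m)%N ->
  \sum_(k < n) (if (2 ^ k.+1 <= m)%N then (2 `^ al) ^+ k.+1 - (2 `^ al) ^+ k else 0)
  <= (m%:R : R) `^ al.
Proof.
move=> al0 m0; set b := 2 `^ al.
have [j [jm -> _]] : exists j, [/\ (2 ^ j <= m)%N,
    \sum_(k < n) (if (2 ^ k.+1 <= m)%N then b ^+ k.+1 - b ^+ k else 0) = b ^+ j - 1 &
    (j = n) \/ ((m < 2 ^ j.+1)%N /\ (j <= n)%N)].
  elim: n => [|n [j [jm E H]]].
    by exists 0%N; split; [rewrite expn0|rewrite big_ord0 expr0 subrr|left].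
  have [jn|[mj jn]] := H.
    subst j; have [h|h] := leqP (2 ^ n.+1) m.
      exists n.+1; split => //; last by left.
      by rewrite big_ord_recr /= E h addrC subrKA.
    exists n; split => //; last by right.
    by rewrite big_ord_recr /= E leqNgt h addr0.
  exists j; split => //; last by right; split => //; exact: leqW.
  rewrite big_ord_recr /= E leqNgt (leq_trans mj) ?addr0//.
  by rewrite leq_pexp2l.
apply: (@le_trans _ _ (b ^+ j)); first by rewrite gerBl.
rewrite /b dyadic_powR; apply: ge0_ler_powR; rewrite ?nnegrE ?(ltW al0)//.
by rewrite ler_nat.
Qed.

Lemma geometric_sum_le (rho : R) n : 0 <= rho -> rho < 1 ->
  \sum_(k < n) rho ^+ k <= (1 - rho)^-1.
Proof.
move=> r0 r1; have r10 : 0 < 1 - rho by rewrite subr_gt0.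
have E : (\sum_(k < n) rho ^+ k) * (1 - rho) = 1 - rho ^+ n.
  elim: n => [|n IH]; first by rewrite big_ord0 mul0r expr0 subrr.
  by rewrite big_ord_recr /= mulrDl IH exprS; ring.
by rewrite -[leRHS]mul1r ler_pdivlMr// E gerBl exprn_ge0.
Qed.

Lemma nat_ceil_ex (x : R) : 0 < x -> exists N : nat,
  [/\ (0 < N)%N, forall k, (x <= k%:R) = (N <= k)%N & N%:R <= x + 1].
Proof.
move=> x0; have exk : exists k : nat, x <= k%:R.
  by exists (Num.truncn x).+1; have /andP[_ /ltW] := Num.Theory.truncn_itv (ltW x0).
case: (ex_minnP exk) => N xN Nmin.
have N0 : (0 < N)%N by rewrite -(ltr0n R) (lt_le_trans x0).
exists N; split => //.
  move=> k; apply/idP/idP => [/Nmin//|Nk].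
  by apply: (le_trans xN); rewrite ler_nat.
rewrite leNgt; apply/negP => h.
have : (N <= N.-1)%N by apply: Nmin; move: h; rewrite -{1}(prednK N0) -natr1; lra.
by rewrite leqNgt prednK// leqnn.
Qed.

End dyadic.

Section moments.
Context {d : measure_display} {T : measurableType d} {R : realType}.
Variables (P : probability T R) (S : set R) (F : nat -> set (set T)) (X : nat -> T -> R).
Hypothesis hA0 : A0 P S F X.
Local Arguments tau : simpl never.
Local Notation alive := (alive X).

Lemma measurable_alive t : measurable (alive t).
Proof.
case: t => [|t]; last exact: (filt_measurable hA0 (ltn0Sn t) (filt_alive hA0 (ltn0Sn t))).
rewrite (_ : alive 0 = setT)//; apply/seteqP; split => // w _ s /andP[s1].
by rewrite leqn0 => /eqP s0; rewrite s0 in s1.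
Qed.

Lemma alive_ret_eta w N : (0 < N)%N -> alive N w <->
  match ret_eta X 1 w with Some m => (N <= m)%N | None => True end.
Proof.
move=> N0; rewrite -(@eta_tailE _ _ _ X N%:R N N0) => [|k]; last by rewrite ler_nat.
by rewrite /eta_tail /=; case: ret_eta => // m; rewrite ler_nat.
Qed.

Lemma eta1_pow_measurable (al : R) : measurable_fun setT (eta1_pow X al).
Proof.
move=> _ B mB; rewrite setTI.
rewrite (_ : _ @^-1` _ = (\bigcup_k (if `[< B ((k.-1%:R `^ al)%:E) >]
   then [set w | tau X 1 w = Some k] else set0))
   `|` (if `[< B +oo%E >] then ~` [set w | tau X 1 w <> None] else set0)).
  apply: measurableU.
    by apply: bigcupT_measurable => k; case: ifPn => // _; exact: (measurable_tau hA0).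
  by case: ifPn => // _; apply: measurableC; exact: (measurable_tau_fin hA0).
apply/seteqP; split => w; rewrite /preimage /mkset /eta1_pow /ret_eta -[1.-1]/0%N tau0.
  case E : (tau X 1 w) => [k|] Bw.
    by left; exists k => //; rewrite asboolT// -subn1.
  by right; rewrite asboolT//= E => /(_ erefl).
move=> [[k _]|].
  by case: asboolP => // Bk /= ->; rewrite subn1.
by case: asboolP => // Bo /= h; case: (tau X 1 w) h => // k h; exfalso; apply: h.
Qed.

Lemma eta1_pow_ge0 (al : R) w : (0 <= eta1_pow X al w)%E.
Proof. by rewrite /eta1_pow; case: ret_eta => [k|]; rewrite ?leey// lee_fin powR_ge0. Qed.

Lemma integral_indicZ (k : R) (A : set T) : 0 <= k -> measurable A ->
  (\int[P]_w (k * \1_A w)%:E = (k * fine (P A))%:E)%E.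
Proof.
move=> k0 mA.
under eq_integral do rewrite EFinM.
rewrite ge0_integralZl//.
- by rewrite integral_indic// setIT EFinM fineK// fin_num_prob.
- by apply/measurable_EFinP; exact: measurable_indic.
Qed.

Lemma moment_infinite (al : R) : 0 < al ->
  (\forall x \near +oo, forall M : nat, M%:R <= x + 1 ->
    x `^ (- al) * ln x `^ (- (1 / 2)) <= fine (P (alive M))) ->
  (\int[P]_w eta1_pow X al w = +oo)%E.
Proof.
move=> al0 [x0 [_ Hx0]]; set b := 2 `^ al : R.
have b0 : 0 < b by exact: powR_gt0.
have b1 : 1 < b.
  have := @gt0_ltr_powR R al al0 1 2; rewrite powR1; apply; rewrite ?nnegrE//; lra.
have low n : ((\sum_(k < n) (b ^+ k.+1 - b ^+ k) * fine (P (alive (2 ^ k.+1))))%:E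
    <= \int[P]_w eta1_pow X al w)%E.
  have bk k : 0 <= b ^+ k.+1 - b ^+ k.
    by rewrite subr_ge0 exprS ler_peMl ?(ltW b1)// exprn_ge0// ltW.
  have -> : ((\sum_(k < n) (b ^+ k.+1 - b ^+ k) * fine (P (alive (2 ^ k.+1))))%:E =
      \int[P]_w (\sum_(k <- index_iota 0 n) ((b ^+ k.+1 - b ^+ k) * \1_(alive (2 ^ k.+1)) w)%:E))%E.
    rewrite ge0_integral_sum//.
    - rewrite -sumEFin big_mkord; apply: eq_bigr => k _.
      by rewrite integral_indicZ//; exact: measurable_alive.
    - move=> k; apply/measurable_EFinP; apply: measurable_funM => //.
      by apply: measurable_indic; exact: measurable_alive.
    - by move=> k w _; rewrite lee_fin mulr_ge0.
  apply: ge0_le_integral => //.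
  - by move=> w _; apply: sume_ge0 => k _; rewrite lee_fin mulr_ge0.
  - apply: emeasurable_sum => k; apply/measurable_EFinP; apply: measurable_funM => //.
    by apply: measurable_indic; exact: measurable_alive.
  - exact: eta1_pow_measurable.
  move=> w _; rewrite /eta1_pow; case E : (ret_eta X 1 w) => [m|]; last by rewrite leey.
  rewrite sumEFin lee_fin big_mkord.
  have m0 : (0 < m)%N.
    have := (@alive_ret_eta w 1 (ltn0Sn 0)).1; rewrite E; apply.
    by move=> s /andP[s1 s2]; have := leq_trans s1 s2.
  apply: le_trans (dyadic_layers_le n al0 m0); apply: ler_sum => k _.
  have [|h] := leqP (2 ^ k.+1) m; first by rewrite indicE -/b; case: (_ \in _); rewrite ?mulr1// mulr0.
  have e0 : (0 < 2 ^ k.+1)%N by rewrite expn_gt0.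
  rewrite indicE memNset ?mulr0// => alw.
  by have := (alive_ret_eta w e0).1 alw; rewrite E leqNgt h.
have [//|fin] := eqVneq (\int[P]_w eta1_pow X al w)%E +oo%E; exfalso.
have i0 : (0 <= \int[P]_w eta1_pow X al w)%E.
  by apply: integral_ge0 => w _; exact: eta1_pow_ge0.
set q := fine (\int[P]_w eta1_pow X al w)%E.
have qE : (\int[P]_w eta1_pow X al w = q%:E)%E.
  by rewrite fineK// ge0_fin_numE// ltey.
pose k0 := (Num.truncn `|x0|).+2.
have /andP[_ tx0] := Num.Theory.truncn_itv (normr_ge0 x0).
have x0k k : (k0 <= k)%N -> x0 < (2 ^ k)%:R.
  move=> kk; apply: (le_lt_trans (ler_norm x0)); apply: (lt_le_trans tx0).
  rewrite ler_nat; apply: leq_trans (ltnW (ltn_expl k (ltnSn 1))).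
  by apply: leq_trans kk; rewrite leqnSn.
pose dl := (b - 1) / b.
have dl0 : 0 < dl by rewrite divr_gt0// subr_gt0.
have ln2 : 0 < ln 2 :> R by rewrite ln_gt0//; lra.
have m11 : -1 < 1 :> R by lra.
have ln21 : ln 2 <= 1 :> R by exact: (le_ln1Dx m11).
have term n k : (0 < n)%N -> (k < n ^ 2)%N -> (k0 <= k)%N ->
    dl / n%:R <= (b ^+ k.+1 - b ^+ k) * fine (P (alive (2 ^ k.+1))).
  move=> n0 kn kk.
  have := Hx0 (2 ^ k.+1)%:R (x0k _ (leqW kk)) (2 ^ k.+1)%N; rewrite lerDl => /(_ ler01) h.
  apply: (@le_trans _ _ ((b ^+ k.+1 - b ^+ k) * ((2 ^ k.+1)%:R `^ (- al) * ln (2 ^ k.+1)%:R `^ (- (1 / 2))))); last first.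
    apply: ler_wpM2l => //.
    by rewrite subr_ge0 exprS ler_peMl ?(ltW b1)// exprn_ge0// ltW.
  rewrite powRN -dyadic_powR -/b mulrA.
  have -> : (b ^+ k.+1 - b ^+ k) / b ^+ k.+1 = dl.
    by rewrite /dl exprS; field; rewrite expf_neq0 gt_eqF.
  rewrite ler_pM2l// powRN lef_pV2 ?posrE ?powR_gt0 ?ltr0n//; last first.
    by rewrite natrX lnXn// mulrn_wgt0.
  rewrite natrX lnXn//; apply: (@le_trans _ _ ((n%:R ^+ 2) `^ (1 / 2))).
    apply: ge0_ler_powR; rewrite ?nnegrE ?exprn_ge0 ?mulrn_wge0 ?(ltW ln2)//.
    apply: (@le_trans _ _ k.+1%:R); first by rewrite -[leLHS]mulr_natl ler_piMr.
    by rewrite -natrX ler_nat.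
  by rewrite -powR_mulrn// -powRrM div1r mulfV ?pnatr_eq0// powRr1.
have big n : (0 < n)%N -> dl * (n%:R - k0%:R) <= q.
  move=> n0; have := low (n ^ 2)%N; rewrite qE lee_fin; apply: le_trans.
  have [kn|nk] := leqP k0 (n ^ 2); last first.
    apply: (@le_trans _ _ 0); last first.
      apply: sumr_ge0 => k _; rewrite mulr_ge0 ?fine_prob_ge0//.
      by rewrite subr_ge0 exprS ler_peMl ?(ltW b1)// exprn_ge0// ltW.
    rewrite mulr_ge0_le0 ?(ltW dl0)// subr_le0 ler_nat (leq_trans _ (ltnW nk))//.
    by rewrite -{1}(expn1 n) leq_pexp2l.
  rewrite -(big_mkord xpredT (fun k => (b ^+ k.+1 - b ^+ k) * fine (P (alive (2 ^ k.+1))))).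
  rewrite (big_cat_nat _ kn)//= -[leLHS]add0r lerD//.
    apply: sumr_ge0 => k _; rewrite mulr_ge0 ?fine_prob_ge0//.
    by rewrite subr_ge0 exprS ler_peMl ?(ltW b1)// exprn_ge0// ltW.
  apply: (@le_trans _ _ (\sum_(k0 <= k < n ^ 2) dl / n%:R)); last first.
    by apply: ler_sum_nat => k /andP[k1 k2]; exact: term.
  rewrite sumr_const_nat -[leRHS]mulr_natr -mulrA ler_pM2l// natrB// mulrBr.
  have n0' : 0 < n%:R :> R by rewrite ltr0n.
  rewrite natrX expr2 mulrA mulVf ?gt_eqF// mul1r lerD2l lerN2 ler_piMl//.
  by rewrite invf_le1// ler1n.
pose n := (Num.truncn (`|q| / dl)).+1.
have /andP[_ tq] := Num.Theory.truncn_itv (divr_ge0 (normr_ge0 q) (ltW dl0)).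
have := big (n + k0)%N isT; rewrite natrD addrK mulrC -ler_pdivlMr// => h.
have : q / dl <= `|q| / dl by rewrite ler_pM2r ?invr_gt0// ler_norm.
by move=> /(le_trans h)/(le_lt_trans)/(_ tq); rewrite ltxx.
Qed.

Lemma moment_finite (al be : R) : 0 < be -> be < al ->
  P [set w | tau X 1 w <> None] = 1%E ->
  (\forall x \near +oo, forall N : nat, x <= N%:R -> fine (P (alive N)) <= x `^ (- al)) ->
  (\int[P]_w eta1_pow X be w < +oo)%E.
Proof.
move=> be0 beal rec [x0 [_ Hx0]]; set b := 2 `^ be : R.
have b0 : 0 < b by exact: powR_gt0.
pose rho : R := 2 `^ (be - al).
have rho0 : 0 < rho by exact: powR_gt0.
have rho1 : rho < 1.
  by rewrite /rho /powR gt_eqF// expR_lt1 nmulr_rlt0 ?subr_lt0// ln_gt0//; lra.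
pose k0 := (Num.truncn `|x0|).+2.
have /andP[_ tx0] := Num.Theory.truncn_itv (normr_ge0 x0).
have x0k k : (k0 <= k)%N -> x0 < (2 ^ k)%:R.
  move=> kk; apply: (le_lt_trans (ler_norm x0)); apply: (lt_le_trans tx0).
  rewrite ler_nat; apply: leq_trans (ltnW (ltn_expl k (ltnSn 1))).
  by apply: leq_trans kk; rewrite leqnSn.
have b1 : 1 <= b by rewrite -[leLHS](powRr0 2) ler_powR ?(ltW be0)//; lra.
pose D := b ^+ k0 / rho ^+ k0 + b.
have D0 : 0 < D by rewrite addr_gt0// divr_gt0// exprn_gt0.
have term k : b ^+ k.+1 * fine (P (alive (2 ^ k))) <= D * rho ^+ k.
  have [kk|kk] := leqP k0 k.
    have := Hx0 (2 ^ k)%:R (x0k _ kk) (2 ^ k)%N (lexx _) => h.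
    apply: (@le_trans _ _ (b ^+ k.+1 * (2 ^ k)%:R `^ (- al))).
      by rewrite ler_pM2l// exprn_gt0.
    have -> : b ^+ k.+1 * (2 ^ k)%:R `^ (- al) = b * rho ^+ k.
      rewrite exprS -mulrA /b /rho !dyadic_powR -gt0_powRD// ltr0n expn_gt0//.
    by rewrite ler_pM2r ?exprn_gt0// /D lerDr divr_ge0// exprn_ge0// ltW.
  apply: (@le_trans _ _ (b ^+ k0)).
    apply: (@le_trans _ _ (b ^+ k.+1 * 1)).
      rewrite ler_pM2l ?exprn_gt0// -lee_fin fineK; last by apply: fin_num_prob; exact: measurable_alive.
      by apply: probability_le1; exact: measurable_alive.
    by rewrite mulr1 ler_weXn2l.
  rewrite /D mulrDl -[leLHS]addr0 lerD//; last by rewrite mulr_ge0 ?exprn_ge0 ?(ltW b0) ?(ltW rho0).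
  rewrite mulrAC -mulrA ler_peMr ?exprn_ge0 ?(ltW b0)//.
  rewrite ler_pdivlMr ?exprn_gt0// mul1r.
  by rewrite ler_wiXn2l ?(ltW rho0) ?(ltW rho1)// ltnW.
pose f k w : \bar R := ((b ^+ k.+1) * \1_(alive (2 ^ k)) w)%:E.
have mf k : measurable_fun setT (f k).
  apply/measurable_EFinP; apply: measurable_funM => //.
  by apply: measurable_indic; exact: measurable_alive.
have f0 k w : (0 <= f k w)%E by rewrite lee_fin mulr_ge0 ?exprn_ge0// ltW.
apply: (@le_lt_trans _ _ (\int[P]_w (\sum_(k <oo) f k w))%E).
  apply: ae_ge0_le_integral => //.
  - by move=> w _; exact: eta1_pow_ge0.
  - exact: eta1_pow_measurable.
  - by move=> w _; apply: nneseries_ge0 => k _ _; exact: f0.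
  - exact: ge0_emeasurable_sum.
  exists (~` [set w | tau X 1 w <> None]); split.
  - by apply: measurableC; exact: (measurable_tau_fin hA0).
  - apply: etrans (probability_setC P (measurable_tau_fin hA0 1)) _.
    by rewrite rec subee.
  move=> w /= + h; apply => _; move: h.
  have := @alive_ret_eta w; rewrite /eta1_pow /ret_eta -[1.-1]/0%N tau0.
  case: (tau X 1 w) => [m|//] alv _; set mm := (m - 1)%N in alv *.
  have m0 : (0 < mm)%N.
    have := (alv 1%N (ltn0Sn 0)).1; apply.
    by move=> s /andP[s1 s2]; have := leq_trans s1 s2.
  have /andP[l1 l2] := trunc_log_bounds (ltnSn 1) m0.
  set k := trunc_log 2 mm in l1 l2.
  apply: (@le_trans _ _ (f k w)).
    rewrite /f lee_fin indicE mem_set; last by apply/alv; rewrite ?expn_gt0.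
    rewrite mulr1 /b dyadic_powR; apply: ge0_ler_powR; rewrite ?nnegrE ?(ltW be0)//.
    by rewrite ler_nat ltnW.
  apply: (@le_trans _ _ (\sum_(0 <= i < k.+1) f i w)%E).
    by rewrite big_nat_recr//= leeDr// sume_ge0.
  exact: nneseries_lim_ge.
rewrite integral_nneseries//.
apply: (@le_lt_trans _ _ (D / (1 - rho))%:E); last exact: ltry.
apply: lime_le.
  by apply: is_cvg_nneseries => k _ _; apply: integral_ge0.
apply: nearW => n.
rewrite (eq_bigr (fun k => (b ^+ k.+1 * fine (P (alive (2 ^ k))))%:E)); last first.
  by move=> k _; rewrite /f integral_indicZ ?exprn_ge0 ?(ltW b0)//; exact: measurable_alive.
rewrite sumEFin lee_fin big_mkord.
apply: (@le_trans _ _ (\sum_(k < n) D * rho ^+ k)); first by apply: ler_sum => k _.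
by rewrite -mulr_sumr ler_pM2l// geometric_sum_le// ltW.
Qed.

End moments.

Theorem theorem2p4 (d : measure_display) (T : measurableType d) (R : realType)
  (P : probability T R) (S : set R) (F : nat -> set (set T)) (X : nat -> T -> R)
  (c s2 p : R) :
  A0 P S F X -> A1 P S F X -> A2 P c s2 F X -> A3 P X ->
  -1 < - 2 * c / s2 ->
  Num.max 2 (1 + (- 2 * c / s2)) < p -> Mp P p F X ->
  let r := - 2 * c / s2 in
  (forall eps : R, 0 < eps ->
     \forall x \near +oo,
       ((x `^ (- ((1 + r) / 2)) * ln x `^ (- eps))%:E
         <= P [set w | match ret_eta X 1%N w with
                       | Some k => (x <= k%:R)%R
                       | None => True end])%E
       /\ (P [set w | match ret_eta X 1%N w with
                     | Some k => (x <= k%:R)%R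
                     | None => True end]
         <= (x `^ (- ((1 + r) / 2)) * ln x `^ (2 + r + eps))%:E)%E)
  /\ (\int[P]_w eta1_pow X ((1 + r) / 2) w = +oo)%E
  /\ (forall eps : R, 0 < eps ->
        (\int[P]_w eta1_pow X ((1 + r) / 2 - eps) w < +oo)%E).
Proof.
move=> hA0 hA1 hA2 hA3 r1; rewrite gt_max => /andP[p2 rp] hMp r.
have al0 : 0 < (1 + r) / 2 by rewrite divr_gt0//; move: r1; rewrite -/r; lra.
have up ep := upper_tail hA0 hA1 hA2 hMp p2 (ep := ep) r1 rp.
rewrite -/r in up.
have mal := measurable_alive hA0.
have upw be : be < (1 + r) / 2 -> \forall x \near +oo, forall N : nat, x <= N%:R ->
    fine (P (alive X N)) <= x `^ (- be).
  move=> beal; near=> x => N xN.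
  have x1 : 1 <= x by near: x; exact: nbhs_pinfty_ge.
  have x0 : 0 < x by exact: lt_le_trans ltr01 x1.
  apply: (@le_trans _ _ (x `^ (- ((1 + r) / 2)) * ln x `^ (2 + r + 1))).
    by move: N xN; near: x; apply: up.
  rewrite (_ : - ((1 + r) / 2) = - be + - ((1 + r) / 2 - be)); last by ring.
  rewrite gt0_powRD// -mulrA ler_piMr ?powR_ge0//.
  by near: x; apply: near_powR_powR_ln => //; rewrite subr_gt0.
have rec : P [set w | tau X 1 w <> None] = 1%E.
  have mt := measurable_tau_fin hA0 1.
  have PC := probability_setC P mt.
  have mtC : measurable (~` [set w | tau X 1 w <> None]) by exact: measurableC.
  have C0 : fine (P (~` [set w | tau X 1 w <> None])) <= 0.
    apply/ler_addgt0Pr => e e0; rewrite add0r.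
    have h42 : (1 + r) / 4 < (1 + r) / 2 by move: al0; lra.
    have [x1 [_ Hx1]] := upw _ h42.
    have al40 : 0 < (1 + r) / 4 by move: al0; lra.
    have [x2 [_ Hx2]] := near_powR_small al40 e0.
    pose x := `|x1| + `|x2| + 1.
    have [N [N0 HN _]] : exists N : nat, [/\ (0 < N)%N, forall k, (x <= k%:R) = (N <= k)%N & N%:R <= x + 1].
      by apply: nat_ceil_ex; rewrite /x ltr_wpDl// addr_ge0.
    apply: (@le_trans _ _ (fine (P (alive X N)))).
      apply: le_prob => // w /= h; apply: tau1_alive; exact: contrapT.
    apply: (le_trans (Hx1 x _ N _)).
    - by rewrite /x; have := ler_norm x1; have := normr_ge0 x2; lra.
    - by rewrite HN.
    - by apply: Hx2; rewrite /x; have := ler_norm x2; have := normr_ge0 x1; lra.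
  have : fine (P (~` [set w | tau X 1 w <> None])) = 0.
    by apply/eqP; rewrite eq_le C0 fine_prob_ge0.
  move: PC; rewrite -(fineK (fin_num_prob P mt)) -(fineK (fin_num_prob P mtC)).
  rewrite -EFinB => -[->] /eqP; rewrite subr_eq0 => /eqP <-.
  by [].
have low ep := lower_tail hA0 hA1 hA2 hA3 hMp p2 r1 rp rec (ep := ep).
rewrite -/r in low.
split; [|split].
- move=> eps eps0; near=> x.
  have x0 : 0 < x by near: x; exact: nbhs_pinfty_gt.
  have [N [N0 HN Nx]] := nat_ceil_ex x0.
  rewrite -/(eta_tail X x) (eta_tailE X N0 HN) -(fineK (fin_num_prob P (mal N))) !lee_fin.
  split.
    by move: N Nx {N0 HN}; near: x; apply: low.
  have : x <= N%:R by rewrite HN.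
  by move: {Nx HN N0} N; near: x; apply: up.
- apply: (moment_infinite hA0 al0); apply: low; lra.
- move=> eps eps0.
  pose e' := Num.min eps ((1 + r) / 2) / 2.
  have m0 : 0 < Num.min eps ((1 + r) / 2) by rewrite lt_min eps0.
  have e1 : Num.min eps ((1 + r) / 2) <= eps by rewrite ge_min lexx.
  have e2 : Num.min eps ((1 + r) / 2) <= (1 + r) / 2 by rewrite ge_min lexx orbT.
  have fin : (\int[P]_w eta1_pow X ((1 + r) / 2 - e') w < +oo)%E.
    apply: (@moment_finite _ _ _ P S F X hA0 ((1 + r) / 2 - e' / 2)) => //.
    - by rewrite /e'; lra.
    - by rewrite /e'; lra.
    - by apply: upw; rewrite /e'; lra.
  apply: le_lt_trans fin; apply: ge0_le_integral => //.
  + by move=> w _; exact: eta1_pow_ge0.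
  + exact: (eta1_pow_measurable hA0).
  + exact: (eta1_pow_measurable hA0).
  move=> w _; have := @alive_ret_eta _ _ _ X w 1 (ltn0Sn 0).
  rewrite /eta1_pow; case: ret_eta => [m [h _]|_]; last exact: lexx.
  have m1 : (1 <= m)%N by apply: h => s /andP[s1 s1']; have := leq_trans s1 s1'.
  by rewrite lee_fin ler_powR ?ler1n// /e'; lra.
Unshelve. all: by end_near. Qed.
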